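(* For $\phi\in\mathcal{S}'(\mathbb{R}^{2d})$, the associated Cohen's class distribution $Q_\phi(\psi)=W(\psi,\psi)\ast\phi$ is given by $$Q_\phi(\psi)=(\psi\otimes\psi)\star L_\phi\qquad\text{for }\psi\in\mathcal{S}(\mathbb{R}^d),$$ where $L_\phi$ is the Weyl transform of $\phi$. Conversely, any operator $A\in\mathfrak{S}'$ determines a Cohen's class distribution by $$Q_A(\psi):=(\psi\otimes\psi)\star\check A\qquad\text{for }\psi\in\mathcal{S}(\mathbb{R}^d),$$ i.e. there is $\phi\in\mathcal{S}'(\mathbb{R}^{2d})$ with $Q_A(\psi)=W(\psi,\psi)\ast\phi$ for all $\psi\in\mathcal{S}(\mathbb{R}^d)$.
   Context: $\mathcal{S}$, $\mathcal{S}'$ denote Schwartz functions and tempered distributions. The cross-Wigner distribution is $W(\psi,\phi)(x,\omega)=\int_{\mathbb{R}^d}\psi(x+\frac t2)\overline{\phi(x-\frac t2)}e^{-2\pi i\omega\cdot t}\,dt$. A quadratic time-frequency distribution $Q$ is of Cohen's class if $Q(\psi)=Q_\phi(\psi):=W(\psi,\psi)\ast\phi$ for some $\phi\in\mathcal{S}'(\mathbb{R}^{2d})$. The Weyl transform $L_f$ of $f\in\mathcal{S}'(\mathbb{R}^{2d})$ is the operator $\mathcal{S}(\mathbb{R}^d)\to\mathcal{S}'(\mathbb{R}^d)$ given by $\langle L_f\psi,\phi\rangle=\langle f,W(\psi,\phi)\rangle$ for $\psi,\phi\in\mathcal{S}(\mathbb{R}^d)$, where the left pairing is antilinear in $\phi$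 (extending the $L^2$ inner product) and the right pairing is the bilinear one; $f$ is the Weyl symbol of $L_f$. $\mathfrak{S}$ (resp. $\mathfrak{S}'$) is the set of operators with Weyl symbol in $\mathcal{S}(\mathbb{R}^{2d})$ (resp. $\mathcal{S}'(\mathbb{R}^{2d})$); $\mathfrak{S}'$ is dual to $\mathfrak{S}$ via the bilinear pairing $\langle L_a,L_b\rangle_{\mathfrak{S}',\mathfrak{S}}=\langle a,b\rangle_{\mathcal{S}',\mathcal{S}}$, which extends $\mathrm{tr}(L_aL_b)$. $(\psi\otimes\psi)\zeta=\langle\zeta,\psi\rangle\psi$; $P\psi(x)=\psi(-x)$ and $\check A=PAP$; for $z=(x,\omega)\in\mathbb{R}^{2d}$, $\pi(z)\psi(t)=e^{2\pi i\omega\cdot t}\psi(t-x)$ and $\alpha_z(A)=\pi(z)A\pi(z)^*$. For $f\in\mathcal{S}(\mathbb{R}^{2d})$ and $S\in\mathfrak{S}$, $f\star S=\iint f(z)\alpha_z(S)\,dz\in\mathfrak{S}$. For trace class $S,T$, $S\star T(z)=\mathrm{tr}(S\alpha_z(\check T))$; for $S\in\mathfrak{S}$ and $A\in\mathfrak{S}'$ this is extended by duality: $S\star A\in\mathcal{S}'(\mathbb{R}^{2d})$ is given by $\langle S\star A,f\rangle_{\mathcal{S}',\mathcal{S}}=\langle A,f\star\check S\rangle_{\mathfrak{S}',\mathfrak{S}}$ for $f\in\mathcal{S}(\mathbb{R}^{2d})$. *)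

(* Defs.v *)
From HB Require Import structures.
From mathcomp Require Import all_boot all_order all_algebra.
From mathcomp Require Import complex.
From mathcomp Require Import all_classical all_reals all_analysis.

Set Implicit Arguments.
Unset Strict Implicit.
Unset Printing Implicit Defensive.
Import Order.TTheory GRing.Theory Num.Theory.
Import numFieldNormedType.Exports.

Local Open Scope classical_set_scope.
Local Open Scope ring_scope.

(* The product of Lebesgue measure on R with a measure on R^n, transported to
   R^(n+1) by (x, t) |-> x :: t. *)
Section lebesgue_cons.
Context {R : realType} {n : nat}.
Local Notation RT := (measurableTypeR R).
Variable mu : {sigma_finite_measure set (n.-tuple RT) -> \bar R}.

Definition tcons (p : RT * n.-tuple RT) : n.+1.-tuple RT :=
  [the n.+1.-tuple RT of p.1 :: p.2].

Definition lebesgue_cons : set (n.+1.-tuple RT) -> \bar R :=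
  pushforward (@lebesgue_measure R \x mu)%E tcons.

Lemma measurable_tcons : measurable_fun setT tcons.
Proof. by apply: measurable_cons. Qed.

Let preimage_tcons (A : set (n.+1.-tuple RT)) :
  measurable A -> measurable (tcons @^-1` A).
Proof. by move=> mA; rewrite -[X in measurable X]setTI; exact: measurable_tcons. Qed.

Let lebesgue_cons0 : lebesgue_cons set0 = 0%E.
Proof. by rewrite /lebesgue_cons /pushforward preimage_set0 measure0. Qed.

Let lebesgue_cons_ge0 A : (0 <= lebesgue_cons A)%E.
Proof. by rewrite /lebesgue_cons /pushforward measure_ge0. Qed.

Let lebesgue_cons_sigma_additive : semi_sigma_additive lebesgue_cons.
Proof.
move=> F mF tF mUF; rewrite /lebesgue_cons /pushforward preimage_bigcup.
apply: measure_semi_sigma_additive.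
- by move=> i; exact: preimage_tcons.
- apply/trivIsetP => /= i j _ _ ij; rewrite -preimage_setI.
  by move/trivIsetP : tF => /(_ _ _ _ _ ij) ->//; rewrite preimage_set0.
- by rewrite -preimage_bigcup; exact: preimage_tcons.
Qed.

HB.instance Definition _ := isMeasure.Build _ _ _ lebesgue_cons
  lebesgue_cons0 lebesgue_cons_ge0 lebesgue_cons_sigma_additive.

Let lebesgue_cons_sigma_finite : sigma_finite setT lebesgue_cons.
Proof.
have /sigma_finiteP[F [FT ndF Foo]] := sigma_finiteT (@lebesgue_measure R).
have /sigma_finiteP[G [GT ndG Goo]] := sigma_finiteT mu.
pose h (t : n.+1.-tuple RT) : RT * n.-tuple RT :=
  (tnth t ord0, [tuple of behead t]).
have mh : measurable_fun setT h.
  apply/measurable_fun_pairP; split; first exact: measurable_tnth.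
  exact: measurable_behead.
have hK p : h (tcons p) = p.
  by case: p => x t; congr pair; exact/val_inj.
exists (fun k => h @^-1` (F k `*` G k)).
  apply/esym; rewrite -subTset => t _.
  have [i _ Fi] : (\bigcup_k F k) (h t).1 by rewrite -FT.
  have [j _ Gj] : (\bigcup_k G k) (h t).2 by rewrite -GT.
  exists (maxn i j) => //; split.
  - by move: Fi; exact/subsetPset/ndF/leq_maxl.
  - by move: Gj; exact/subsetPset/ndG/leq_maxr.
move=> k; have [mF Fkoo] := Foo k; have [mG Gkoo] := Goo k; split.
  by rewrite -[X in measurable X]setTI; apply: mh => //; exact: measurableX.
rewrite /lebesgue_cons /pushforward (_ : _ @^-1` _ = F k `*` G k).
  by rewrite product_measure1E// lte_mul_pinfty// ge0_fin_numE.
by rewrite -comp_preimage (_ : h \o tcons = id)//; apply/funext.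
Qed.

HB.instance Definition _ := Measure_isSigmaFinite.Build _ _ _ lebesgue_cons
  lebesgue_cons_sigma_finite.

End lebesgue_cons.

Fixpoint lebesgue_tuple (R : realType) (n : nat) :
    {sigma_finite_measure set (n.-tuple (measurableTypeR R)) -> \bar R} :=
  match n with
  | 0 => dirac ([tuple] : 0.-tuple (measurableTypeR R))
  | n'.+1 => lebesgue_cons (lebesgue_tuple R n')
  end.

Section time_frequency.
Context {R : realType}.
Local Notation C := R[i].
Local Notation Re := (@complex.Re R).
Local Notation Im := (@complex.Im R).

Definition cfun (n : nat) := 'rV[R]_n -> C.

Definition rowt n (t : n.-tuple (measurableTypeR R)) : 'rV[R]_n :=
  \row_i tnth t i.

Definition cintegral n (f : cfun n) : C :=
  Complex (\int[lebesgue_tuple R n]_t Re (f (rowt t)))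
          (\int[lebesgue_tuple R n]_t Im (f (rowt t))).

Definition cis (a : R) : C := Complex (cos a) (sin a).

Definition dotp n (u v : 'rV[R]_n) : R := \sum_i u 0 i * v 0 i.

Definition conjf n (f : cfun n) : cfun n := fun x => conjc (f x).

Definition e_ n (i : 'I_n) : 'rV[R]_n := delta_mx 0 i.

Definition cpartial n (i : 'I_n) (f : cfun n) : cfun n := fun x =>
  Complex ('D_(e_ i) (Re \o f) x) ('D_(e_ i) (Im \o f) x).

Definition cpartials n (s : seq 'I_n) (f : cfun n) : cfun n :=
  foldr (@cpartial n) f s.

Definition smooth n : set (cfun n) := [set f | forall s : seq 'I_n,
  [/\ continuous (Re \o cpartials s f),
      continuous (Im \o cpartials s f) &
      forall i x, derivable (Re \o cpartials s f) x (e_ i) /\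
                  derivable (Im \o cpartials s f) x (e_ i)]].

Definition weighted n (k : nat) (s : seq 'I_n) (f : cfun n) : 'rV[R]_n -> R :=
  fun x => (1 + `|x|) ^+ k * Normc.normc (cpartials s f x).

Definition schwartz n : set (cfun n) := [set f | smooth f /\
  forall k s, has_ubound (range (weighted k s f))].

Definition seminorm n (k : nat) (s : seq 'I_n) (f : cfun n) : R :=
  sup (range (weighted k s f)).

(* Distributions are functionals of which only the values at Schwartz
   functions are meaningful; [eq_dist] is equality of distributions. *)
Definition functional (n : nat) := cfun n -> C.

Definition eq_dist n (T U : functional n) :=
  forall f, schwartz f -> T f = U f.

Definition linear_on_schwartz n (T : functional n) :=
  forall (a : C) (f g : cfun n), schwartz f -> schwartz g ->
    T (fun x => a * f x + g x) = a * T f + T g.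

(* Continuity for the locally convex topology generated by the seminorms. *)
Definition continuous_on_schwartz n (T : functional n) :=
  exists (c : R) (l : seq (nat * seq 'I_n)), forall f, schwartz f ->
    Normc.normc (T f) <= c * \sum_(p <- l) seminorm p.1 p.2 f.

Definition tempered n : set (functional n) := [set T |
  linear_on_schwartz T /\ continuous_on_schwartz T].

Definition dist_of n (g : cfun n) : functional n := fun f =>
  cintegral (fun x => g x * f x).

(* The pairing of a distribution with a function, antilinear in the latter,
   that extends the L^2 inner product; plain application is the bilinear
   pairing. *)
Definition apair n (T : functional n) (f : cfun n) : C := T (conjf f).

Definition inner n (f g : cfun n) : C :=
  cintegral (fun x => f x * conjc (g x)).

Definition reflect_fun n (f : cfun n) : cfun n := fun x => f (- x).

Definition reflect_dist n (T : functional n) : functional n := fun f =>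
  T (reflect_fun f).

Definition conv n (f g : cfun n) : cfun n := fun x =>
  cintegral (fun y => f y * g (x - y)).

(* <g * T, f> = <T, f * g^v> where g^v(x) = g(-x). *)
Definition conv_dist n (g : cfun n) (T : functional n) : functional n :=
  fun f => T (conv f (reflect_fun g)).

(* A phase space point z = (x, omega) is [row_mx x omega] : 'rV_(d + d). *)
Definition wigner d (psi phi : cfun d) : cfun (d + d) := fun z =>
  let x := lsubmx z in let omega := rsubmx z in
  cintegral (fun t => psi (x + 2^-1 *: t) * conjc (phi (x - 2^-1 *: t)) *
                      cis (- (2 * pi * dotp omega t))).

(* Operators from Schwartz functions to distributions; only the values at
   Schwartz functions are meaningful. *)
Definition operator (d : nat) := cfun d -> functional d.

Definition eq_op d (A B : operator d) :=
  forall psi, schwartz psi -> eq_dist (A psi) (B psi).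

(* The distribution L_f psi, for which
   <L_f psi, phi> = apair (weyl f psi) phi = f (wigner psi phi). *)
Definition weyl d (f : functional (d + d)) : operator d := fun psi phi =>
  f (wigner psi (conjf phi)).

Definition is_symbol d (A : operator d) (a : functional (d + d)) :=
  tempered a /\ eq_op A (weyl a).

Definition is_schwartz_symbol d (A : operator d) (a : cfun (d + d)) :=
  schwartz a /\ eq_op A (weyl (dist_of a)).

Definition frakS d : set (operator d) := [set A |
  exists a, is_schwartz_symbol A a].

Definition frakS' d : set (operator d) := [set A | exists a, is_symbol A a].

Definition symbol d (A : operator d) : functional (d + d) :=
  xget (fun=> 0) [set a | is_symbol A a].

Definition schwartz_symbol d (A : operator d) : cfun (d + d) :=
  xget (fun=> 0) [set a | is_schwartz_symbol A a].

(* <L_a, L_b> = <a, b> for A = L_a in frakS' and B = L_b in frakS. Symbols are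
   unique up to [eq_dist], so the value does not depend on the choice made by
   [xget]. *)
Definition op_pair d (A B : operator d) : C := symbol A (schwartz_symbol B).

Definition rank_one d (psi : cfun d) : operator d := fun zeta =>
  dist_of (fun x => inner zeta psi * psi x).

Definition check_op d (A : operator d) : operator d := fun psi =>
  reflect_dist (A (reflect_fun psi)).

Definition tfshift d (z : 'rV[R]_(d + d)) (psi : cfun d) : cfun d := fun t =>
  cis (2 * pi * dotp (rsubmx z) t) * psi (t - lsubmx z).

(* pi(z)^*, the inverse of the unitary pi(z). *)
Definition tfshift_adj d (z : 'rV[R]_(d + d)) (psi : cfun d) : cfun d :=
  fun t => cis (- (2 * pi * dotp (rsubmx z) (t + lsubmx z))) *
           psi (t + lsubmx z).

(* pi(z) on distributions: <pi(z) T, phi> = <T, pi(z)^* phi> in the antilinear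
   pairing. *)
Definition tfshift_dist d (z : 'rV[R]_(d + d)) (T : functional d) :
    functional d := fun phi => apair T (tfshift_adj z (conjf phi)).

Definition alpha d (z : 'rV[R]_(d + d)) (A : operator d) : operator d :=
  fun psi => tfshift_dist z (A (tfshift_adj z psi)).

(* The integral of f(z) alpha_z(S), in the weak sense. *)
Definition star_fun_op d (f : cfun (d + d)) (S : operator d) : operator d :=
  fun psi phi => cintegral (fun z => f z * alpha z S psi phi).

(* For S in frakS and A in frakS', by duality: <S * A, f> = <A, f * check S>. *)
Definition star_op_op d (S A : operator d) : functional (d + d) := fun f =>
  op_pair A (star_fun_op f (check_op S)).

Definition cohen d (phi : functional (d + d)) (psi : cfun d) :
    functional (d + d) := conv_dist (wigner psi psi) phi.

Definition cohen_class d (Q : cfun d -> functional (d + d)) :=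
  exists2 phi, tempered phi &
    forall psi, schwartz psi -> eq_dist (Q psi) (cohen phi psi).

End time_frequency.

Arguments cfun R n : clear implicits.
Arguments functional R n : clear implicits.
Arguments operator R d : clear implicits.

(* Main.v *)
(* The f-weighted average of the operators alpha_z (check (psi (x) psi)) has Weyl
   symbol f * W(psi, psi)^v: evaluated on W(zeta, conj eta) this is Moyal's identity
   int W(psi, psi)(y - w) W(zeta, conj eta)(w) dw = (int p) (int q), where p and q
   are the two factors of the rank-one matrix coefficient of alpha_y. Pairing
   with L_phi therefore yields <phi, f * W(psi, psi)^v>, which is the definition
   of <W(psi, psi) * phi, f>; for the converse, the symbol of check A is the
   reflection of the symbol of A.

   Since the pairing of operators refers to chosen symbols, Weyl symbols must be
   unique: a tempered T that vanishes on every W(psi, eta) vanishes. Let G be the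
   Wigner distribution of a Gaussian g. Modulated translates of G are Wigner
   distributions of time-frequency shifts of g, so T kills them. Averaging over
   the modulations (Fourier inversion) gives T(H G(. - u)) = 0 for every Schwartz
   H and every u; with H = F th(. - u), averaging over u gives
   (int G th) T(F) = 0 for all Schwartz th, whence T(F) = 0. *)
Require Import Defs.
From mathcomp Require Import all_boot all_order all_algebra.
From mathcomp Require Import complex.
From mathcomp Require Import all_classical all_reals all_analysis.
From mathcomp Require Import measurable_realfun.
From mathcomp Require Import ring lra.

Set Implicit Arguments.
Unset Strict Implicit.
Unset Printing Implicit Defensive.
Import Order.TTheory GRing.Theory Num.Theory.
Import numFieldNormedType.Exports.
Local Open Scope classical_set_scope.
Local Open Scope ring_scope.

(** * Derivatives along lines *)

Section derivatives_along_lines.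
Context {R : realType}.
Local Notation C := R[i].
Local Notation Re := (@complex.Re R).
Local Notation Im := (@complex.Im R).
Local Notation normc := (@Normc.normc R).

(** Schwartz functions and distributions are bare functions with predicates, and [smooth] speaks of
    derivatives along basis vectors only. Other directional derivatives and the closure properties
    of the Schwartz class rest on a coinduction principle, [schwartz_coind]: a family of rapidly
    decreasing functions stable under partial derivatives consists of Schwartz functions, so
    iterated derivatives are hardly ever computed. The measure on R^n is built coordinate by
    coordinate. Changes of variables are therefore reduced to scalings, translations and Fubini; the
    shear behind Moyal's identity becomes a translation at fixed t followed by a reflection. The
    delicate step is to move a tempered distribution past a parameter integral, which is done by
    Riemann sums controlled in every seminorm. Uniqueness of symbols uses modulated translates of a
    single G in order to avoid a density theorem for tensor products; all that is asked of G is G(0)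
    <> 0, and the Gaussian, which Fourier inversion uses anyway, makes this value explicit. *)

Lemma complexP (z w : C) : Re z = Re w -> Im z = Im w -> z = w.
Proof. by case: z w => a b [c d] /= -> ->. Qed.

Lemma cReM (z w : C) : Re (z * w) = Re z * Re w - Im z * Im w.
Proof. by case: z w => a b [c d]. Qed.

Lemma cImM (z w : C) : Im (z * w) = Re z * Im w + Im z * Re w.
Proof. by case: z w => a b [c d]. Qed.

Lemma cReD (z w : C) : Re (z + w) = Re z + Re w.
Proof. by case: z w => a b [c d]. Qed.

Lemma cImD (z w : C) : Im (z + w) = Im z + Im w.
Proof. by case: z w => a b [c d]. Qed.

Lemma cRe_conj (z : C) : Re (conjc z) = Re z.
Proof. by case: z. Qed.

Lemma cIm_conj (z : C) : Im (conjc z) = - Im z.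
Proof. by case: z. Qed.

Lemma normc_ge0 (z : C) : 0 <= normc z.
Proof. by case: z => a b; exact: sqrtr_ge0. Qed.

Lemma normc_Re (z : C) : `|Re z| <= normc z.
Proof.
by case: z => a b /=; rewrite -sqrtr_sqr ler_sqrt ?addr_ge0 ?sqr_ge0// lerDl sqr_ge0.
Qed.

Lemma normc_Im (z : C) : `|Im z| <= normc z.
Proof.
by case: z => a b /=; rewrite -sqrtr_sqr ler_sqrt ?addr_ge0 ?sqr_ge0// lerDr sqr_ge0.
Qed.

Lemma normc_real (a : R) : normc (Complex a 0) = `|a|.
Proof. by rewrite /= expr0n addr0 sqrtr_sqr. Qed.

Lemma normc_imag (a : R) : normc (Complex 0 a) = `|a|.
Proof. by rewrite /= expr0n add0r sqrtr_sqr. Qed.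

Lemma normc_le (z : C) : normc z <= `|Re z| + `|Im z|.
Proof.
case: z => a b.
have -> : Complex a b = Complex a 0 + Complex 0 b.
  by apply: complexP; rewrite /= ?addr0 ?add0r.
by rewrite (le_trans (le_normcD _ _))// normc_real normc_imag /= addr0 add0r.
Qed.

Lemma normc_conj (z : C) : normc (conjc z) = normc z.
Proof. by case: z => a b /=; rewrite sqrrN. Qed.

Lemma normc_cis (a : R) : normc (cis a) = 1.
Proof. by rewrite /cis /= cos2Dsin2 sqrtr1. Qed.

Lemma cisD (a b : R) : cis (a + b) = cis a * cis b.
Proof. by apply: complexP; rewrite /= ?cosD ?sinD//; ring. Qed.

Lemma cis0 : cis (0 : R) = 1.
Proof. by apply: complexP; rewrite /= ?cos0 ?sin0. Qed.

Lemma conj_cis (a : R) : conjc (cis a) = cis (- a).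
Proof. by apply: complexP; rewrite /= ?cosN ?sinN. Qed.

Lemma conjcM (z w : C) : conjc (z * w) = conjc z * conjc w.
Proof. exact: rmorphM. Qed.

(** Existence and value of the derivative are kept together, componentwise, so that product,
    substitution and integral rules transport both at once. *)
Definition cder n (f : cfun R n) (x v : 'rV[R]_n) (l : C) :=
  is_derive x v (Re \o f) (Re l) /\ is_derive x v (Im \o f) (Im l).

Lemma is_deriveE n (f : 'rV[R]_n -> R) x v l : is_derive x v f l <->
  (h^-1 * (f (h *: v + x) - f x)) @[h --> 0^'] --> l.
Proof.
split=> [[df <-]|fl]; first exact: df.
apply: DeriveDef; first by apply/cvg_ex; exists l.
exact: cvg_lim fl.
Qed.

(** Restriction to a line gives access to the one-variable theory: mean value theorem, chain rule,
    differentiation under the integral. *)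
Lemma is_derive_line n (f : 'rV[R]_n -> R) x v l (t : R) :
  is_derive (t *: v + x) v f l <-> is_derive t (1:R) (fun h : R => f (h *: v + x)) l.
Proof.
suff E : forall h : R, h^-1 * (f (h *: v + (t *: v + x)) - f (t *: v + x)) =
     h^-1 * (f ((h%:A + t) *: v + x) - f (t *: v + x)).
  have E' := funext E.
  split=> [/is_deriveE H|[H1 H2]].
    rewrite E' in H.
    by apply: DeriveDef; [apply/cvg_ex; exists l|apply: cvg_lim].
  by apply/is_deriveE; rewrite E' -H2; exact: H1.
by move=> h; rewrite addrA -scalerDl [_%:A]mulr1.
Qed.

Lemma is_derive_continuous (f : R -> R) (df : R -> R) :
  (forall x : R, is_derive x (1:R) f (df x)) -> continuous f.
Proof.
move=> H x; apply/differentiable_continuous/derivable1_diffP.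
by have [] := H x.
Qed.

(** Bounding [|c|] by [|h|] treats both signs of [h] uniformly, which is what limits over punctured
    neighbourhoods of 0 call for. *)
Lemma MVT_line n (f g : 'rV[R]_n -> R) v x (h : R) :
  (forall z, is_derive z v f (g z)) ->
  exists2 c, `|c| <= `|h| & f (h *: v + x) - f x = h * g (c *: v + x).
Proof.
move=> H.
have D (t : R) : is_derive t (1:R) (fun h : R => f (h *: v + x)) (g (t *: v + x)).
  exact/is_derive_line.
have K := is_derive_continuous D.
have [h0|h0] := leP 0 h.
  have [|c] := @MVT_segment _ _ _ 0 h h0 (fun t _ => D t).
    exact: continuous_subspaceT.
  rewrite in_itv/= => /andP[c0 ch] E; exists c.
    by rewrite !ger0_norm.
  by move: E; rewrite scale0r add0r subr0 => ->; rewrite mulrC.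
have [|c] := @MVT_segment _ _ _ h 0 (ltW h0) (fun t _ => D t).
  exact: continuous_subspaceT.
rewrite in_itv/= => /andP[c0 ch] E; exists c.
  by rewrite !ler0_norm ?lerN2// ltW.
move: E; rewrite scale0r add0r sub0r => E.
by rewrite -[LHS]opprB E mulrN opprK mulrC.
Qed.

Lemma rV_sum n (x : 'rV[R]_n) : x = \sum_i x 0 i *: e_ i.
Proof. exact: row_sum_delta. Qed.

Lemma coord_le n (x : 'rV[R]_n) i : `|x 0 i| <= `|x|.
Proof.
rewrite -[leRHS]/(mx_norm x) mx_normrE.
by apply: (@le_bigmax _ _ _ 0 (fun k : 'I_1 * 'I_n => `|x k.1 k.2|) (0, i)).
Qed.

Lemma norm_le_coord n (x : 'rV[R]_n) (M : R) : 0 <= M ->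
  (forall i, `|x 0 i| <= M) -> `|x| <= M.
Proof.
move=> M0 H; rewrite -[leLHS]/(mx_norm x) mx_normrE.
by apply: bigmax_le => // -[i j] _ /=; rewrite ord1.
Qed.

(** The increment is made one coordinate at a time, with the mean value theorem on each leg; the
    base point stays general because it moves with every leg. *)
Lemma lipschitz_coord n (f : 'rV[R]_n -> R) (g : 'I_n -> 'rV[R]_n -> R) (M : R) :
  (forall i x, is_derive x (e_ i) f (g i x)) -> (forall i x, `|g i x| <= M) ->
  forall x y : 'rV[R]_n, `|f (y + x) - f x| <= \sum_i `|y 0 i| * M.
Proof.
move=> H1 H2 x y; rewrite {1}(rV_sum y).
elim/big_ind2 : _ x => [x|a u b v Hu Hv x|i _ x].
- by rewrite add0r subrr normr0.
- rewrite (le_trans _ (lerD (Hu (v + x)) (Hv x)))//.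
  rewrite addrA (le_trans _ (ler_normD _ _))//.
  by rewrite addrA subrK.
- have [c _ ->] := MVT_line x (y 0 i) (H1 i).
  by rewrite normrM ler_wpM2l.
Qed.

Lemma lipschitz_continuous n (f : 'rV[R]_n -> R) (M : R) :
  (forall x y : 'rV[R]_n, `|f (y + x) - f x| <= M * `|y|) -> continuous f.
Proof.
move=> H x A /nbhs_ballP[e /= e0 Ae].
have K0 : 0 < Num.max M 1 by rewrite lt_max ltr01 orbT.
apply/nbhs_ballP; exists (e / Num.max M 1) => /=; first exact: divr_gt0.
move=> y; rewrite -ball_normE /= => xy.
apply: Ae; rewrite -ball_normE /= distrC.
have := H x (y - x); rewrite subrK => /le_lt_trans; apply.
rewrite (@le_lt_trans _ _ (Num.max M 1 * `|y - x|))//.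
  by rewrite ler_wpM2r// le_max lexx.
by rewrite mulrC -ltr_pdivlMr// distrC.
Qed.

(** Supplies the continuity clauses of [smooth] from derivatives alone: the partial derivatives of a
    rapidly decreasing family are bounded, so its members are Lipschitz. *)
Lemma bounded_partials_continuous n (f : 'rV[R]_n -> R)
    (g : 'I_n -> 'rV[R]_n -> R) (M : R) :
  (forall i x, is_derive x (e_ i) f (g i x)) -> (forall i x, `|g i x| <= M) ->
  continuous f.
Proof.
move=> H1 H2; apply: (@lipschitz_continuous _ _ (n%:R * `|M|)) => x y.
rewrite (le_trans (lipschitz_coord H1 H2 x y))//.
rewrite (@le_trans _ _ (\sum_(i < n) `|y| * `|M|))//.
  apply: ler_sum => i _; rewrite (@le_trans _ _ (`|y 0 i| * `|M|))//.
    by rewrite ler_wpM2l// ler_norm.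
  by rewrite ler_wpM2r// coord_le.
by rewrite sumr_const card_ord -[leLHS]mulr_natl mulrA mulrAC.
Qed.

(** The difference quotient splits into one along [v] at [x] and one along [w] at the moved point
    [h *: v + x]. The mean value theorem turns the second into a value of [g] near [x], and
    continuity of [g] gives the limit. *)
Lemma is_derive_addv n (f g : 'rV[R]_n -> R) x v w l :
  is_derive x v f l -> (forall z, is_derive z w f (g z)) ->
  {for x, continuous g} -> is_derive x (v + w) f (l + g x).
Proof.
move=> /is_deriveE H1 H2 cg; apply/is_deriveE.
have E (h : R) : h^-1 * (f (h *: (v + w) + x) - f x) =
   h^-1 * (f (h *: v + x) - f x) +
   h^-1 * (f (h *: w + (h *: v + x)) - f (h *: v + x)).
  by rewrite scalerDr -mulrDr [h *: v + h *: w]addrC -addrA addrC; congr (_ * _); ring.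
under eq_fun do rewrite E.
apply: cvgD => //.
apply/cvgrPdist_le => /= e e0.
have /cg/nbhs_ballP[d /= d0 Hd] := nbhsx_ballx (g x) e e0.
pose K := `|v| + `|w| + 1.
have K0 : 0 < K by rewrite ltr_wpDl// addr_ge0.
near=> h.
have h0 : h != 0 by near: h; exact: nbhs_dnbhs_neq.
have [c ch ->] := MVT_line (h *: v + x) h H2.
rewrite mulKf//; apply: ltW.
have := Hd (c *: w + (h *: v + x)); rewrite -!ball_normE /=; apply.
rewrite addrA [_ + x]addrC opprD addrA subrr sub0r.
rewrite normrN (le_lt_trans (ler_normD _ _))// !normrZ.
rewrite (@le_lt_trans _ _ (`|h| * K))//.
  have := ler_wpM2r (normr_ge0 w) ch; have := normr_ge0 h.
  by rewrite /K !mulrDr mulr1; lra.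
rewrite -ltr_pdivlMr//; near: h.
apply: dnbhs0_lt; exact: divr_gt0.
Unshelve. all: by end_near. Qed.

Lemma is_derive_scalev n (f : 'rV[R]_n -> R) x v l (a : R) :
  is_derive x v f l -> is_derive x (a *: v) f (a * l).
Proof.
have [->|a0] := eqVneq a 0.
  by rewrite scale0r mul0r => _; exact: is_derive0.
move=> /is_deriveE H; apply/is_deriveE.
have E (h : R) : h^-1 * (f (h *: (a *: v) + x) - f x) =
   a * ((h * a)^-1 * (f ((h * a) *: v + x) - f x)).
  rewrite scalerA; have [->|h0] := eqVneq h 0; last by field; rewrite a0.
  by rewrite mul0r !invr0 !mul0r mulr0.
under eq_fun do rewrite E.
apply: cvgZr.
have T : h * a @[h --> (0:R)^'] --> (0:R)^'.
  move=> A [e /= e0 He]; exists (e / `|a|) => /=.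
    by rewrite divr_gt0// normr_gt0.
  move=> h /=; rewrite sub0r normrN => he h0; apply: He => /=.
    by rewrite sub0r normrN normrM -ltr_pdivlMr// normr_gt0.
  by rewrite mulf_neq0.
exact: (cvg_comp _ _ T H).
Qed.

(** Needed for linear substitutions, which do not send basis vectors to basis vectors. Directions
    are added one coordinate at a time by [is_derive_addv]. *)
Lemma is_derive_dir n (f : 'rV[R]_n -> R) (g : 'I_n -> 'rV[R]_n -> R) :
  (forall i x, is_derive x (e_ i) f (g i x)) -> (forall i, continuous (g i)) ->
  forall x v, is_derive x v f (\sum_i v 0 i * g i x).
Proof.
move=> H1 H2 x v; rewrite {1}(rV_sum v).
elim: (index_enum _) x => [|i s IH] x.
  by rewrite !big_nil; exact: is_derive0.
rewrite !big_cons addrC [X in is_derive _ _ _ X]addrC.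
have H3 z : is_derive z (v 0 i *: e_ i) f (v 0 i * g i z).
  exact: is_derive_scalev.
have H4 : {for x, continuous (fun z => v 0 i * g i z)}.
  by apply: (@cvgZr _ _ _ (nbhs x) _ (v 0 i) (g i) (g i x)); exact: H2.
exact: (is_derive_addv (IH x) H3 H4).
Qed.

End derivatives_along_lines.

(** * Complex derivatives and Schwartz functions *)

Section complex_derivatives.
Context {R : realType}.
Local Notation C := R[i].
Local Notation Re := (@complex.Re R).
Local Notation Im := (@complex.Im R).
Local Notation normc := (@Normc.normc R).
Local Open Scope complex_scope.

Lemma cderD n (f g : cfun R n) x v a b :
  cder f x v a -> cder g x v b -> cder (fun x => f x + g x) x v (a + b).
Proof.
move=> [f1 f2] [g1 g2]; split; rewrite ?cReD ?cImD.
  have -> : Re \o (fun x => f x + g x) = (Re \o f) + (Re \o g).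
    by apply/funext => y /=; rewrite cReD.
  exact: is_deriveD.
have -> : Im \o (fun x => f x + g x) = (Im \o f) + (Im \o g).
  by apply/funext => y /=; rewrite cImD.
exact: is_deriveD.
Qed.

Lemma cderM n (f g : cfun R n) x v a b :
  cder f x v a -> cder g x v b ->
  cder (fun x => f x * g x) x v (a * g x + f x * b).
Proof.
move=> [f1 f2] [g1 g2]; split.
  have -> : Re \o (fun x => f x * g x) =
      (Re \o f) * (Re \o g) - (Im \o f) * (Im \o g).
    by apply/funext => y; rewrite !fctE /= cReM.
  apply: is_derive_eq (is_deriveB (is_deriveM f1 g1) (is_deriveM f2 g2)) _.
  rewrite cReD !cReM /comp -![_ *: _]/(_ * _); ring.
have -> : Im \o (fun x => f x * g x) =
    (Re \o f) * (Im \o g) + (Im \o f) * (Re \o g).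
  by apply/funext => y; rewrite !fctE /= cImM.
apply: is_derive_eq (is_deriveD (is_deriveM f1 g2) (is_deriveM f2 g1)) _.
rewrite cImD !cImM /comp -![_ *: _]/(_ * _); ring.
Qed.

Lemma cder_cst n (c : C) (x v : 'rV[R]_n) : cder (fun=> c) x v 0.
Proof. by split; exact: is_derive_cst. Qed.

Lemma cderZ n (f : cfun R n) x v a (c : C) :
  cder f x v a -> cder (fun x => c * f x) x v (c * a).
Proof. by move=> /(cderM (cder_cst c x v)); rewrite mul0r add0r. Qed.

Lemma cder_conj n (f : cfun R n) x v a :
  cder f x v a -> cder (conjf f) x v (conjc a).
Proof.
move=> [f1 f2]; split; rewrite ?cRe_conj ?cIm_conj.
  by have -> : Re \o conjf f = Re \o f by apply/funext => y /=; exact: cRe_conj.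
have -> : Im \o conjf f = - (Im \o f) by apply/funext => y; exact: cIm_conj.
exact: is_deriveN.
Qed.

(** A chain rule free of Fréchet differentials: [A] only has to map the line through [x] along [v]
    affinely onto the line along [w]. *)
Lemma is_derive_affine a b (A : 'rV[R]_a -> 'rV[R]_b) (f : 'rV[R]_b -> R)
    x v w l :
  (forall h : R, A (h *: v + x) = h *: w + A x) ->
  is_derive (A x) w f l -> is_derive x v (f \o A) l.
Proof.
move=> H /is_deriveE df; apply/is_deriveE => /=.
by under eq_fun do rewrite H.
Qed.

Lemma cder_affine a b (A : 'rV[R]_a -> 'rV[R]_b) (f : cfun R b) x v w l :
  (forall h : R, A (h *: v + x) = h *: w + A x) ->
  cder f (A x) w l -> cder (fun x => f (A x)) x v l.
Proof.
by move=> H [f1 f2]; split; [exact: (is_derive_affine H f1)|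
  exact: (is_derive_affine H f2)].
Qed.

(** Coordinates, phases and Gaussian exponents are polynomials of degree at most two, so along a
    line the difference quotient is exactly [h * k + l]. *)
Lemma is_derive_scalar_affine n (q : 'rV[R]_n -> R) x v (l k : R) :
  (forall h : R, q (h *: v + x) = q x + h * l + h ^+ 2 * k) ->
  is_derive x v q l.
Proof.
move=> H; apply/is_deriveE; under eq_fun do rewrite H.
have E : \forall h \near (0:R)^', h * k + l =
    h^-1 * (q x + h * l + h ^+ 2 * k - q x).
  near=> h; have h0 : h != 0 by near: h; exact: nbhs_dnbhs_neq.
  by field.
have H1 : h * k + l @[h --> (0:R)^'] --> 0 * k + l.
  apply: cvgD; last exact: cvg_cst.
  by apply: cvgMr_tmp; exact: nbhs_dnbhs.
rewrite mul0r add0r in H1; apply: cvg_trans H1.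
exact: near_eq_cvg E.
Unshelve. all: by end_near. Qed.

Lemma cder_coord n (i : 'I_n) (x v : 'rV[R]_n) :
  cder (fun x => (x 0 i)%:C) x v (v 0 i)%:C.
Proof.
split; last exact: is_derive_cst.
apply: (is_derive_scalar_affine (k := 0)) => h /=.
by rewrite !mxE; ring.
Qed.

Lemma cder_cis n (q : 'rV[R]_n -> R) x v l : is_derive x v q l ->
  cder (fun x => cis (q x)) x v (Complex 0 l * cis (q x)).
Proof.
move=> H.
have H0 : is_derive (0 : R) (1 : R) (fun h : R => q (h *: v + x)) l.
  by apply/is_derive_line; rewrite scale0r add0r.
have E : q (0 *: v + x) = q x by rewrite scale0r add0r.
split; rewrite -[X in is_derive X](add0r x) -(scale0r v); apply/is_derive_line.
  have -> : (fun h : R => (Re \o (fun x => cis (q x))) (h *: v + x)) =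
     cos \o (fun h : R => q (h *: v + x)) by [].
  apply: is_derive_eq; rewrite E cReM /= /GRing.scale /=; ring.
have -> : (fun h : R => (Im \o (fun x => cis (q x))) (h *: v + x)) =
   sin \o (fun h : R => q (h *: v + x)) by [].
apply: is_derive_eq; rewrite E cImM /= /GRing.scale /=; ring.
Qed.

Lemma cder_uniq n (f : cfun R n) x i a : cder f x (e_ i) a -> cpartial i f x = a.
Proof. by move=> [[_ H1] [_ H2]]; apply: complexP. Qed.

(** Schwartz decay of the function itself, with no derivative; [schwartz_coind] brings in the
    derivatives. *)
Definition rapid n (f : cfun R n) :=
  forall k, exists M, forall x, (1 + `|x|) ^+ k * normc (f x) <= M.

Lemma rapid_bounded n (f : cfun R n) :
  rapid f -> exists M, forall x, normc (f x) <= M.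
Proof.
by move=> /(_ 0%N)[M H]; exists M => x; have := H x; rewrite expr0 mul1r.
Qed.

Lemma partials_continuous n (f : cfun R n) (g : 'I_n -> cfun R n) :
  (forall i x, cder f x (e_ i) (g i x)) ->
  (forall i, exists M, forall x, normc (g i x) <= M) ->
  continuous (Re \o f) /\ continuous (Im \o f).
Proof.
move=> H1 /choice[M HM].
have K i x : normc (g i x) <= \sum_j `|M j|.
  rewrite (le_trans (HM i x))// (le_trans (ler_norm _))//.
  by rewrite (bigD1 i)//= lerDl sumr_ge0.
split; apply: bounded_partials_continuous.
- by move=> i x; exact: (H1 i x).1.
- by move=> i x; exact: le_trans (normc_Re _) (K i x).
- by move=> i x; exact: (H1 i x).2.
- by move=> i x; exact: le_trans (normc_Im _) (K i x).
Qed.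

(** The Schwartz class is the largest family of rapid functions closed under partial derivatives.
    Induction on [s] keeps every iterated derivative in [F], where decay is assumed, and its
    continuity follows because the next derivatives are bounded. *)
Lemma schwartz_coind n (F : set (cfun R n)) :
  (forall f, F f -> rapid f) ->
  (forall f i, F f -> exists2 g, F g & forall x, cder f x (e_ i) (g x)) ->
  forall f, F f -> schwartz f.
Proof.
move=> Fr Fd f Ff.
have Fs s : F (cpartials s f).
  elim: s => //= i s /(Fd _ i)[g Fg H].
  by have -> : cpartial i (cpartials s f) = g by apply/funext => x; exact: cder_uniq.
split=> [s|k s]; last first.
  by have [M HM] := Fr _ (Fs s) k; exists M => _ [x _ <-]; exact: HM.
have D i x : cder (cpartials s f) x (e_ i) (cpartials (i :: s) f x).
  by have [g _ H] := Fd _ i (Fs s); rewrite /= (cder_uniq (H x)).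
have [|c1 c2] := partials_continuous D.
  by move=> i; apply: rapid_bounded; exact: Fr.
split=> // i x; split.
  exact: (D i x).1.(ex_derive).
exact: (D i x).2.(ex_derive).
Qed.

Lemma schwartz_rapid n (f : cfun R n) : schwartz f -> rapid f.
Proof. by move=> [_ H] k; have [M HM] := H k [::]; exists M => x; apply: HM; exists x. Qed.

Lemma schwartz_cder n (f : cfun R n) i x :
  schwartz f -> cder f x (e_ i) (cpartial i f x).
Proof.
by move=> [H _]; have [_ _ /(_ i x)[H1 H2]] := H [::]; split;
  [exact: DeriveDef H1 erefl|exact: DeriveDef H2 erefl].
Qed.

Lemma schwartz_partial n (f : cfun R n) i : schwartz f -> schwartz (cpartial i f).
Proof.
(* [foldr] differentiates first in the last index of the list. *)
have E s : cpartials s (cpartial i f) = cpartials (rcons s i) f.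
  by rewrite /cpartials foldr_rcons.
move=> [H1 H2]; split=> [s|k s]; first by rewrite E; exact: H1.
by have := H2 k (rcons s i); rewrite /weighted E.
Qed.

Lemma schwartz_continuous n (f : cfun R n) : schwartz f ->
  continuous (Re \o f) /\ continuous (Im \o f).
Proof. by move=> [H _]; have [] := H [::]. Qed.

Lemma schwartz_dir n (f : cfun R n) x v : schwartz f ->
  cder f x v (\sum_i (v 0 i)%:C * cpartial i f x).
Proof.
move=> sf.
have ReS (F : 'I_n -> C) : Re (\sum_i F i) = \sum_i Re (F i).
  by elim/big_ind2 : _ => // a b c d <- <-; rewrite cReD.
have ImS (F : 'I_n -> C) : Im (\sum_i F i) = \sum_i Im (F i).
  by elim/big_ind2 : _ => // a b c d <- <-; rewrite cImD.
split; rewrite ?ReS ?ImS.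
  under eq_bigr do rewrite cReM /= mul0r subr0.
  apply: (@is_derive_dir _ _ (Re \o f) (fun i => Re \o cpartial i f)).
    by move=> i y; exact: (schwartz_cder i y sf).1.
  by move=> i; exact: (schwartz_continuous (schwartz_partial i sf)).1.
under eq_bigr do rewrite cImM /= mul0r addr0.
apply: (@is_derive_dir _ _ (Im \o f) (fun i => Im \o cpartial i f)).
  by move=> i y; exact: (schwartz_cder i y sf).2.
by move=> i; exact: (schwartz_continuous (schwartz_partial i sf)).2.
Qed.

End complex_derivatives.

(** * Closure properties of the Schwartz class *)

Section schwartz_stability.
Context {R : realType}.
Local Notation C := R[i].
Local Notation normc := (@Normc.normc R).
Local Open Scope complex_scope.

Lemma rapidL n (f g : cfun R n) (c : C) :
  rapid f -> rapid g -> rapid (fun x => c * f x + g x).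
Proof.
move=> Hf Hg k; have [A HA] := Hf k; have [B HB] := Hg k.
exists (normc c * A + B) => x.
rewrite (@le_trans _ _ (normc c * ((1 + `|x|) ^+ k * normc (f x)) +
   (1 + `|x|) ^+ k * normc (g x)))//; last first.
  by rewrite lerD// ler_wpM2l// normc_ge0.
rewrite mulrCA -mulrDr ler_wpM2l ?exprn_ge0 ?addr_ge0//.
by rewrite (le_trans (le_normcD _ _))// Normc.normcM.
Qed.

Lemma schwartzL n (f g : cfun R n) (c : C) :
  schwartz f -> schwartz g -> schwartz (fun x => c * f x + g x).
Proof.
move=> sf sg; apply: (@schwartz_coind _ _ [set h | exists f g,
    [/\ schwartz f, schwartz g & h = fun x => c * f x + g x]]); last first.
- by exists f, g.
- move=> _ i [f1 [g1 [s1 s2 ->]]]; exists (fun x => c * cpartial i f1 x + cpartial i g1 x).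
    by exists (cpartial i f1), (cpartial i g1); split=> //; exact: schwartz_partial.
  move=> x; apply: cderD; last exact: schwartz_cder.
  by apply: cderZ; exact: schwartz_cder.
- by move=> _ [f1 [g1 [s1 s2 ->]]]; apply: rapidL; exact: schwartz_rapid.
Qed.

Lemma schwartz0 n : schwartz (fun _ : 'rV[R]_n => 0 : C).
Proof.
apply: (@schwartz_coind _ _ [set fun=> 0]) => //.
- move=> _ -> k; exists 0 => x.
  by rewrite (_ : normc 0 = 0) ?mulr0//; exact: Normc.normc0.
- by move=> _ i ->; exists (fun=> 0) => // x; exact: cder_cst.
Qed.

Lemma schwartzZ n (f : cfun R n) (c : C) :
  schwartz f -> schwartz (fun x => c * f x).
Proof.
move=> /(schwartzL c)/(_ (schwartz0 n)).
by under [X in schwartz X -> _]eq_fun do rewrite addr0.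
Qed.

Lemma schwartzD n (f g : cfun R n) :
  schwartz f -> schwartz g -> schwartz (fun x => f x + g x).
Proof.
move=> sf /(schwartzL 1 sf).
by under [X in schwartz X -> _]eq_fun do rewrite mul1r.
Qed.

Lemma schwartzB n (f g : cfun R n) :
  schwartz f -> schwartz g -> schwartz (fun x => f x - g x).
Proof.
move=> sf sg; have := schwartzD sf (schwartzZ (-1) sg).
by under [X in schwartz X -> _]eq_fun do rewrite mulN1r.
Qed.

Lemma schwartz_sum n (I : Type) (s : seq I) (f : I -> cfun R n) :
  (forall i, schwartz (f i)) -> schwartz (fun x => \sum_(i <- s) f i x).
Proof.
move=> sf; elim: s => [|i s IH].
  by under eq_fun do rewrite big_nil; exact: schwartz0.
by under eq_fun do rewrite big_cons; exact: schwartzD.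
Qed.

Lemma rapid_mulx n (f : cfun R n) j : rapid f -> rapid (fun x => (x 0 j)%:C * f x).
Proof.
move=> Hf k; have [A HA] := Hf k.+1; exists A => x; apply: le_trans (HA x).
rewrite exprSr -mulrA ler_wpM2l ?exprn_ge0 ?addr_ge0// Normc.normcM.
rewrite ler_wpM2r ?normc_ge0// normc_real.
by rewrite (le_trans (coord_le _ _))// lerDr.
Qed.

(** The derivative of x_j f is x_j times a derivative of f plus a multiple of f without the factor
    x_j. The stable family therefore carries an additive Schwartz term; the coefficient 1 gives it
    the shape treated by [rapidL]. *)
Lemma schwartz_mulx n (f : cfun R n) j :
  schwartz f -> schwartz (fun x => (x 0 j)%:C * f x).
Proof.
move=> sf; apply: (@schwartz_coind _ _ [set h | exists f g,
    [/\ schwartz f, schwartz g & h = fun x : 'rV[R]_n => 1 * ((x 0 j)%:C * f x) + g x]]); last first.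
- exists f, (fun=> 0); split => //; first exact: schwartz0.
  by apply/funext => x; rewrite mul1r addr0.
- move=> _ i [f1 [g1 [s1 s2 ->]]].
  exists (fun x : 'rV[R]_n => 1 * ((x 0 j)%:C * cpartial i f1 x) +
      (((e_ i : 'rV[R]_n) 0 j)%:C * f1 x + cpartial i g1 x)).
    exists (cpartial i f1), (fun x => ((e_ i : 'rV[R]_n) 0 j)%:C * f1 x + cpartial i g1 x).
    split=> //; first exact: schwartz_partial.
    by apply: schwartzL => //; exact: schwartz_partial.
  move=> x; rewrite addrA mul1r [_ * cpartial _ _ _ + _]addrC.
  apply: cderD; last exact: schwartz_cder.
  under eq_fun do rewrite mul1r.
  by apply: cderM; [exact: cder_coord|exact: schwartz_cder].
- move=> _ [f1 [g1 [s1 s2 ->]]]; apply: rapidL; last exact: schwartz_rapid.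
  by apply: rapid_mulx; exact: schwartz_rapid.
Qed.

(** A predicate on plain functions, so that maps assembled from [row_mx], [lsubmx] and [rsubmx] can
    be used as they are. *)
Definition lin a b (L : 'rV[R]_a -> 'rV[R]_b) :=
  forall k x y, L (k *: x + y) = k *: L x + L y.

Lemma lin_sum a b (L : 'rV[R]_a -> 'rV[R]_b) x : lin L ->
  L x = \sum_i x 0 i *: L (e_ i).
Proof.
move=> H; rewrite {1}(rV_sum x); have H0 : L 0 = 0.
  by have := H 1 0 0; rewrite !scale1r addr0 => /eqP; rewrite -subr_eq0 opprD addrA subrr sub0r oppr_eq0 => /eqP.
elim: (index_enum _) => [|i s IH]; first by rewrite !big_nil.
by rewrite !big_cons H IH.
Qed.

Lemma schwartz_mullin n (f : cfun R n) (l : 'rV[R]_n -> 'rV[R]_1) (b : R) : lin l ->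
  schwartz f -> schwartz (fun x => (l x 0 0 + b)%:C * f x).
Proof.
move=> H sf.
have -> : (fun x => (l x 0 0 + b)%:C * f x) =
    (fun x => \sum_i (l (e_ i) 0 0)%:C * ((x 0 i)%:C * f x) + b%:C * f x).
  apply/funext => x; rewrite rmorphD mulrDl; congr (_ + _).
  rewrite (lin_sum x H) summxE rmorph_sum mulr_suml; apply: eq_bigr => i _.
  by rewrite mxE rmorphM mulrAC mulrC mulrA.
apply: schwartzD; last exact: schwartzZ.
by apply: schwartz_sum => i; apply: schwartzZ; exact: schwartz_mulx.
Qed.

Lemma schwartz_conj n (f : cfun R n) : schwartz f -> schwartz (conjf f).
Proof.
move=> sf; apply: (@schwartz_coind _ _ [set conjf f | f in @schwartz R n]); last first.
- by exists f.
- move=> _ i [f1 s1 <-]; exists (conjf (cpartial i f1)).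
    by exists (cpartial i f1) => //; exact: schwartz_partial.
  by move=> x; apply: cder_conj; exact: schwartz_cder.
- move=> _ [f1 s1 <-] k; have [M HM] := schwartz_rapid s1 k.
  by exists M => x; rewrite normc_conj; exact: HM.
Qed.

Lemma norm_row_mx m n (x : 'rV[R]_m) (y : 'rV[R]_n) :
  1 + `|row_mx x y| <= (1 + `|x|) * (1 + `|y|).
Proof.
have H : `|row_mx x y| <= `|x| + `|y|.
  apply: norm_le_coord; first by rewrite addr_ge0.
  move=> i; rewrite mxE; case: splitP => j _.
    by rewrite (le_trans (coord_le _ _))// lerDl.
  by rewrite (le_trans (coord_le _ _))// lerDr.
rewrite mulrDl mul1r mulrDr mulr1 -addrA lerD2l addrA.
by rewrite (le_trans H)// [`|y| + _]addrC lerDl mulr_ge0.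
Qed.

Lemma rapid_tens m n (f : cfun R m) (g : cfun R n) : rapid f -> rapid g ->
  rapid (fun z : 'rV_(m + n) => f (lsubmx z) * g (rsubmx z)).
Proof.
move=> Hf Hg k; have [A HA] := Hf k; have [B HB] := Hg k.
exists (A * B) => z.
rewrite (@le_trans _ _ (((1 + `|lsubmx z|) ^+ k * normc (f (lsubmx z))) *
   ((1 + `|rsubmx z|) ^+ k * normc (g (rsubmx z)))))//; last first.
  by rewrite ler_pM// mulr_ge0 ?normc_ge0 ?exprn_ge0 ?addr_ge0.
rewrite mulrACA -exprMn -Normc.normcM ler_wpM2r ?normc_ge0//.
rewrite lerXn2r ?nnegrE ?addr_ge0 ?mulr_ge0 ?addr_ge0//.
by rewrite -{1}[z]hsubmxK norm_row_mx.
Qed.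

Lemma schwartz_tens m n (f : cfun R m) (g : cfun R n) : schwartz f -> schwartz g ->
  schwartz (fun z : 'rV_(m + n) => f (lsubmx z) * g (rsubmx z)).
Proof.
move=> sf sg; apply: (@schwartz_coind _ _ [set h | exists f g,
    [/\ schwartz f, schwartz g & h = fun z => f (lsubmx z) * g (rsubmx z)]]); last first.
- by exists f, g.
- move=> _ i [f1 [g1 [s1 s2 ->]]].
  have AL z h : lsubmx (h *: (e_ i : 'rV[R]_(m + n)) + z) = h *: lsubmx (e_ i) + lsubmx z.
    by rewrite linearD linearZ.
  have AR z h : rsubmx (h *: (e_ i : 'rV[R]_(m + n)) + z) = h *: rsubmx (e_ i) + rsubmx z.
    by rewrite linearD linearZ.
  case: (split_ordP i) AL AR => j -> AL AR.
    exists (fun z => cpartial j f1 (lsubmx z) * g1 (rsubmx z)).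
      by exists (cpartial j f1), g1; split=> //; exact: schwartz_partial.
    move=> z.
    have -> : cpartial j f1 (lsubmx z) * g1 (rsubmx z) =
      cpartial j f1 (lsubmx z) * g1 (rsubmx z) + f1 (lsubmx z) * 0 by rewrite mulr0 addr0.
    apply: cderM.
      apply: (cder_affine (AL z)).
      have -> : lsubmx (e_ (lshift n j)) = e_ j :> 'rV[R]_m.
        by apply/rowP => l; rewrite !mxE eqxx /= (inj_eq (@lshift_inj _ _)).
      exact: schwartz_cder.
    apply: (cder_affine (AR z)).
    have -> : rsubmx (e_ (lshift n j)) = 0 :> 'rV[R]_n.
      by apply/rowP => l; rewrite !mxE eqxx /= eq_rlshift.
    by split; exact: is_derive0.
  exists (fun z => f1 (lsubmx z) * cpartial j g1 (rsubmx z)).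
    by exists f1, (cpartial j g1); split=> //; exact: schwartz_partial.
  move=> z.
  have -> : f1 (lsubmx z) * cpartial j g1 (rsubmx z) =
    0 * g1 (rsubmx z) + f1 (lsubmx z) * cpartial j g1 (rsubmx z) by rewrite mul0r add0r.
  apply: cderM.
    apply: (cder_affine (AL z)).
    have -> : lsubmx (e_ (rshift m j)) = 0 :> 'rV[R]_m.
      by apply/rowP => l; rewrite !mxE eqxx /= eq_lrshift.
    by split; exact: is_derive0.
  apply: (cder_affine (AR z)).
  have -> : rsubmx (e_ (rshift m j)) = e_ j :> 'rV[R]_n.
    by apply/rowP => l; rewrite !mxE eqxx /= (inj_eq (@rshift_inj _ _)).
  exact: schwartz_cder.
- by move=> _ [f1 [g1 [s1 s2 ->]]]; apply: rapid_tens; exact: schwartz_rapid.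
Qed.

(** One more power of the weight costs f and the functions x_i f, since |x| is at most the sum of
    the |x_i|. Decay thus reduces to boundedness of a family stable under the coordinates. *)
Lemma rapid_of_mulx n (F : set (cfun R n)) :
  (forall f, F f -> exists M, forall x, normc (f x) <= M) ->
  (forall f i, F f -> F (fun x => (x 0 i)%:C * f x)) ->
  forall f, F f -> rapid f.
Proof.
move=> Fb Fx f Ff k; elim: k f Ff => [|k IH] f Ff.
  by have [M H] := Fb _ Ff; exists M => x; rewrite expr0 mul1r.
have [A HA] := IH _ Ff.
have /choice[B HB] : forall i, exists B, forall x : 'rV[R]_n,
    (1 + `|x|) ^+ k * normc ((x 0 i)%:C * f x) <= B.
  by move=> i; exact: IH (Fx _ i Ff).
exists (A + \sum_i `|B i|) => x.
have e0 : 0 <= (1 + `|x|) ^+ k by rewrite exprn_ge0// addr_ge0.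
rewrite exprSr -mulrA mulrDl mul1r mulrDr lerD//.
have HN : `|x| <= \sum_i `|x 0 i|.
  apply: norm_le_coord => [|i]; first by rewrite sumr_ge0.
  by rewrite (bigD1 i)//= lerDl sumr_ge0.
rewrite (@le_trans _ _ ((1 + `|x|) ^+ k * ((\sum_i `|x 0 i|) * normc (f x))))//.
  by rewrite ler_wpM2l// ler_wpM2r// normc_ge0.
rewrite mulr_suml mulr_sumr ler_sum// => i _.
rewrite (le_trans _ (ler_norm _))// (le_trans _ (HB i x))//.
by rewrite Normc.normcM normc_real.
Qed.

(** Because of the left inverse, x_i = M(L x)_i is a linear combination of the coordinates of L x,
    so multiplication by x_i acts on [f] before the substitution. As [L] is only injective,
    restrictions to slices and to the diagonal are included. *)
Lemma schwartz_affine a b (f : cfun R b) (L : 'rV[R]_a -> 'rV[R]_b)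
    (M : 'rV[R]_b -> 'rV[R]_a) (c : 'rV[R]_b) : lin L -> lin M -> cancel L M ->
  schwartz f -> schwartz (fun x => f (L x + c)).
Proof.
move=> lL lM LM sf.
pose F : set (cfun R a) := [set h | exists2 f, schwartz f & h = fun x => f (L x + c)].
have MS y i : M y 0 i = \sum_k M (e_ k) 0 i * y 0 k.
  by rewrite (lin_sum y lM) summxE; apply: eq_bigr => k _; rewrite mxE mulrC.
apply: (@schwartz_coind _ _ F); last by exists f.
- apply: rapid_of_mulx => [_ [g sg ->]|_ i [g sg ->]].
    by have [B HB] := rapid_bounded (schwartz_rapid sg); exists B => x.
  exists (fun y : 'rV[R]_b => \sum_k (M (e_ k) 0 i)%:C * ((y 0 k)%:C * g y + (- c 0 k)%:C * g y)).
    apply: schwartz_sum => k; apply/schwartzZ/schwartzD; first exact: schwartz_mulx.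
    exact: schwartzZ.
  apply/funext => x; rewrite -{1}(LM x) MS rmorph_sum mulr_suml.
  apply: eq_bigr => k _; rewrite rmorphM -mulrA -mulrDl -rmorphD; congr (_ * (_%:C * _)).
  by rewrite mxE addrK.
- move=> _ i [g sg ->].
  exists (fun x => \sum_k (L (e_ i) 0 k)%:C * cpartial k g (L x + c)).
    exists (fun y => \sum_k (L (e_ i) 0 k)%:C * cpartial k g y) => //.
    by apply: schwartz_sum => k; apply/schwartzZ; exact: schwartz_partial.
  move=> x; apply: (@cder_affine _ _ _ (fun x => L x + c) _ _ _ (L (e_ i))).
    by move=> h; rewrite lL addrA.
  exact: schwartz_dir.
Qed.

Lemma schwartz_lin a b (f : cfun R b) (L : 'rV[R]_a -> 'rV[R]_b)
    (M : 'rV[R]_b -> 'rV[R]_a) : lin L -> lin M -> cancel L M ->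
  schwartz f -> schwartz (fun x => f (L x)).
Proof.
move=> lL lM LM /(schwartz_affine 0 lL lM LM).
by under [X in schwartz X -> _]eq_fun do rewrite addr0.
Qed.

(** The product is the restriction of the tensor product to the diagonal. *)
Lemma schwartz_mul n (f g : cfun R n) : schwartz f -> schwartz g ->
  schwartz (fun x => f x * g x).
Proof.
move=> sf sg; have := @schwartz_lin n (n + n) _ (fun x => row_mx x x) lsubmx _ _ _ (schwartz_tens sf sg).
under [X in schwartz X]eq_fun do rewrite row_mxKl row_mxKr.
apply.
- by move=> k x y; rewrite scale_row_mx add_row_mx.
- by move=> k x y; rewrite linearD linearZ.
- by move=> x; rewrite row_mxKl.
Qed.

(** When the gradient of [q] is affine, differentiating [cis q] only produces an affine factor,
    which the Schwartz function absorbs; the family of all [cis q] times Schwartz is stable. *)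
Lemma schwartz_phase n (f : cfun R n) (q : 'rV[R]_n -> R)
    (l : 'I_n -> 'rV[R]_n -> 'rV[R]_1) (b : 'I_n -> R) :
  (forall i, lin (l i)) ->
  (forall i x, is_derive x (e_ i) q (l i x 0 0 + b i)) ->
  schwartz f -> schwartz (fun x => cis (q x) * f x).
Proof.
move=> Hl Hq sf; apply: (@schwartz_coind _ _ [set h | exists2 f, schwartz f &
    h = fun x => cis (q x) * f x]); last first.
- by exists f.
- move=> _ i [g sg ->].
  exists (fun x => cis (q x) * (Complex 0 1 * ((l i x 0 0 + b i)%:C * g x) + cpartial i g x)).
    exists (fun x => Complex 0 1 * ((l i x 0 0 + b i)%:C * g x) + cpartial i g x) => //.
    by apply: schwartzL; [exact: schwartz_mullin|exact: schwartz_partial].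
  move=> x; rewrite mulrDr.
  have -> : cis (q x) * (Complex 0 1 * ((l i x 0 0 + b i)%:C * g x)) =
      Complex 0 (l i x 0 0 + b i) * cis (q x) * g x.
    rewrite !mulrA; congr (_ * _); rewrite -mulrA mulrC; congr (_ * _).
    by apply: complexP; rewrite /= ?mul0r ?mul1r ?mulr0 ?subr0 ?add0r ?addr0.
  by apply: cderM; [exact: cder_cis|exact: schwartz_cder].
- move=> _ [g sg ->] k; have [M HM] := schwartz_rapid sg k.
  by exists M => x; rewrite Normc.normcM normc_cis mul1r; exact: HM.
Qed.

Lemma dotpDl n (u v w : 'rV[R]_n) : dotp (u + v) w = dotp u w + dotp v w.
Proof. by rewrite /dotp -big_split; apply: eq_bigr => i _; rewrite mxE mulrDl. Qed.

Lemma dotpC n (u v : 'rV[R]_n) : dotp u v = dotp v u.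
Proof. by apply: eq_bigr => i _; rewrite mulrC. Qed.

Lemma dotpDr n (u v w : 'rV[R]_n) : dotp w (u + v) = dotp w u + dotp w v.
Proof. by rewrite dotpC dotpDl !(dotpC _ w). Qed.

Lemma dotpZl n (u v : 'rV[R]_n) k : dotp (k *: u) v = k * dotp u v.
Proof. by rewrite /dotp mulr_sumr; apply: eq_bigr => i _; rewrite mxE mulrA. Qed.

Lemma dotpZr n (u v : 'rV[R]_n) k : dotp u (k *: v) = k * dotp u v.
Proof. by rewrite dotpC dotpZl dotpC. Qed.

Lemma dotpNl n (u v : 'rV[R]_n) : dotp (- u) v = - dotp u v.
Proof. by rewrite -scaleN1r dotpZl mulN1r. Qed.

Lemma dotpNr n (u v : 'rV[R]_n) : dotp u (- v) = - dotp u v.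
Proof. by rewrite dotpC dotpNl dotpC. Qed.

Lemma dotp0l n (v : 'rV[R]_n) : dotp 0 v = 0.
Proof. by rewrite /dotp big1// => i _; rewrite mxE mul0r. Qed.

(** Covers both modulations (one argument of [dotp] constant) and the Fourier kernel in two
    variables. The scalar gradient is wrapped by [%:M] as a 1-by-1 row to be [lin]. *)
Lemma schwartz_cis_dotp n m (f : cfun R n) (L M : 'rV[R]_n -> 'rV[R]_m) (c c' : 'rV[R]_m) (k : R) :
  lin L -> lin M -> schwartz f ->
  schwartz (fun x => cis (k * dotp (L x + c) (M x + c')) * f x).
Proof.
move=> lL lM sf.
apply: (@schwartz_phase _ _ _
   (fun i x => (k * (dotp (L (e_ i)) (M x) + dotp (L x) (M (e_ i))))%:M)
   (fun i => k * (dotp (L (e_ i)) c' + dotp c (M (e_ i))))) => //.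
- move=> i h x y; apply/rowP => j; rewrite !mxE !ord1 eqxx !mulr1n.
  by rewrite lL lM !(dotpDl, dotpDr, dotpZl, dotpZr); ring.
- move=> i x; apply: (is_derive_scalar_affine (k := k * dotp (L (e_ i)) (M (e_ i)))) => h.
  rewrite mxE eqxx mulr1n lL lM !(dotpDl, dotpDr, dotpZl, dotpZr).
  by ring.
Qed.

End schwartz_stability.

(** * Integration on R^n *)

Section complex_integral.
Context {R : realType}.
Local Notation C := R[i].
Local Notation Re := (@complex.Re R).
Local Notation Im := (@complex.Im R).
Local Notation normc := (@Normc.normc R).
Local Open Scope complex_scope.

(** The form of [cintegral] for an arbitrary measure, used for single coordinates and for product
    measures. *)
Definition cint d (T : measurableType d) (mu : {measure set T -> \bar R})
    (D : set T) (f : T -> C) : C :=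
  Complex (\int[mu]_(t in D) Re (f t)) (\int[mu]_(t in D) Im (f t)).

Definition cintegrable d (T : measurableType d) (mu : {measure set T -> \bar R})
    (D : set T) (f : T -> C) :=
  mu.-integrable D (EFin \o (Re \o f)) /\ mu.-integrable D (EFin \o (Im \o f)).

Section generic.
Context d (T : measurableType d) (mu : {measure set T -> \bar R}) (D : set T).
Hypothesis mD : measurable D.

Lemma eq_cint (f g : T -> C) : (forall t, D t -> f t = g t) ->
  cint mu D f = cint mu D g.
Proof.
by move=> H; congr Complex; apply: eq_Rintegral => t /set_mem Dt; rewrite H.
Qed.

Lemma cintegrable_dom (f : T -> C) (G : T -> R) :
  measurable_fun D (Re \o f) -> measurable_fun D (Im \o f) ->
  mu.-integrable D (EFin \o G) -> (forall t, D t -> normc (f t) <= G t) ->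
  cintegrable mu D f.
Proof.
move=> m1 m2 iG H; split.
  apply: le_integrable iG => //; first exact/measurable_EFinP.
  move=> t Dt; rewrite /= lee_fin (le_trans (normc_Re _))//.
  by rewrite (le_trans (H t Dt))// ler_norm.
apply: le_integrable iG => //; first exact/measurable_EFinP.
move=> t Dt; rewrite /= lee_fin (le_trans (normc_Im _))//.
by rewrite (le_trans (H t Dt))// ler_norm.
Qed.

(** The factor 2 comes from estimating the real and imaginary parts separately. *)
Lemma normc_cint (f : T -> C) (G : T -> R) : cintegrable mu D f ->
  mu.-integrable D (EFin \o G) -> (forall t, D t -> normc (f t) <= G t) ->
  normc (cint mu D f) <= 2 * \int[mu]_(t in D) G t.
Proof.
move=> [i1 i2] iG H; rewrite (le_trans (normc_le _))//= mulr2n mulrDl mul1r.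
apply: lerD.
  rewrite (le_trans (le_normr_Rintegral mD i1))//.
  apply: le_Rintegral => //; first exact: integrable_norm.
  by move=> t Dt; exact: le_trans (normc_Re _) (H t Dt).
rewrite (le_trans (le_normr_Rintegral mD i2))//.
apply: le_Rintegral => //; first exact: integrable_norm.
by move=> t Dt; exact: le_trans (normc_Im _) (H t Dt).
Qed.

Lemma cintegrableD (f g : T -> C) : cintegrable mu D f -> cintegrable mu D g ->
  cintegrable mu D (fun t => f t + g t).
Proof.
move=> [f1 f2] [g1 g2]; split.
  have -> : EFin \o (Re \o (fun t => f t + g t)) =
      (EFin \o (Re \o f)) \+ (EFin \o (Re \o g)).
    by apply/funext => t /=; rewrite cReD.
  exact: integrableD.
have -> : EFin \o (Im \o (fun t => f t + g t)) =
    (EFin \o (Im \o f)) \+ (EFin \o (Im \o g)).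
  by apply/funext => t /=; rewrite cImD.
exact: integrableD.
Qed.

Lemma cintD (f g : T -> C) : cintegrable mu D f -> cintegrable mu D g ->
  cint mu D (fun t => f t + g t) = cint mu D f + cint mu D g.
Proof.
move=> [f1 f2] [g1 g2]; apply: complexP; rewrite /= -RintegralD//.
  by apply: eq_Rintegral => t _; rewrite cReD.
by apply: eq_Rintegral => t _; rewrite cImD.
Qed.

Lemma cintZ (f : T -> C) (c : C) : cintegrable mu D f ->
  cint mu D (fun t => c * f t) = c * cint mu D f.
Proof.
have iZ (k : R) (h : T -> R) : mu.-integrable D (EFin \o h) ->
    mu.-integrable D (EFin \o (fun t => k * h t)).
  by move=> ih; apply: (@integrableZl _ _ _ mu D mD k (EFin \o h)).
move=> [f1 f2]; apply: complexP; rewrite ?cReM ?cImM /= -!RintegralZl//.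
  rewrite -RintegralB//; [|exact: iZ..].
  by apply: eq_Rintegral => t _; rewrite cReM.
rewrite -RintegralD//; [|exact: iZ..].
by apply: eq_Rintegral => t _; rewrite cImM.
Qed.

End generic.

Section cfubini.
Context d1 d2 (T1 : measurableType d1) (T2 : measurableType d2).
Variable m1 : {sigma_finite_measure set T1 -> \bar R}.
Variable m2 : {sigma_finite_measure set T2 -> \bar R}.

(** The inner integrals are finite for every [x], not just almost every one, so [fine] can be undone
    pointwise when passing from extended to real values. *)
Lemma Rintegral_prod1 (f : T1 * T2 -> R) :
  (m1 \x m2)%E.-integrable setT (EFin \o f) ->
  (forall x, m2.-integrable setT (fun y => (f (x, y))%:E)) ->
  \int[m1]_x \int[m2]_y f (x, y) = \int[(m1 \x m2)%E]_z f z.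
Proof.
move=> i1 i2; rewrite /Rintegral -(integral12_prod_meas1 i1); congr fine.
apply: eq_integral => x _; rewrite /fubini_F fineK//.
exact: integrable_fin_num.
Qed.

Lemma Rintegral_prod2 (f : T1 * T2 -> R) :
  (m1 \x m2)%E.-integrable setT (EFin \o f) ->
  (forall y, m1.-integrable setT (fun x => (f (x, y))%:E)) ->
  \int[m2]_y \int[m1]_x f (x, y) = \int[(m1 \x m2)%E]_z f z.
Proof.
move=> i1 i2; rewrite /Rintegral -(integral21_prod_meas1 i1); congr fine.
apply: eq_integral => x _; rewrite /fubini_G fineK//.
exact: integrable_fin_num.
Qed.

Lemma cint_prod1 (f : T1 * T2 -> C) :
  cintegrable (m1 \x m2)%E setT f ->
  (forall x, cintegrable m2 setT (fun y => f (x, y))) ->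
  cint m1 setT (fun x => cint m2 setT (fun y => f (x, y))) =
  cint (m1 \x m2)%E setT f.
Proof.
move=> [i1 i2] H; apply: complexP => /=.
  by rewrite -(Rintegral_prod1 i1) => [|x]; last exact: (H x).1.
by rewrite -(Rintegral_prod1 i2) => [|x]; last exact: (H x).2.
Qed.

Lemma cint_prod2 (f : T1 * T2 -> C) :
  cintegrable (m1 \x m2)%E setT f ->
  (forall y, cintegrable m1 setT (fun x => f (x, y))) ->
  cint m2 setT (fun y => cint m1 setT (fun x => f (x, y))) =
  cint (m1 \x m2)%E setT f.
Proof.
move=> [i1 i2] H; apply: complexP => /=.
  by rewrite -(Rintegral_prod2 i1) => [|x]; last exact: (H x).1.
by rewrite -(Rintegral_prod2 i2) => [|x]; last exact: (H x).2.
Qed.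

Lemma integrable_prod (u : T1 -> R) (v : T2 -> R) :
  (forall x, 0 <= u x) -> (forall y, 0 <= v y) ->
  m1.-integrable setT (EFin \o u) -> m2.-integrable setT (EFin \o v) ->
  (m1 \x m2)%E.-integrable setT (EFin \o (fun z => u z.1 * v z.2)).
Proof.
move=> u0 v0 iu iv.
have mu : measurable_fun setT u by apply/measurable_EFinP; exact: measurable_int iu.
have mv : measurable_fun setT v by apply/measurable_EFinP; exact: measurable_int iv.
apply/integrable12ltyP.
  by apply/measurable_EFinP; apply: measurable_funM; exact: measurableT_comp.
rewrite /=.
under eq_integral => x _.
  under eq_integral do rewrite ger0_norm ?mulr_ge0// EFinM.
  rewrite ge0_integralZl//=; last 3 first.
  - exact/measurable_EFinP.
  - by move=> y _; rewrite lee_fin.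
  - by rewrite lee_fin.
  over.
rewrite /= ge0_integralZr//=.
- rewrite lte_mul_pinfty//.
  + by apply: integral_ge0 => x _; rewrite lee_fin.
  + exact: integrable_fin_num.
  + exact: integrable_lty.
- exact/measurable_EFinP.
- by move=> y _; rewrite lee_fin.
- by apply: integral_ge0 => x _; rewrite lee_fin.
Qed.

End cfubini.

Definition consr n (s : R) (x : 'rV[R]_n) : 'rV[R]_n.+1 := row_mx s%:M x : 'rV_(1 + n).

Lemma consr0 n s (x : 'rV[R]_n) : consr s x 0 ord0 = s.
Proof.
have -> : ord0 = lshift n ord0 :> 'I_(1 + n) by exact/val_inj.
by rewrite [LHS](row_mxEl (s%:M : 'rV_1) x 0 ord0) mxE eqxx mulr1n.
Qed.

Lemma consrS n s (x : 'rV[R]_n) (i : 'I_n) : consr s x 0 (lift ord0 i) = x 0 i.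
Proof.
have -> : lift ord0 i = rshift 1 i :> 'I_(1 + n) by exact/val_inj.
exact: (row_mxEr (s%:M : 'rV_1) x 0 i).
Qed.

Lemma rowt_cons n (p : R * n.-tuple (measurableTypeR R)) :
  rowt (tcons p) = consr p.1 (rowt p.2).
Proof.
case: p => s t; apply/rowP => i; rewrite mxE.
case: (unliftP ord0 i) => [j|] ->; last by rewrite consr0.
by rewrite consrS mxE /tcons tnthS.
Qed.

(** Links the topology of rows with the product sigma-algebra of tuples: an open set is a countable
    union of sup-norm balls with rational centres and radii 1/(k+1), and such a ball pulls back to a
    finite intersection of coordinate conditions. *)
Lemma preimage_rowt_measurable n (U : set 'rV[R]_n) : open U ->
  measurable (@rowt R n @^-1` U).
Proof.
move=> oU.
pose q2r (q : n.-tuple rat) : 'rV[R]_n := \row_i ratr (tnth q i).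
pose B (qk : n.-tuple rat * nat) : set 'rV[R]_n := ball (q2r qk.1) (qk.2.+1%:R^-1).
pose F (qk : n.-tuple rat * nat) : set (n.-tuple (measurableTypeR R)) :=
  if `[< B qk `<=` U >] then @rowt R n @^-1` B qk else set0.
have -> : @rowt R n @^-1` U = \bigcup_qk F qk.
  apply/seteqP; split=> [t /= Ut|t [qk _]]; last first.
    by rewrite /F; case: asboolP => // BU Bt; exact: BU.
  have /nbhs_ballP[e /= e0 He] : nbhs (rowt t) U by exact: open_nbhs_nbhs.
  (* Half of [e], because a ball of radius 1/(k+1) that contains the point reaches at most 2/(k+1)
     away from it. *)
  have [k Hk] : exists k, k.+1%:R^-1 < e / 2.
    exists (Num.trunc (e / 2)^-1).
    by rewrite invf_plt ?posrE ?divr_gt0// truncnS_gt.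
  have kp : (0:R) < k.+1%:R^-1 by rewrite invr_gt0.
  have /choice[q Hq] : forall i, exists q : rat, `|rowt t 0 i - ratr q| < k.+1%:R^-1.
    move=> i; have [|q] := @rat_in_itvoo R (rowt t 0 i - k.+1%:R^-1) (rowt t 0 i + k.+1%:R^-1).
      by rewrite ltrBlDr -addrA ltrDl addr_gt0.
    rewrite in_itv /= => /andP[q1 q2]; exists q; rewrite ltr_norml.
    apply/andP; move: q1 q2; move: (ratr q : R) (_^-1) (rowt t 0 i) => u v w ? ?.
    by split; lra.
  exists ([tuple q i | i < n], k) => //; rewrite /F.
  have Bt : B ([tuple q i | i < n], k) (rowt t).
    split => // i j; rewrite !ord1 /= mxE tnth_mktuple /ball /= distrC.
    exact: Hq.
  case: asboolP => //; case=> y By; apply: He.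
  have := ball_triangle (ball_sym Bt) By.
  by apply: le_ball; rewrite /=; move: Hk; move: (_^-1) => u; lra.
apply: countable_bigcupT_measurable => [|qk].
  exact: countableP.
rewrite /F; case: asboolP => // _.
have -> : @rowt R n @^-1` B qk = \bigcap_(i in [set: 'I_n])
    ((@tnth n (measurableTypeR R) ^~ i) @^-1` (ball (ratr (tnth qk.1 i) : R) qk.2.+1%:R^-1)).
  apply/seteqP; split=> t.
    by move=> [_ H] i _ /=; have := H 0 i; rewrite !mxE.
  by move=> H; split; [rewrite invr_gt0|move=> i j; rewrite !mxE; exact: H].
apply: fin_bigcap_measurable => // i _.
rewrite -[X in measurable X]setTI; apply: measurable_tnth => //.
exact: measurable_ball.
Qed.

Lemma measurable_rowt n (f : 'rV[R]_n -> R) : continuous f ->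
  measurable_fun setT (fun t : n.-tuple (measurableTypeR R) => f (rowt t)).
Proof.
move=> /continuousP cf; apply: (measurability _ (RGenOpens.measurableE R)).
move=> _ [_ [a [b ->] <-]]; rewrite setTI.
apply: (@preimage_rowt_measurable _ (f @^-1` `]a, b[)).
exact/cf/interval_open.
Qed.

(* An integrable majorant that factors over the coordinates. *)
Definition maj n (x : 'rV[R]_n) : R := \prod_i (oneDsqr (x 0 i))^-1.

Lemma maj_gt0 n (x : 'rV[R]_n) : 0 < maj x.
Proof. by apply: prodr_gt0 => i _; rewrite invr_gt0 (lt_le_trans ltr01)// oneDsqr_ge1. Qed.

Lemma maj_cons n s (x : 'rV[R]_n) : maj (consr s x) = (oneDsqr s)^-1 * maj x.
Proof.
rewrite /maj big_ord_recl consr0; congr (_ * _).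
by apply: eq_bigr => i _; rewrite consrS.
Qed.

Lemma integrable_inv_oneDsqr :
  (@lebesgue_measure R).-integrable setT (EFin \o (fun s => (oneDsqr s)^-1)).
Proof.
apply/integrableP; split.
  apply/measurable_EFinP; apply: continuous_measurable_fun.
  exact: continuous_oneDsqrV.
rewrite /=; under eq_integral do rewrite ger0_norm ?invr_ge0 ?(le_trans ler01)// ?oneDsqr_ge1//.
rewrite (@ge0_symfun_integralT _ (fun s => (oneDsqr s)^-1)).
- rewrite (_ : [set x | _] = `[0, +oo[%classic); last first.
    by apply/seteqP; split => x/=; rewrite in_itv/= andbT.
  by rewrite integral0y_oneDsqr -EFinM ltry.
- by move=> x; rewrite invr_ge0 (le_trans ler01)// oneDsqr_ge1.
- exact: continuous_oneDsqrV.
- by move=> x/=; rewrite /oneDsqr sqrrN.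
Qed.

Lemma measurable_maj n :
  measurable_fun setT (fun t : n.-tuple (measurableTypeR R) => maj (rowt t)).
Proof.
rewrite /maj; elim: (index_enum _) => [|i s IH].
  by under eq_fun do rewrite big_nil; exact: measurable_cst.
under eq_fun do rewrite big_cons mxE.
apply: measurable_funM => //.
apply: (@measurableT_comp _ _ _ _ _ _ (fun s : measurableTypeR R => (oneDsqr s)^-1)).
  by apply: continuous_measurable_fun; exact: continuous_oneDsqrV.
exact: measurable_tnth.
Qed.

Lemma integral_lebesgue_cons n (f : n.+1.-tuple (measurableTypeR R) -> \bar R) :
  measurable_fun setT f -> (forall t, 0 <= f t)%E ->
  (\int[lebesgue_tuple R n.+1]_t f t =
   \int[@lebesgue_measure R]_s \int[lebesgue_tuple R n]_t f (tcons (s, t)))%E.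
Proof.
move=> mf f0.
have mt := @measurable_tcons R n.
rewrite -(@fubini_tonelli1 _ _ _ _ _ (@lebesgue_measure R) (lebesgue_tuple R n) (f \o tcons)).
- by rewrite /= /lebesgue_cons ge0_integral_pushforward.
- exact: measurableT_comp.
- by move=> x; exact: f0.
Qed.

(** By Tonelli each coordinate contributes one factor, the finite integral of 1/(1 + s^2). *)
Lemma integrable_maj n : (lebesgue_tuple R n).-integrable setT
  (EFin \o (fun t => maj (rowt t))).
Proof.
have M k (t : k.-tuple (measurableTypeR R)) : 0 <= maj (rowt t).
  exact/ltW/maj_gt0.
elim: n => [|n IH]; apply/integrableP; split.
- apply/measurable_EFinP; exact: measurable_maj.
- rewrite /= integral_dirac//; last first.
    apply/measurable_EFinP.
    exact: (measurableT_comp (@normr_measurable R setT) (@measurable_maj 0)).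
  by rewrite diracT mul1e ltry.
- apply/measurable_EFinP; exact: measurable_maj.
- rewrite integral_lebesgue_cons//; last first.
    by apply: measurableT_comp => //; apply/measurable_EFinP; exact: measurable_maj.
  have E s (t : n.-tuple (measurableTypeR R)) :
      (`|(maj (rowt (tcons (s, t))))%:E| = (oneDsqr s)^-1%:E * (maj (rowt t))%:E)%E.
    rewrite rowt_cons /= maj_cons ger0_norm ?EFinM//.
    by rewrite mulr_ge0 ?M// invr_ge0 (le_trans ler01)// oneDsqr_ge1.
  have E2 s : (\int[lebesgue_tuple R n]_t `|(maj (rowt (tcons (s, t))))%:E| =
      (oneDsqr s)^-1%:E * \int[lebesgue_tuple R n]_t (maj (rowt t))%:E)%E.
    under eq_integral => t _ do rewrite E.
    rewrite ge0_integralZl//=.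
    - apply/measurable_EFinP; exact: measurable_maj.
    - by move=> y _; rewrite lee_fin.
  under eq_integral => s _ do rewrite /= E2.
  rewrite ge0_integralZr//=.
  + rewrite lte_mul_pinfty//.
    * by apply: integral_ge0 => x _; rewrite lee_fin invr_ge0 (le_trans ler01)// oneDsqr_ge1.
    * exact: integrable_fin_num integrable_inv_oneDsqr.
    * exact: integrable_lty IH.
  + apply/measurable_EFinP; apply: continuous_measurable_fun; exact: continuous_oneDsqrV.
  + by apply: integral_ge0 => x _; rewrite lee_fin.
Qed.

(** Decay of order 2n is enough: the product of the n factors 1 + x_i^2 is at most (1 +
    |x|)^(2n). *)
Lemma rapid_maj n (f : cfun R n) : rapid f ->
  exists2 M, 0 <= M & forall x, normc (f x) <= M * maj x.
Proof.
move=> /(_ (2 * n)%N)[M HM]; exists M => [|x].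
  by rewrite (le_trans _ (HM 0))// mulr_ge0 ?normc_ge0 ?exprn_ge0 ?addr_ge0.
rewrite -ler_pdivrMr ?maj_gt0// mulrC (le_trans _ (HM x))//.
rewrite ler_wpM2r ?normc_ge0// /maj -prodfV.
rewrite exprM -[X in _ ^+ X]card_ord -prodr_const.
apply: ler_prod => i _; rewrite invrK (le_trans ler01) ?oneDsqr_ge1//=.
have := coord_le x i; rewrite /oneDsqr sqrrD expr1n mul1r => H.
rewrite -real_normK ?num_real// -addrA lerD2l.
rewrite (@le_trans _ _ (`|x| ^+ 2))// ?lerXn2r ?nnegrE//.
by rewrite lerDr mulrn_wge0.
Qed.

Definition integrable_rV m (f : cfun R m) :=
  cintegrable (lebesgue_tuple R m) setT (f \o @rowt R m).

Lemma schwartz_integrable n (f : cfun R n) : schwartz f -> integrable_rV f.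
Proof.
move=> sf; have [M M0 HM] := rapid_maj (schwartz_rapid sf).
have [c1 c2] := schwartz_continuous sf.
apply: (@cintegrable_dom _ _ _ _ _ _ (fun t => M * maj (rowt t))) => //.
- exact: (measurable_rowt c1).
- exact: (measurable_rowt c2).
- exact: (@integrableZl _ _ _ _ _ _ M (EFin \o (fun t => maj (rowt t)))) (integrable_maj n).
- by move=> t _; exact: HM.
Qed.

Lemma cintegralE n (f : cfun R n) :
  cintegral f = cint (lebesgue_tuple R n) setT (f \o @rowt R n).
Proof. by []. Qed.

Definition tcat m n (p : m.-tuple (measurableTypeR R) * n.-tuple (measurableTypeR R)) :=
  [the (m + n).-tuple (measurableTypeR R) of p.1 ++ p.2].

Lemma measurable_tcat m n : measurable_fun setT
  (fun p : m.-tuple (measurableTypeR R) * n.-tuple (measurableTypeR R) =>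
     tcat p).
Proof.
apply/measurable_fun_tnthP => i.
case: (split_ordP i) => j ->.
  rewrite (_ : _ \o _ = fun p => tnth p.1 j).
    exact: (measurableT_comp (measurable_tnth j) measurable_fst).
  by apply/funext => p /=; exact: tnth_lshift.
rewrite (_ : _ \o _ = fun p => tnth p.2 j).
  exact: (measurableT_comp (measurable_tnth j) measurable_snd).
by apply/funext => p /=; exact: tnth_rshift.
Qed.

Lemma rowt_cat m n (s : m.-tuple (measurableTypeR R)) (t : n.-tuple (measurableTypeR R)) :
  rowt (tcat (s, t)) = row_mx (rowt s) (rowt t).
Proof.
apply/rowP => i; case: (split_ordP i) => j ->.
  by rewrite row_mxEl !mxE /tcat tnth_lshift.
by rewrite row_mxEr !mxE /tcat tnth_rshift.
Qed.

End complex_integral.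

(** * Fubini and affine substitution for Schwartz functions *)

Section change_of_variables.
Context {R : realType}.
Local Notation C := R[i].
Local Notation Re := (@complex.Re R).
Local Notation Im := (@complex.Im R).
Local Open Scope complex_scope.
Local Notation leb := (@lebesgue_measure R).

Lemma integrableRZ d (T : measurableType d) (mu : {measure set T -> \bar R})
    (D : set T) (G : T -> R) (M : R) : measurable D ->
  mu.-integrable D (EFin \o G) -> mu.-integrable D (EFin \o (fun t => M * G t)).
Proof. by move=> mD iG; exact: (@integrableZl _ _ _ _ _ mD M (EFin \o G)). Qed.

Lemma oneDsqr_gt0 (s : R) : 0 < oneDsqr s.
Proof. by rewrite (lt_le_trans ltr01)// oneDsqr_ge1. Qed.

Lemma inv_oneDsqr_ge0 (s : R) : 0 <= (oneDsqr s)^-1.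
Proof. by rewrite invr_ge0 ltW// oneDsqr_gt0. Qed.

Lemma inv_oneDsqr_le1 (s : R) : (oneDsqr s)^-1 <= 1.
Proof. by rewrite invf_le1 ?oneDsqr_ge1 ?oneDsqr_gt0. Qed.

Lemma maj_le1 n (x : 'rV[R]_n) : maj x <= 1.
Proof.
suff : 0 <= maj x <= 1 by case/andP.
rewrite /maj; elim/big_ind : _ => [|a b /andP[a0 a1] /andP[b0 b1]|i _].
- by rewrite ler01 lexx.
- by rewrite mulr_ge0// mulr_ile1.
- by rewrite inv_oneDsqr_ge0 inv_oneDsqr_le1.
Qed.

Lemma schwartz_line_continuous n (f : cfun R n) v x : schwartz f ->
  continuous (fun s : R => Re (f (s *: v + x))) /\
  continuous (fun s : R => Im (f (s *: v + x))).
Proof.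
move=> sf; split.
  apply: is_derive_continuous => s; apply/(@is_derive_line _ _ (Re \o f)).
  exact: (schwartz_dir (s *: v + x) v sf).1.
apply: is_derive_continuous => s; apply/(@is_derive_line _ _ (Im \o f)).
exact: (schwartz_dir (s *: v + x) v sf).2.
Qed.

Lemma consrE n s (x : 'rV[R]_n) : consr s x = s *: e_ ord0 + consr 0 x.
Proof.
apply/rowP => i; rewrite [RHS]mxE [X in X + _]mxE; case: (unliftP ord0 i) => [j|] ->.
  by rewrite !consrS mxE /= mulr0 add0r.
by rewrite !consr0 mxE /= mulr1 addr0.
Qed.

Lemma maj_row_mx m n (x : 'rV[R]_m) (y : 'rV[R]_n) : maj (row_mx x y) = maj x * maj y.
Proof.
rewrite /maj big_split_ord; congr (_ * _); apply: eq_bigr => i _.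
  by rewrite row_mxEl.
by rewrite row_mxEr.
Qed.

Lemma schwartz_slice m n (F : cfun R (m + n)) x : schwartz F ->
  schwartz (fun y : 'rV_n => F (row_mx x y)).
Proof.
move=> sF; have := @schwartz_affine R n (m + n) F (fun y => row_mx 0 y) rsubmx (row_mx x 0).
under [X in _ -> _ -> _ -> _ -> schwartz X]eq_fun do rewrite add_row_mx add0r addr0.
apply=> //.
- by move=> k u v; rewrite scale_row_mx add_row_mx scaler0 addr0.
- by move=> k u v; rewrite linearD linearZ.
- by move=> y; rewrite row_mxKr.
Qed.

Lemma schwartz_slicel m n (F : cfun R (m + n)) y : schwartz F ->
  schwartz (fun x : 'rV_m => F (row_mx x y)).
Proof.
move=> sF; have := @schwartz_affine R m (m + n) F (fun x => row_mx x 0) lsubmx (row_mx 0 y).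
under [X in _ -> _ -> _ -> _ -> schwartz X]eq_fun do rewrite add_row_mx add0r addr0.
apply=> //.
- by move=> k u v; rewrite scale_row_mx add_row_mx scaler0 addr0.
- by move=> k u v; rewrite linearD linearZ.
- by move=> x; rewrite row_mxKl.
Qed.

Lemma schwartz_consr n (F : cfun R n.+1) s : schwartz F ->
  schwartz (fun y => F (consr s y)).
Proof. exact: (@schwartz_slice 1 n F). Qed.

Section swap.
Variables (m n : nat) (F : cfun R (m + n)).
Hypothesis sF : schwartz F.
Local Notation lm := (lebesgue_tuple R m).
Local Notation ln := (lebesgue_tuple R n).

Let Fp (p : m.-tuple (measurableTypeR R) * n.-tuple (measurableTypeR R)) :=
  F (row_mx (rowt p.1) (rowt p.2)).

Let cintegrable_Fp : cintegrable (lm \x ln)%E setT Fp.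
Proof.
have [M M0 HM] := rapid_maj (schwartz_rapid sF).
have [c1 c2] := schwartz_continuous sF.
have H (f : 'rV[R]_(m + n) -> R) : continuous f ->
    measurable_fun setT (fun p : m.-tuple (measurableTypeR R) * n.-tuple (measurableTypeR R) =>
      f (row_mx (rowt p.1) (rowt p.2))).
  move=> cf; rewrite (_ : (fun p => _) = (fun t => f (rowt t)) \o @tcat R m n).
    apply: measurableT_comp; first exact: measurable_rowt.
    exact: measurable_tcat.
  by apply/funext => -[p q] /=; rewrite rowt_cat.
apply: (@cintegrable_dom _ _ _ _ _ _ _ (fun p => M * (maj (rowt p.1) * maj (rowt p.2)))) => //.
- exact: (H _ c1).
- exact: (H _ c2).
- apply: integrableRZ => //.
  apply: (@integrable_prod _ _ _ _ _ lm ln (fun t => maj (rowt t)) (fun t => maj (rowt t))).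
  + by move=> t; exact/ltW/maj_gt0.
  + by move=> t; exact/ltW/maj_gt0.
  + exact: integrable_maj.
  + exact: integrable_maj.
- by move=> p _; rewrite -maj_row_mx; exact: HM.
Qed.

(** Slices of a Schwartz function are Schwartz, so every inner integral converges; joint
    integrability comes from [maj], which factors over the two blocks. *)
Lemma cintegral_swap :
  cintegral (fun x => cintegral (fun y => F (row_mx x y))) =
  cintegral (fun y => cintegral (fun x => F (row_mx x y))).
Proof.
rewrite !cintegralE.
transitivity (cint (lm \x ln)%E setT Fp).
  apply: (cint_prod1 cintegrable_Fp) => t.
  exact: (schwartz_integrable (schwartz_slice (rowt t) sF)).
apply/esym; apply: (cint_prod2 cintegrable_Fp) => t.
exact: (schwartz_integrable (schwartz_slicel (rowt t) sF)).
Qed.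

End swap.

Section cons.
Variables (n : nat) (F : cfun R n.+1).
Hypothesis sF : schwartz F.
Local Notation ln := (lebesgue_tuple R n).

Lemma cintegrable_consr x : cintegrable leb setT (fun s => F (consr s x)).
Proof.
have [M M0 HM] := rapid_maj (schwartz_rapid sF).
have [c1 c2] := schwartz_continuous sF.
have [d1 d2] := schwartz_line_continuous (e_ ord0) (consr 0 x) sF.
apply: (@cintegrable_dom _ _ _ _ _ _ _ (fun s : measurableTypeR R => M * (oneDsqr s)^-1)) => //.
- rewrite (_ : _ \o _ = fun s : R => Re (F (s *: e_ ord0 + consr 0 x))).
    exact: continuous_measurable_fun.
  by apply/funext => s; rewrite /= [consr s x]consrE.
- rewrite (_ : _ \o _ = fun s : R => Im (F (s *: e_ ord0 + consr 0 x))).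
    exact: continuous_measurable_fun.
  by apply/funext => s; rewrite /= [consr s x]consrE.
- by apply: integrableRZ => //; exact: integrable_inv_oneDsqr.
- move=> s _; rewrite (le_trans (HM _))// maj_cons ler_wpM2l//.
  by rewrite ler_piMr ?maj_le1// inv_oneDsqr_ge0.
Qed.

Let Fp (p : measurableTypeR R * n.-tuple (measurableTypeR R)) :=
  F (consr p.1 (rowt p.2)).

Let cintegrable_Fp : cintegrable (leb \x ln)%E setT Fp.
Proof.
have [M M0 HM] := rapid_maj (schwartz_rapid sF).
have [c1 c2] := schwartz_continuous sF.
have H (f : 'rV[R]_(n.+1) -> R) : continuous f ->
    measurable_fun setT (fun p : measurableTypeR R * n.-tuple (measurableTypeR R) =>
      f (consr p.1 (rowt p.2))).
  move=> cf; rewrite (_ : (fun p => _) = (fun t => f (rowt t)) \o @tcons R n).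
    apply: measurableT_comp; first exact: measurable_rowt.
    exact: measurable_tcons.
  by apply/funext => p /=; rewrite rowt_cons.
apply: (@cintegrable_dom _ _ _ _ _ _ _ (fun p : measurableTypeR R * n.-tuple (measurableTypeR R) =>
    M * ((oneDsqr p.1)^-1 * maj (rowt p.2)))) => //.
- exact: (H _ c1).
- exact: (H _ c2).
- apply: integrableRZ => //.
  apply: (@integrable_prod _ _ _ _ _ leb ln (fun s => (oneDsqr s)^-1) (fun t => maj (rowt t))).
  + by move=> t; exact: inv_oneDsqr_ge0.
  + by move=> t; exact/ltW/maj_gt0.
  + exact: integrable_inv_oneDsqr.
  + exact: integrable_maj.
- by move=> p _; rewrite -maj_cons; exact: HM.
Qed.

Let cintegral_Fp : cintegral F = cint (leb \x ln)%E setT Fp.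
Proof.
have [c1 c2] := schwartz_continuous sF; have [i1 i2] := cintegrable_Fp.
have H (f : 'rV[R]_n.+1 -> R) : continuous f ->
    (leb \x ln)%E.-integrable setT (EFin \o (fun p => f (consr p.1 (rowt p.2)))) ->
    \int[lebesgue_tuple R n.+1]_t f (rowt t) =
    \int[(leb \x ln)%E]_p f (consr p.1 (rowt p.2)).
  move=> cf iF.
  have E : EFin \o (fun p => f (consr p.1 (rowt p.2))) =
      (EFin \o (fun t => f (rowt t))) \o @tcons R n.
    by apply/funext => p /=; rewrite rowt_cons.
  rewrite /Rintegral /= /lebesgue_cons.
  rewrite (@integral_pushforward _ _ _ _ _ _ (@measurable_tcons R n) (leb \x ln)%E setT
     (EFin \o (fun t => f (rowt t)))).
  - by rewrite -E.
  - by apply/measurable_EFinP; exact: measurable_rowt.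
  - by rewrite preimage_setT -E.
  - by [].
by apply: complexP; [exact: (H _ c1 i1)|exact: (H _ c2 i2)].
Qed.

Lemma cintegral_cons1 :
  cintegral F = cint leb setT (fun s => cintegral (fun x => F (consr s x))).
Proof.
rewrite cintegral_Fp; apply/esym; apply: (cint_prod1 cintegrable_Fp) => s.
exact: (schwartz_integrable (schwartz_consr s sF)).
Qed.

Lemma cintegral_cons2 :
  cintegral F = cintegral (fun x => cint leb setT (fun s => F (consr s x))).
Proof.
rewrite cintegral_Fp; apply/esym; apply: (cint_prod2 cintegrable_Fp) => t.
exact: (cintegrable_consr (rowt t)).
Qed.

End cons.

Lemma eq_cintegral n (f g : cfun R n) : (forall x, f x = g x) -> cintegral f = cintegral g.
Proof. by move=> fg; congr cintegral; apply/funext. Qed.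

Lemma cintegral_rV0 (f : cfun R 0) : cintegral f = f 0.
Proof.
have E (t : 0.-tuple (measurableTypeR R)) : rowt t = 0 by apply/rowP => -[].
apply: complexP; rewrite /= /Rintegral /= integral_dirac// ?diracT ?mul1e/= ?E//.
  by under eq_fun do rewrite E; exact: measurable_cst.
by under eq_fun do rewrite E; exact: measurable_cst.
Qed.

Section subst1.
Variables (phi : measurableTypeR R -> measurableTypeR R) (k : {nonneg R}).
Hypothesis measurable_phi : measurable_fun setT phi.

Let nu : {measure set (measurableTypeR R) -> \bar R} :=
  measure_function_pushforward__canonical__measure_function_Measure leb measurable_phi.

Hypothesis leb_phi : forall x y : R,
  leb `]x, y]%classic = (k%:num%:E * leb (phi @^-1` `]x, y]%classic))%E.

(** Lebesgue measure is determined by its values on half-open intervals, so a substitution only has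
    to be checked on those. *)
Let leb_scale (A : set (measurableTypeR R)) : measurable A -> leb A = mscale k nu A.
Proof.
apply: lebesgue_measure_unique => _ [[x y] _ <-].
exact: leb_phi.
Qed.

Let ge0_int (f : R -> \bar R) : measurable_fun setT f -> (forall s, 0 <= f s)%E ->
  (\int[leb]_s f s = k%:num%:E * \int[leb]_s f (phi s))%E.
Proof.
move=> mf f0.
rewrite (@eq_measure_integral _ _ _ _ (mscale k nu)); last first.
  by move=> A mA _; exact: leb_scale.
by rewrite ge0_integral_mscale//= /nu ge0_integral_pushforward.
Qed.

Lemma Rint_subst (f : R -> R) : measurable_fun setT f ->
  leb.-integrable setT (EFin \o (fun s => f (phi s))) ->
  \int[leb]_s f s = k%:num * \int[leb]_s f (phi s).
Proof.
move=> mf iF; rewrite /Rintegral -[X in _ = X * _]/(fine k%:num%:E) -fineM//; last first.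
  exact: integrable_fin_num iF.
congr fine.
rewrite integralE [X in (_ * X)%E]integralE muleBr//; last first.
  exact: integrable_add_def iF.
have mf' : measurable_fun setT (fun x => (f x)%:E) by exact/measurable_EFinP.
have Hp (F : R -> \bar R) : measurable_fun setT F ->
    (\int[leb]_s F^\+ s = k%:num%:E * \int[leb]_s (F \o phi)^\+ s)%E.
  by move=> mF; rewrite (funepos_comp F phi) ge0_int; [|exact: measurable_funepos|move=> s; exact: funepos_ge0].
have Hn (F : R -> \bar R) : measurable_fun setT F ->
    (\int[leb]_s F^\- s = k%:num%:E * \int[leb]_s (F \o phi)^\- s)%E.
  by move=> mF; rewrite (funeneg_comp F phi) ge0_int; [|exact: measurable_funeneg|move=> s; exact: funeneg_ge0].
by rewrite (Hp _ mf') (Hn _ mf').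
Qed.

End subst1.

Lemma Rint_affine (a b : R) (f : R -> R) : a != 0 -> measurable_fun setT f ->
  leb.-integrable setT (EFin \o (fun s => f (a * s + b))) ->
  \int[leb]_s f s = `|a| * \int[leb]_s f (a * s + b).
Proof.
move=> a0; apply: (@Rint_subst (fun s => a * s + b) (NngNum (normr_ge0 a))).
  by apply: measurable_funD => //; exact: measurable_funM.
move=> x y; rewrite /=.
have [agt|alt] : 0 < a \/ a < 0 by apply/orP; rewrite orbC -neq_lt.
  rewrite (_ : _ @^-1` _ = `](x - b) / a, (y - b) / a]%classic); last first.
    apply/seteqP; split=> s; rewrite /= !in_itv/=.
      by rewrite ltr_pdivrMr// ler_pdivlMr// ltrBlDr lerBrDr mulrC.
    by rewrite ltr_pdivrMr// ler_pdivlMr// ltrBlDr lerBrDr [s * a]mulrC.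
  rewrite !lebesgue_measure_itv/= !lte_fin ltr_pM2r ?invr_gt0// ltrD2r.
  case: ifPn => _; last by rewrite mule0.
  by rewrite gtr0_norm// -!EFinB -EFinM; congr EFin; field.
(* A negative slope exchanges the open and the closed end, which does not change the measure. *)
rewrite (_ : _ @^-1` _ = `[(y - b) / a, (x - b) / a[%classic); last first.
  apply/seteqP; split=> s; rewrite /= !in_itv/=.
    by rewrite ler_ndivrMr// ltr_ndivlMr// ltrBlDr lerBrDr mulrC andbC.
  by rewrite ler_ndivrMr// ltr_ndivlMr// ltrBlDr lerBrDr [s * a]mulrC andbC.
rewrite !lebesgue_measure_itv/= !lte_fin ltr_nM2r ?invr_lt0// ltrD2r.
case: ifPn => _; last by rewrite mule0.
by rewrite ltr0_norm// -!EFinB -EFinM; congr EFin; field.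
Qed.

Lemma schwartz_scale n (f : cfun R n) (a : R) c : a != 0 -> schwartz f ->
  schwartz (fun x => f (a *: x + c)).
Proof.
move=> a0; apply: (@schwartz_affine _ _ _ _ (fun x => a *: x) (fun x => a^-1 *: x)).
- by move=> k x y; rewrite scalerDr !scalerA mulrC.
- by move=> k x y; rewrite scalerDr !scalerA mulrC.
- by move=> x; rewrite scalerA mulVf// scale1r.
Qed.

Lemma consr_affine n (a : R) (c : 'rV[R]_n.+1) s x :
  a *: consr s x + c =
  consr (a * s + c 0 ord0) (a *: x + (rsubmx (c : 'rV_(1 + n)))).
Proof.
apply/rowP => i; rewrite [LHS]mxE [X in X + _]mxE.
case: (unliftP ord0 i) => [j|] ->; last by rewrite !consr0.
rewrite !consrS !mxE; congr (_ + c 0 _); exact/val_inj.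
Qed.

Lemma schwartz_scale_consr n (F : cfun R n.+1) (a : R) (b : R) : a != 0 -> schwartz F ->
  schwartz (fun z : 'rV[R]_n.+1 => F (consr (a * z 0 ord0 + b) (rsubmx (z : 'rV_(1 + n))))).
Proof.
move=> a0 sF.
have := @schwartz_affine R n.+1 n.+1 F
  (fun z : 'rV[R]_n.+1 => consr (a * z 0 ord0) (rsubmx (z : 'rV_(1 + n))))
  (fun z : 'rV[R]_n.+1 => consr (a^-1 * z 0 ord0) (rsubmx (z : 'rV_(1 + n)))) (consr b 0).
have E (z : 'rV[R]_n.+1) : consr (a * z 0 ord0) (rsubmx (z : 'rV_(1 + n))) + consr b 0 =
    consr (a * z 0 ord0 + b) (rsubmx (z : 'rV_(1 + n))).
  apply/rowP => i; rewrite [LHS]mxE.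
  by case: (unliftP ord0 i) => [j|] ->; rewrite ?consrS ?consr0// [X in _ + X]mxE addr0.
under [X in _ -> _ -> _ -> _ -> schwartz X]eq_fun do rewrite E.
have H (k : R) : lin (fun z : 'rV[R]_n.+1 => consr (k * z 0 ord0) (rsubmx (z : 'rV_(1 + n)))).
  move=> l u v; apply/rowP => i; rewrite [RHS]mxE [X in _ = X + _]mxE.
  case: (unliftP ord0 i) => [j|] ->; rewrite ?consrS ?consr0 !mxE//.
  by rewrite mulrDr; congr (_ + _); rewrite mulrCA.
apply=> // z.
apply/rowP => i; case: (unliftP ord0 i) => [j|] ->; rewrite ?consrS ?consr0 ?mulKf//.
have -> : rsubmx (consr (a * z 0 ord0) (rsubmx (z : 'rV_(1 + n))) : 'rV_(1 + n)) =
   rsubmx (z : 'rV_(1 + n)) by rewrite /consr row_mxKr.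
by rewrite mxE; congr (z 0 _); exact/val_inj.
Qed.

Lemma cint_subst1 n (F : cfun R n.+1) (k a b : R) (x : 'rV[R]_n) : schwartz F -> a != 0 ->
  (forall f : R -> R, measurable_fun setT f ->
  leb.-integrable setT (EFin \o (fun s => f (a * s + b))) ->
  \int[leb]_s f s = k * \int[leb]_s f (a * s + b)) ->
  cint leb setT (fun s => F (consr s x)) = k%:C * cint leb setT (fun s => F (consr (a * s + b) x)).
Proof.
move=> sF a0 H.
have [i1 i2] := cintegrable_consr sF x.
have := cintegrable_consr (schwartz_scale_consr b a0 sF) x.
have E s : F (consr (a * consr s x 0 ord0 + b) (rsubmx (consr s x : 'rV_(1 + n)))) =
   F (consr (a * s + b) x) by rewrite consr0 /consr row_mxKr.
under [X in cintegrable _ _ X -> _]eq_fun do rewrite E.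
move=> [j1 j2].
apply: complexP; rewrite ?cReM ?cImM /= ?mul0r ?subr0 ?addr0.
  apply: (H (fun s => Re (F (consr s x)))) => //.
  by apply/measurable_EFinP; exact: measurable_int i1.
apply: (H (fun s => Im (F (consr s x)))) => //.
by apply/measurable_EFinP; exact: measurable_int i2.
Qed.

Lemma cintegralZ n (f : cfun R n) (c : C) : integrable_rV f ->
  cintegral (fun x => c * f x) = c * cintegral f.
Proof. by move=> iF; exact: (cintZ _ c iF). Qed.

Lemma cintegralD n (f g : cfun R n) : integrable_rV f -> integrable_rV g ->
  cintegral (fun x => f x + g x) = cintegral f + cintegral g.
Proof. by move=> iF ig; exact: (cintD _ iF ig). Qed.

(** Coordinates are substituted one by one, each contributing a factor [k]; the shift in the
    one-dimensional hypothesis is arbitrary because every coordinate has its own entry of [c]. *)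
Lemma cintegral_subst n (f : cfun R n) (k a : R) (c : 'rV[R]_n) : schwartz f -> a != 0 ->
  (forall b (f : R -> R), measurable_fun setT f ->
  leb.-integrable setT (EFin \o (fun s => f (a * s + b))) ->
  \int[leb]_s f s = k * \int[leb]_s f (a * s + b)) ->
  cintegral f = (k ^+ n)%:C * cintegral (fun x => f (a *: x + c)).
Proof.
move=> sf a0 H; elim: n f c sf => [|n IH] f c sf.
  rewrite expr0 mul1r !cintegral_rV0; congr f.
  by apply/rowP => -[].
have sG := schwartz_scale_consr (c 0 ord0) a0 sf.
have E s x : f (consr (a * consr s x 0 ord0 + c 0 ord0) (rsubmx (consr s x : 'rV_(1 + n)))) =
   f (consr (a * s + c 0 ord0) x) by rewrite consr0 /consr row_mxKr.
have sS := schwartz_scale c a0 sf.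
(* [G] is [f] after substitution in the first coordinate only. *)
set G := fun z => _ in sG.
transitivity (cintegral (fun z => k%:C * G z)).
  rewrite (cintegral_cons2 sf) (cintegral_cons2 (schwartzZ k%:C sG)).
  apply: eq_cintegral => x; rewrite (cint_subst1 x sf a0 (H (c 0 ord0))).
  rewrite cintZ//; last exact: cintegrable_consr.
  by congr (_ * _); apply: eq_cint => // s _; rewrite /G E.
rewrite cintegralZ; last exact: schwartz_integrable.
rewrite exprS rmorphM -mulrA; congr (_ * _).
rewrite -cintegralZ; last exact: schwartz_integrable.
rewrite (cintegral_cons1 sG) (cintegral_cons1 (schwartzZ _ sS)).
apply: eq_cint => // s _.
transitivity (cintegral (fun x => f (consr (a * s + c 0 ord0) x))).
  by apply: eq_cintegral => x; rewrite /G E.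
rewrite (IH _ (rsubmx (c : 'rV_(1 + n))) (schwartz_consr _ sf)).
rewrite -cintegralZ; last first.
  apply: schwartz_integrable.
  exact: (schwartz_scale (rsubmx (c : 'rV_(1 + n))) a0 (schwartz_consr (a * s + c 0 ord0) sf)).
by apply: eq_cintegral => x; rewrite consr_affine.
Qed.

Lemma cintegral_scale n (f : cfun R n) (a : R) (c : 'rV[R]_n) : schwartz f -> a != 0 ->
  cintegral f = (`|a| ^+ n)%:C * cintegral (fun x => f (a *: x + c)).
Proof.
by move=> sf a0; apply: cintegral_subst => // b g; exact: Rint_affine.
Qed.

Lemma cintegral_translate n (f : cfun R n) (c : 'rV[R]_n) : schwartz f ->
  cintegral (fun x => f (x + c)) = cintegral f.
Proof.
move=> sf; rewrite [RHS](cintegral_scale c sf (oner_neq0 _)) normr1 expr1n mul1r.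
by apply: eq_cintegral => x; rewrite scale1r.
Qed.

Lemma cintegral_opp n (f : cfun R n) (c : 'rV[R]_n) : schwartz f ->
  cintegral (fun x => f (c - x)) = cintegral f.
Proof.
move=> sf; rewrite [RHS](@cintegral_scale _ _ (-1) c)// ?oppr_eq0 ?oner_eq0//.
rewrite normrN1 expr1n mul1r; apply: eq_cintegral => x.
by rewrite scaleN1r addrC.
Qed.

End change_of_variables.

(** * The Fourier transform *)

Section partial_fourier.
Context {R : realType}.
Local Notation C := R[i].
Local Notation Re := (@complex.Re R).
Local Notation Im := (@complex.Im R).
Local Notation normc := (@Normc.normc R).
Local Open Scope complex_scope.

Section under.
Context d (T : measurableType d) (mu : {measure set T -> \bar R}) (D : set T).
Hypothesis mD : measurable D.

(** On the line through [x] along [v] this is the one-parameter theorem on the interval ]-1, 1[,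
    whence domination is asked for [|h| < 1] only. *)
Lemma is_derive_under n (k k' : 'rV[R]_n -> T -> R) (x v : 'rV[R]_n) (G : T -> R) :
  (forall y, mu.-integrable D (EFin \o k y)) ->
  (forall y t, is_derive y v (k ^~ t) (k' y t)) ->
  (forall t, 0 <= G t) -> mu.-integrable D (EFin \o G) ->
  (forall (h : R) t, `|h| < 1 -> D t -> `|k' (h *: v + x) t| <= G t) ->
  is_derive x v (fun y => \int[mu]_(t in D) k y t) (\int[mu]_(t in D) k' x t).
Proof.
move=> ik dk G0 iG HG.
pose f (h : R) (t : T) := k (h *: v + x) t.
have df (h : R) t : is_derive h (1 : R) (f ^~ t) (k' (h *: v + x) t).
  by apply/(@is_derive_line _ _ (k ^~ t)); exact: dk.
have E h t : partial1of2 f h t = k' (h *: v + x) t.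
  by rewrite partial1of2E; exact: (@derive_val _ _ _ _ _ _ _ (df h t)).
have I0 : ((`](-1), 1[)%classic : set R) 0 by rewrite /= in_itv/= ltr01 ltrN10.
have H1 h : ((`](-1), 1[)%classic : set R) h -> mu.-integrable D (EFin \o f h) by move=> _; exact: ik.
have H2 h t : ((`](-1), 1[)%classic : set R) h -> D t -> derivable (f ^~ t) h 1.
  by move=> _ _; exact: (@ex_derive _ _ _ _ _ _ _ (df h t)).
have H3 h t : ((`](-1), 1[)%classic : set R) h -> D t -> `|partial1of2 f h t| <= G t.
  rewrite /= in_itv/= => Ih Dt; rewrite E; apply: HG => //.
  by rewrite ltr_norml.
have := derivable_under_integral mD I0 H1 H2 G0 iG H3.
have := differentiation_under_integral mD I0 H1 H2 G0 iG H3.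
rewrite derive1E => V De.
rewrite -[X in is_derive X](add0r x) -(scale0r v); apply/is_derive_line.
apply: DeriveDef => //; rewrite [LHS]V.
by apply: eq_Rintegral => t _; rewrite E scale0r add0r.
Qed.

Lemma cder_under n (k k' : 'rV[R]_n -> T -> C) (x v : 'rV[R]_n) (G : T -> R) :
  (forall y, cintegrable mu D (k y)) ->
  (forall y t, cder (k ^~ t) y v (k' y t)) ->
  (forall t, 0 <= G t) -> mu.-integrable D (EFin \o G) ->
  (forall (h : R) t, `|h| < 1 -> D t -> normc (k' (h *: v + x) t) <= G t) ->
  cder (fun y => cint mu D (k y)) x v (cint mu D (k' x)).
Proof.
move=> ik dk G0 iG HG; split.
  apply: (is_derive_under (k := fun y t => Re (k y t)) (k' := fun y t => Re (k' y t)) (G := G)) => //.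
  - by move=> y; exact: (ik y).1.
  - by move=> y t; exact: (dk y t).1.
  - by move=> h t h1 Dt; exact: le_trans (normc_Re _) (HG h t h1 Dt).
apply: (is_derive_under (k := fun y t => Im (k y t)) (k' := fun y t => Im (k' y t)) (G := G)) => //.
- by move=> y; exact: (ik y).2.
- by move=> y t; exact: (dk y t).2.
- by move=> h t h1 Dt; exact: le_trans (normc_Im _) (HG h t h1 Dt).
Qed.

End under.

Lemma integrable_Mmaj n (M : R) : (lebesgue_tuple R n).-integrable setT
  (EFin \o (fun t => M * maj (rowt t))).
Proof. by apply: integrableRZ => //; exact: integrable_maj. Qed.

(** A majorant common to all translates by vectors of norm at most 1, as [cder_under] requires. From
    |x| <= 1 + |y + x| each 1 + x_i^2 is at most 4 (1 + |y + x|)^2, hence the factor 4^n. *)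
Lemma rapid_maj_shift n (f : cfun R n) : rapid f ->
  exists2 M, 0 <= M & forall x y, `|y| <= 1 -> normc (f (y + x)) <= M * maj x.
Proof.
move=> /(_ (2 * n)%N)[M HM].
have M0 : 0 <= M by rewrite (le_trans _ (HM 0))// mulr_ge0 ?normc_ge0 ?exprn_ge0 ?addr_ge0.
exists (M * 4 ^+ n) => [|x y y1]; first by rewrite mulr_ge0 ?exprn_ge0.
rewrite -ler_pdivrMr ?maj_gt0// mulrC (@le_trans _ _ (4 ^+ n * ((1 + `|y + x|) ^+ (2 * n) * normc (f (y + x)))))//; last first.
  by rewrite mulrC ler_wpM2r ?exprn_ge0.
rewrite mulrA ler_wpM2r ?normc_ge0// exprM -exprMn /maj -prodfV.
rewrite -[X in _ ^+ X]card_ord -prodr_const.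
apply: ler_prod => i _; rewrite invrK (le_trans ler01) ?oneDsqr_ge1//=.
have := coord_le x i; rewrite /oneDsqr => H.
have H2 : `|x| <= 1 + `|y + x|.
  by rewrite -{1}[x](addKr y) (le_trans (ler_normD _ _))// normrN lerD2r.
have : `|x 0 i| ^+ 2 <= (1 + `|y + x|) ^+ 2.
  by rewrite lerXn2r ?nnegrE ?addr_ge0// (le_trans H).
rewrite real_normK ?num_real//; have := normr_ge0 (y + x); nra.
Qed.

Lemma cder_const n (c l : C) (x v : 'rV[R]_n) : cder (fun=> c) x v l -> l = 0.
Proof.
move=> [[_ h1] [_ h2]]; apply: complexP.
  by rewrite -h1; exact: derive_cst.
by rewrite -h2; exact: derive_cst.
Qed.

(** Translation invariance replaces integration by parts: the integral of f(y + x) over x does not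
    depend on y, so its derivative in y, which is the integral of the partial derivative,
    vanishes. *)
Lemma cintegral_partial n (f : cfun R n) i : schwartz f ->
  cintegral (cpartial i f) = 0.
Proof.
move=> sf; have [M M0 HM] := rapid_maj_shift (schwartz_rapid (schwartz_partial i sf)).
have st y : schwartz (fun x => f (y + x)).
  have := schwartz_scale y (oner_neq0 _) sf.
  by under [X in schwartz X -> _]eq_fun do rewrite scale1r addrC.
have := @cder_under _ _ (lebesgue_tuple R n) setT measurableT n
   (fun y t => f (y + rowt t)) (fun y t => cpartial i f (y + rowt t)) 0 (e_ i)
   (fun t => M * maj (rowt t)).
have -> : (fun y => cint (lebesgue_tuple R n) setT (fun t => f (y + rowt t))) = fun=> cintegral f.
  apply/funext => y; rewrite -(cintegral_translate y sf).
  by apply: (@eq_cintegral _ _ (fun x => f (y + x))) => x; rewrite addrC.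
move=> H; have {}H := cder_const (H _ _ _ _ _).
rewrite -{}H.
- by apply: (@eq_cintegral _ _ _ (fun x => cpartial i f (0 + x))) => x; rewrite add0r.
- by move=> y; exact: schwartz_integrable (st y).
- move=> y t; apply: (cder_affine (A := fun y => y + rowt t) (w := e_ i)).
    by move=> h; rewrite addrA.
  exact: schwartz_cder.
- by move=> t; rewrite mulr_ge0// ltW// maj_gt0.
- exact: integrable_Mmaj.
- move=> h t h1 _; apply: HM; rewrite addr0.
  apply: norm_le_coord => // j; rewrite !mxE normrM.
  by case: (_ && _); rewrite ?normr1 ?normr0 ?mulr1 ?mulr0// ltW.
Qed.

(** The Fourier transform in the last n variables only. It contains the full transform (m = 0), the
    passage from correlations to Wigner distributions, and, at frequency 0, integration over a block
    of variables. *)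
Definition pft m n (F : cfun R (m + n)) : cfun R (m + n) := fun z =>
  cintegral (fun t => cis (- (2 * pi * dotp (rsubmx z) t)) * F (row_mx (lsubmx z) t)).

Lemma schwartz_cis n (f : cfun R n) (w : 'rV[R]_n) (k : R) : schwartz f ->
  schwartz (fun t => cis (k * dotp w t) * f t).
Proof.
move=> sf; have := @schwartz_cis_dotp R n n f (fun=> 0) id w 0 k.
under [X in _ -> _ -> _ -> schwartz X]eq_fun do rewrite add0r addr0.
by apply=> // l x y; rewrite scaler0 addr0.
Qed.

Lemma schwartz_pft_integrand m n (F : cfun R (m + n)) x w : schwartz F ->
  schwartz (fun t : 'rV_n => cis (- (2 * pi * dotp w t)) * F (row_mx x t)).
Proof.
move=> sF; under eq_fun do rewrite -mulNr.
exact/schwartz_cis/schwartz_slice.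
Qed.

Lemma pft_bound m n (F : cfun R (m + n)) : schwartz F ->
  exists2 M, 0 <= M & forall w x t, normc (cis (- (2 * pi * dotp w t)) * F (row_mx x t)) <= M * maj t.
Proof.
move=> sF; have [M M0 HM] := rapid_maj (schwartz_rapid sF).
exists M => // w x t; rewrite Normc.normcM normc_cis mul1r (le_trans (HM _))//.
by rewrite maj_row_mx ler_wpM2l// ler_piMl ?maj_le1// ltW// maj_gt0.
Qed.

Lemma lsubmx_e_l m n (j : 'I_m) : lsubmx (e_ (lshift n j)) = e_ j :> 'rV[R]_m.
Proof. by apply/rowP => l; rewrite !mxE eqxx /= (inj_eq (@lshift_inj _ _)). Qed.

Lemma rsubmx_e_l m n (j : 'I_m) : rsubmx (e_ (lshift n j)) = 0 :> 'rV[R]_n.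
Proof. by apply/rowP => l; rewrite !mxE eqxx /= eq_rlshift. Qed.

Lemma lsubmx_e_r m n (j : 'I_n) : lsubmx (e_ (rshift m j)) = 0 :> 'rV[R]_m.
Proof. by apply/rowP => l; rewrite !mxE eqxx /= eq_lrshift. Qed.

Lemma rsubmx_e_r m n (j : 'I_n) : rsubmx (e_ (rshift m j)) = e_ j :> 'rV[R]_n.
Proof. by apply/rowP => l; rewrite !mxE eqxx /= (inj_eq (@rshift_inj _ _)). Qed.

Lemma row_mx_lin m n (h : R) (a b : 'rV[R]_m) (c d : 'rV[R]_n) :
  row_mx (h *: a + b) (h *: c + d) = h *: row_mx a c + row_mx b d.
Proof. by rewrite scale_row_mx add_row_mx. Qed.

Lemma rsubmx_lin m n (h : R) (a b : 'rV[R]_(m + n)) :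
  rsubmx (h *: a + b) = h *: rsubmx a + rsubmx b.
Proof. by rewrite linearD linearZ. Qed.

Lemma dotp_e n (i : 'I_n) (t : 'rV[R]_n) : dotp (e_ i) t = t 0 i.
Proof.
rewrite /dotp (bigD1 i)//= big1 ?addr0 => [|j ji]; rewrite !mxE eqxx /=.
  by rewrite eqxx mul1r.
by rewrite (negbTE ji) mul0r.
Qed.

Lemma cder_pft_l m n (F : cfun R (m + n)) z (j : 'I_m) : schwartz F ->
  cder (pft F) z (e_ (lshift n j)) (pft (cpartial (lshift n j) F) z).
Proof.
move=> sF; have [M M0 HM] := pft_bound (schwartz_partial (lshift n j) sF).
apply: (@cder_under _ _ (lebesgue_tuple R n) setT measurableT (m + n)
  (fun z t => cis (- (2 * pi * dotp (rsubmx z) (rowt t))) * F (row_mx (lsubmx z) (rowt t)))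
  (fun z t => cis (- (2 * pi * dotp (rsubmx z) (rowt t))) *
     cpartial (lshift n j) F (row_mx (lsubmx z) (rowt t))) z _ (fun t => M * maj (rowt t))) => //.
- by move=> y; exact: schwartz_integrable (schwartz_pft_integrand (lsubmx y) (rsubmx y) sF).
- move=> y t.
  set c := (X in cder _ _ _ X).
  have -> : c = 0 * F (row_mx (lsubmx y) (rowt t)) + c by rewrite mul0r add0r.
  apply: cderM.
    apply: (@cder_affine _ _ _ rsubmx (fun w => cis (- (2 * pi * dotp w (rowt t)))) _ _ 0).
      by move=> h; rewrite linearD linearZ/= rsubmx_e_l.
    by split; exact: is_derive0.
  apply: (@cder_affine _ _ _ (fun y => row_mx (lsubmx y) (rowt t)) F _ _ (e_ (lshift n j))).
    move=> h; rewrite linearD linearZ/= lsubmx_e_l.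
    have -> : e_ (lshift n j) = row_mx (e_ j) 0 :> 'rV[R]_(m + n).
      by rewrite -[LHS]hsubmxK lsubmx_e_l rsubmx_e_l.
    by rewrite -row_mx_lin scaler0 add0r.
  exact: schwartz_cder.
- by move=> t; rewrite mulr_ge0// ltW// maj_gt0.
- exact: integrable_Mmaj.
Qed.

Definition mulX n (i : 'I_n) (c : C) (F : cfun R n) : cfun R n :=
  fun x => c * ((x 0 i)%:C * F x).

Lemma schwartz_mulX n (i : 'I_n) c (F : cfun R n) : schwartz F -> schwartz (mulX i c F).
Proof. by move=> sF; exact/schwartzZ/schwartz_mulx. Qed.

Lemma cder_pft_r m n (F : cfun R (m + n)) z (j : 'I_n) : schwartz F ->
  cder (pft F) z (e_ (rshift m j)) (pft (mulX (rshift m j) (Complex 0 (- (2 * pi))) F) z).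
Proof.
move=> sF; have [M M0 HM] := pft_bound (schwartz_mulX (rshift m j) (Complex 0 (- (2 * pi))) sF).
apply: (@cder_under _ _ (lebesgue_tuple R n) setT measurableT (m + n)
  (fun z t => cis (- (2 * pi * dotp (rsubmx z) (rowt t))) * F (row_mx (lsubmx z) (rowt t)))
  (fun z t => cis (- (2 * pi * dotp (rsubmx z) (rowt t))) *
     mulX (rshift m j) (Complex 0 (- (2 * pi))) F (row_mx (lsubmx z) (rowt t)))
  z _ (fun t => M * maj (rowt t))) => //.
- by move=> y; exact: schwartz_integrable (schwartz_pft_integrand (lsubmx y) (rsubmx y) sF).
- move=> y t.
  set u := F (row_mx (lsubmx y) (rowt t)).
  set c := cis (- (2 * pi * dotp (rsubmx y) (rowt t))).
  have -> : c * mulX (rshift m j) (Complex 0 (- (2 * pi))) F (row_mx (lsubmx y) (rowt t)) =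
      Complex 0 (- (2 * pi * rowt t 0 j)) * c * u + c * 0.
    rewrite mulr0 addr0 /mulX row_mxEr -/u !mulrA; congr (_ * _).
    rewrite [RHS]mulrC -mulrA; congr (_ * _).
    by apply: complexP; rewrite /= ?mulr0 ?mul0r ?subr0 ?add0r ?addr0 ?mulNr.
  apply: cderM.
    apply: (@cder_cis _ _ (fun z => - (2 * pi * dotp (rsubmx z) (rowt t)))).
    apply: (is_derive_scalar_affine (k := 0)) => h.
    rewrite rsubmx_lin rsubmx_e_r dotpDl dotpZl dotp_e; ring.
  apply: (@cder_affine _ _ _ (fun y => row_mx (lsubmx y) (rowt t)) F _ _ 0).
    move=> h; rewrite linearD linearZ/= lsubmx_e_r.
    by rewrite scaler0 scaler0 !add0r.
  by split; exact: is_derive0.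
- by move=> t; rewrite mulr_ge0// ltW// maj_gt0.
- exact: integrable_Mmaj.
Qed.

Lemma pft_mulX_l m n (F : cfun R (m + n)) (j : 'I_m) (z : 'rV[R]_(m + n)) : schwartz F ->
  (z 0 (lshift n j))%:C * pft F z = pft (mulX (lshift n j) 1 F) z.
Proof.
move=> sF; rewrite /pft -cintegralZ; last first.
  exact: schwartz_integrable (schwartz_pft_integrand (lsubmx z) (rsubmx z) sF).
apply: eq_cintegral => t; rewrite /mulX mul1r row_mxEl mxE; ring.
Qed.

(** The t_j-derivative of the integrand integrates to 0, so - 2 pi i w_j times the transform of F
    plus the transform of the derivative vanishes. The constant is 1/(2 pi i). *)
Lemma pft_mulX_r m n (F : cfun R (m + n)) (j : 'I_n) (z : 'rV[R]_(m + n)) : schwartz F ->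
  (z 0 (rshift m j))%:C * pft F z =
  pft (fun y => Complex 0 (- (2 * pi)^-1) * cpartial (rshift m j) F y) z.
Proof.
move=> sF; set w := rsubmx z; set x := lsubmx z.
have sI := schwartz_pft_integrand x w sF.
have sI' := schwartz_pft_integrand x w (schwartz_partial (rshift m j) sF).
have := cintegral_partial j sI.
have -> : cpartial j (fun t => cis (- (2 * pi * dotp w t)) * F (row_mx x t)) =
   fun t => Complex 0 (- (2 * pi) * w 0 j) * (cis (- (2 * pi * dotp w t)) * F (row_mx x t)) +
       cis (- (2 * pi * dotp w t)) * cpartial (rshift m j) F (row_mx x t).
  apply/funext => t; apply: cder_uniq; rewrite mulrA; apply: cderM.
    apply: (@cder_cis _ _ (fun t => - (2 * pi * dotp w t))).
    apply: (is_derive_scalar_affine (k := 0)) => h.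
    rewrite [dotp w _]dotpC dotpDl dotpZl dotp_e [dotp t w]dotpC; ring.
  apply: (@cder_affine _ _ _ (fun t => row_mx x t) F _ _ (e_ (rshift m j))).
    move=> h.
    have -> : e_ (rshift m j) = row_mx 0 (e_ j) :> 'rV[R]_(m + n).
      by rewrite -[LHS]hsubmxK lsubmx_e_r rsubmx_e_r.
    by rewrite -row_mx_lin scaler0 add0r.
  exact: schwartz_cder.
rewrite cintegralD; [|exact/schwartz_integrable/schwartzZ|exact: schwartz_integrable].
rewrite cintegralZ; last exact: schwartz_integrable.
rewrite -/(pft F z) -/(pft (cpartial (rshift m j) F) z) => /eqP.
rewrite addr_eq0 => /eqP H.
transitivity (Complex 0 (- (2 * pi)^-1) * pft (cpartial (rshift m j) F) z); last first.
  rewrite -cintegralZ; last exact: schwartz_integrable.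
  by apply: eq_cintegral => t; rewrite mulrCA.
rewrite -[pft (cpartial _ _) z]opprK -H mulrN mulrA -mulNr; congr (_ * _).
have p0 : pi != 0 :> R by rewrite gt_eqF// pi_gt0.
apply: complexP; rewrite /= ?mulr0 ?mul0r ?subr0 ?add0r ?addr0 ?oppr0// /w mxE.
by rewrite opprK !mulNr mulrN opprK mulKf// mulf_neq0// pnatr_eq0.
Qed.

(** The set of all partial transforms is bounded memberwise and stable under coordinates and
    derivatives, since both operations pass to the function being transformed. *)
Lemma schwartz_pft m n (F : cfun R (m + n)) : schwartz F -> schwartz (pft F).
Proof.
move=> sF; pose S : set (cfun R (m + n)) := [set pft F | F in @schwartz R (m + n)].
apply: (@schwartz_coind _ _ S); last by exists F.
- apply: rapid_of_mulx => [_ [G sG <-]|_ i [G sG <-]].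
    have [M M0 HM] := pft_bound sG.
    exists (2 * \int[lebesgue_tuple R n]_t (M * maj (rowt t))) => z.
    apply: normc_cint => //.
    + exact: schwartz_integrable (schwartz_pft_integrand (lsubmx z) (rsubmx z) sG).
    + exact: integrable_Mmaj.
  case: (split_ordP i) => j ->.
    exists (mulX (lshift n j) 1 G); first exact: schwartz_mulX.
    by apply/funext => z; rewrite pft_mulX_l.
  exists (fun y => Complex 0 (- (2 * pi)^-1) * cpartial (rshift m j) G y).
    exact/schwartzZ/schwartz_partial.
  by apply/funext => z; rewrite pft_mulX_r.
- move=> _ i [G sG <-]; case: (split_ordP i) => j ->.
    exists (pft (cpartial (lshift n j) G)); last by move=> z; exact: cder_pft_l.
    by exists (cpartial (lshift n j) G) => //; exact: schwartz_partial.
  exists (pft (mulX (rshift m j) (Complex 0 (- (2 * pi))) G)); last by move=> z; exact: cder_pft_r.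
  by exists (mulX (rshift m j) (Complex 0 (- (2 * pi))) G) => //; exact: schwartz_mulX.
Qed.

(** The marginal is the partial transform restricted to frequency 0. *)
Lemma schwartz_cintegral m n (F : cfun R (m + n)) : schwartz F ->
  schwartz (fun x => cintegral (fun t => F (row_mx x t))).
Proof.
move=> /schwartz_pft sP.
have := @schwartz_lin R m (m + n) _ (fun x => row_mx x 0) lsubmx _ _ _ sP.
have E x : pft F (row_mx x 0) = cintegral (fun t => F (row_mx x t)).
  apply: eq_cintegral => t; rewrite row_mxKl row_mxKr dotp0l mulr0 oppr0.
  by rewrite cis0 mul1r.
under [X in _ -> _ -> _ -> schwartz X]eq_fun do rewrite E.
apply.
- by move=> k x y; rewrite -row_mx_lin scaler0 addr0.
- by move=> k x y; rewrite linearD linearZ.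
- by move=> x; rewrite row_mxKl.
Qed.

End partial_fourier.

(** * Gaussians and Fourier inversion *)

Section fourier_inversion.
Context {R : realType}.
Local Notation C := R[i].
Local Notation Re := (@complex.Re R).
Local Notation Im := (@complex.Im R).
Local Notation normc := (@Normc.normc R).
Local Open Scope complex_scope.
Local Notation leb := (@lebesgue_measure R).

Lemma cReB (z w : C) : Re (z - w) = Re z - Re w.
Proof. by case: z w => a b [c d]. Qed.

Lemma cImB (z w : C) : Im (z - w) = Im z - Im w.
Proof. by case: z w => a b [c d]. Qed.

Definition ft n (f : cfun R n) : cfun R n := fun w =>
  cintegral (fun t => cis (- (2 * pi * dotp w t)) * f t).

Lemma row_mx_rV0 n (x : 'rV[R]_0) (t : 'rV[R]_n) : row_mx x t = t.
Proof. exact: row_thin_mx. Qed.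

Lemma rsubmx_rV0 n (z : 'rV[R]_n) : rsubmx (z : 'rV_(0 + n)) = z.
Proof. by rewrite -[RHS](@hsubmxK _ _ 0 n z) row_thin_mx. Qed.

Lemma pft0 n (f : cfun R n) : @pft R 0 n f = ft f.
Proof.
by apply/funext => z; apply: eq_cintegral => t; rewrite row_mx_rV0 rsubmx_rV0.
Qed.

Lemma schwartz_ft n (f : cfun R n) : schwartz f -> schwartz (ft f).
Proof. by rewrite -pft0; exact: (@schwartz_pft R 0 n f). Qed.

Lemma rshift0 n (j : 'I_n) : rshift 0 j = j :> 'I_(0 + n).
Proof. exact/val_inj. Qed.

Lemma cder_ft n (f : cfun R n) (w : 'rV[R]_n) j : schwartz f ->
  cder (ft f) w (e_ j) (ft (mulX j (Complex 0 (- (2 * pi))) f) w).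
Proof.
move=> sf; have := @cder_pft_r R 0 n f w j sf.
by rewrite rshift0 !pft0.
Qed.

Lemma ft_mulX n (f : cfun R n) (w : 'rV[R]_n) j : schwartz f ->
  (w 0 j)%:C * ft f w = ft (fun y => Complex 0 (- (2 * pi)^-1) * cpartial j f y) w.
Proof.
move=> sf; have := @pft_mulX_r R 0 n f j w sf.
by rewrite rshift0 !pft0.
Qed.

Lemma ft_ext n (f g : cfun R n) w : (forall x, f x = g x) -> ft f w = ft g w.
Proof. by move=> fg; apply: eq_cintegral => t; rewrite fg. Qed.

Lemma ft_integrable n (f : cfun R n) (w : 'rV[R]_n) : schwartz f ->
  schwartz (fun t => cis (- (2 * pi * dotp w t)) * f t).
Proof.
by move=> sf; under eq_fun do rewrite -mulNr; exact: schwartz_cis.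
Qed.

Lemma ftZ n (f : cfun R n) c w : schwartz f -> ft (fun x => c * f x) w = c * ft f w.
Proof.
move=> sf; rewrite /ft -cintegralZ; last exact/schwartz_integrable/ft_integrable.
by apply: eq_cintegral => t; rewrite mulrCA.
Qed.

(** With the kernel exp(- 2 pi i w.t), this normalisation makes the Gaussian its own Fourier
    transform, with integral 1. *)
Definition gauss n : cfun R n := fun x => (expR (- pi * dotp x x))%:C.

Lemma cder_expdot n (k : R) (x v : 'rV[R]_n) :
  cder (fun x => (expR (k * dotp x x))%:C) x v (2 * k * dotp x v * expR (k * dotp x x))%:C.
Proof.
split; last exact: is_derive_cst.
rewrite /=.
have H : is_derive x v (fun x => k * dotp x x) (2 * k * dotp x v).
  apply: (is_derive_scalar_affine (k := k * dotp v v)) => h.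
  by rewrite !(dotpDl, dotpDr, dotpZl, dotpZr) [dotp v x]dotpC; ring.
rewrite -[X in is_derive X](add0r x) -(scale0r v); apply/is_derive_line.
have H0 : is_derive (0 : R) (1 : R) (fun h : R => k * dotp (h *: v + x) (h *: v + x)) (2 * k * dotp x v).
  by apply/(@is_derive_line _ _ (fun x => k * dotp x x)); rewrite scale0r add0r.
have -> : (fun h : R => (Re \o (fun x => (expR (k * dotp x x))%:C)) (h *: v + x)) =
   expR \o (fun h : R => k * dotp (h *: v + x) (h *: v + x)) by [].
have := @is_derive1_comp R _ _ _ _ _ (is_derive_expR _) H0.
by move=> /is_derive_eq; apply; rewrite scale0r add0r mulrC.
Qed.

Lemma dotp_norm n (x : 'rV[R]_n) : `|x| ^+ 2 <= dotp x x.
Proof.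
have D0 : 0 <= dotp x x by apply: sumr_ge0 => i _; rewrite -expr2 sqr_ge0.
rewrite -[leRHS]sqr_sqrtr// lerXn2r ?nnegrE ?sqrtr_ge0//.
apply: norm_le_coord => [|i]; first exact: sqrtr_ge0.
rewrite -sqrtr_sqr ler_sqrt// /dotp (bigD1 i)//= -expr2 lerDl.
by apply: sumr_ge0 => j _; rewrite -expr2 sqr_ge0.
Qed.

(** With r = |x|, 1 + r <= (k+1)(1 + r/(k+1)) <= (k+1) exp(r/(k+1)), so the weight is at most
    (k+1)^(k+1) exp r; the Gaussian is at most exp(- r^2), and r - r^2 <= 1 gives the constant. *)
Lemma rapid_gauss n : rapid (@gauss n).
Proof.
move=> k; exists (k.+1%:R ^+ k.+1 * expR 1) => x.
set r := `|x|; have r0 : 0 <= r by exact: normr_ge0.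
rewrite normc_real ger0_norm ?expR_ge0//.
have H1 : (1 + r) ^+ k <= k.+1%:R ^+ k.+1 * expR r.
  rewrite (@le_trans _ _ ((1 + r) ^+ k.+1))//.
    by rewrite exprSr ler_peMr ?exprn_ge0 ?addr_ge0// lerDl.
  have -> : expR r = expR (r / k.+1%:R) ^+ k.+1.
    by rewrite -expRM_natl mulrC divfK// pnatr_eq0.
  rewrite -exprMn lerXn2r ?nnegrE ?mulr_ge0 ?addr_ge0 ?expR_ge0//.
  rewrite (@le_trans _ _ (k.+1%:R * (1 + r / k.+1%:R)))//.
    by rewrite mulrDr mulr1 mulrC divfK ?pnatr_eq0// lerD2r ler1n.
  by rewrite ler_wpM2l// expR_ge1Dx.
have H2 : expR (- pi * dotp x x) <= expR (- r ^+ 2).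
  rewrite ler_expR mulNr lerN2 (le_trans (dotp_norm x))//.
  rewrite ler_peMl ?(le_trans (ler01 _) (pi_ge2 R))//.
    by rewrite (le_trans _ (dotp_norm x))// sqr_ge0.
  by rewrite (le_trans _ (pi_ge2 R))// ler1n.
rewrite (@le_trans _ _ (k.+1%:R ^+ k.+1 * expR r * expR (- r ^+ 2)))//.
  by rewrite ler_pM// ?exprn_ge0 ?addr_ge0 ?expR_ge0.
rewrite -mulrA ler_wpM2l ?exprn_ge0// -expRD ler_expR.
nra.
Qed.

(** Polynomial multiples of the Gaussian, generated just far enough to be closed under derivatives;
    this is the stable family for [schwartz_gauss]. *)
Inductive gpoly n : cfun R n -> Prop :=
| gpoly_gauss : gpoly (@gauss n)
| gpoly_X i f : gpoly f -> gpoly (fun x : 'rV[R]_n => (x 0 i)%:C * f x)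
| gpoly_L c f g : gpoly f -> gpoly g -> gpoly (fun x => c * f x + g x).

Lemma cder_gauss n (x : 'rV[R]_n) i :
  cder (@gauss n) x (e_ i) ((- (2 * pi))%:C * ((x 0 i)%:C * gauss x)).
Proof.
have := cder_expdot (- pi) x (e_ i).
rewrite [dotp x _]dotpC dotp_e mulrN => H.
by rewrite -!rmorphM mulrA.
Qed.

Lemma schwartz_gauss n : schwartz (@gauss n).
Proof.
apply: (@schwartz_coind _ _ (@gpoly n)); last exact: gpoly_gauss.
- move=> f; elim=> {f} [|i f _ IH|c f g _ IHf _ IHg].
  + exact: rapid_gauss.
  + exact: rapid_mulx.
  + exact: rapidL.
- move=> f i; elim=> {f} [|j f pf [g pg IH]|c f g _ [f' pf IHf] _ [g' pg IHg]].
  (* The coefficient - 2 pi is split as (- 2 pi - 1) + 1 to fit the shape c f + g of [gpoly_L]. *)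
  + exists (fun x : 'rV[R]_n => ((- (2 * pi))%:C - 1) * ((x 0 i)%:C * gauss x) + (x 0 i)%:C * gauss x).
      by apply: gpoly_L; exact/gpoly_X/gpoly_gauss.
    move=> x; rewrite mulrBl mul1r subrK; exact: cder_gauss.
  + exists (fun x : 'rV[R]_n => ((e_ i : 'rV[R]_n) 0 j)%:C * f x + (x 0 j)%:C * g x).
      by apply: gpoly_L => //; exact: gpoly_X.
    by move=> x; apply: cderM => //; exact: cder_coord.
  + exists (fun x => c * f' x + g' x); first exact: gpoly_L.
    by move=> x; apply: cderD => //; exact: cderZ.
Qed.

Lemma gauss_consr n s (x : 'rV[R]_n) :
  gauss (consr s x) = (expR (- pi * s ^+ 2))%:C * gauss x.
Proof.
rewrite /gauss -rmorphM -expRD -mulrDr /dotp big_ord_recl consr0 expr2.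
by congr ((expR (_ * (_ + _)))%:C); apply: eq_bigr => i _; rewrite consrS.
Qed.

(** The Gaussian factors over coordinates; in dimension one the substitution by sqrt pi leads to the
    known integral of exp(- s^2). *)
Lemma cintegral_gauss n : cintegral (@gauss n) = 1.
Proof.
elim: n => [|n IH].
  by rewrite cintegral_rV0 /gauss dotp0l mulr0 expR0.
rewrite (cintegral_cons1 (@schwartz_gauss n.+1)).
transitivity (cint leb setT (fun s => (expR (- pi * s ^+ 2))%:C)).
  apply: eq_cint => // s _.
  under [X in cintegral X]eq_fun do rewrite gauss_consr.
  by rewrite cintegralZ ?IH ?mulr1//; exact/schwartz_integrable/schwartz_gauss.
have [i1 _] := cintegrable_consr (@schwartz_gauss 1) (0 : 'rV_0).
apply: complexP; rewrite /=; last by rewrite Rintegral_cst//= mul0r.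
have E s : Re (gauss (consr s (0 : 'rV[R]_0))) = gauss_fun (Num.sqrt pi * s + 0).
  rewrite gauss_consr /gauss dotp0l mulr0 expR0 mulr1 /gauss_fun addr0.
  by rewrite exprMn sqr_sqrtr ?pi_ge0// mulNr.
have q0 : Num.sqrt pi != 0 :> R by rewrite gt_eqF// sqrtr_gt0 pi_gt0.
have := @Rint_affine R (Num.sqrt pi) 0 gauss_fun q0 (@measurable_gauss_fun R).
rewrite /Rintegral integralT_gauss ger0_norm ?sqrtr_ge0// => H.
have {}H : Num.sqrt pi * 1 = Num.sqrt pi * fine (\int[leb]_s (gauss_fun (Num.sqrt pi * s + 0))%:E).
  rewrite mulr1; apply: H.
  by rewrite [X in leb.-integrable _ X](_ : _ = EFin \o (Re \o (fun s => gauss (consr s (0 : 'rV[R]_0)))))//; apply/funext => s; congr EFin; exact/esym/E.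
move/(mulfI q0) : H => ->; congr fine; apply: eq_integral => s _.
by rewrite /gauss_fun addr0 exprMn sqr_sqrtr ?pi_ge0// mulNr.
Qed.

Lemma cder0_const n (f : cfun R n) : (forall i x, cder f x (e_ i) 0) ->
  forall x, f x = f 0.
Proof.
move=> H x.
have K (g : 'rV[R]_n -> R) : (forall i x, is_derive x (e_ i) g 0) -> g x = g 0.
  move=> Hg; have N0 (i : 'I_n) (z : 'rV[R]_n) : `|0 : R| <= 0 by rewrite normr0.
  have := lipschitz_coord (g := fun _ _ => 0) Hg N0 0 x.
  rewrite big1 ?addr0 => [|i _]; last by rewrite mulr0.
  by rewrite normr_le0 subr_eq0 => /eqP.
apply: complexP; [apply: (K (Re \o f))|apply: (K (Im \o f))] => i z.
  exact: (H i z).1.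
exact: (H i z).2.
Qed.

(** The transform times exp(pi |w|^2) has zero gradient, hence is constant, and its value at 0 is
    the integral of the Gaussian. *)
Lemma ft_gauss n : ft (@gauss n) = @gauss n.
Proof.
have sg := @schwartz_gauss n.
pose H (w : 'rV[R]_n) := ft (@gauss n) w * (expR (pi * dotp w w))%:C.
have cH : forall i w, cder H w (e_ i) 0.
  move=> i w.
  have -> : (0 : C) = ft (mulX i (Complex 0 (- (2 * pi))) (@gauss n)) w * (expR (pi * dotp w w))%:C +
     ft (@gauss n) w * (2 * pi * dotp w (e_ i) * expR (pi * dotp w w))%:C.
    (* As d_i g = - 2 pi x_i g, the function - 2 pi i x_i g equals i d_i g; i is written as - 2 pi
       times the constant of [ft_mulX]. *)
    have -> : ft (mulX i (Complex 0 (- (2 * pi))) (@gauss n)) w =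
        ft (fun y => (- (2 * pi))%:C * (Complex 0 (- (2 * pi)^-1) * cpartial i (@gauss n) y)) w.
      apply: ft_ext => x; rewrite (cder_uniq (cder_gauss x i)) /mulX !mulrA.
      congr (_ * _ * _); have p0 : 2 * pi != 0 :> R.
        by rewrite mulf_neq0 ?pnatr_eq0// gt_eqF// pi_gt0.
      have -> : (- (2 * pi : R))%:C * Complex 0 (- (2 * pi)^-1) = Complex 0 1.
        by apply: complexP; rewrite /= ?mulrNN ?mulfV ?mulr0 ?mul0r ?subr0 ?addr0 ?add0r.
      by apply: complexP; rewrite /=; ring.
    rewrite ftZ; last exact/schwartzZ/schwartz_partial.
    rewrite -(ft_mulX w i sg) [dotp w (e_ i)]dotpC dotp_e rmorphN.
    rewrite (rmorphM _ (2 * pi * w 0 i)) (rmorphM _ (2 * pi)) /=.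
    by ring.
  by apply: cderM; [exact: cder_ft|exact: cder_expdot].
apply/funext => w.
have := cder0_const cH w; rewrite /H dotp0l mulr0 expR0 mulr1.
have -> : ft (@gauss n) 0 = 1.
  rewrite -[RHS](cintegral_gauss n); apply: eq_cintegral => t.
  by rewrite dotp0l mulr0 oppr0 cis0 mul1r.
move=> E; rewrite -[LHS]mulr1 -[1](_ : (expR (pi * dotp w w))%:C * gauss w = _).
  by rewrite mulrA E mul1r.
by rewrite /gauss -rmorphM -expRD mulNr subrr expR0.
Qed.

Lemma lipschitz_schwartz n (f : cfun R n) : schwartz f ->
  exists2 M, 0 <= M & forall x y, normc (f (y + x) - f x) <= M * \sum_i `|y 0 i|.
Proof.
move=> sf.
have /choice[B HB] : forall i, exists B, forall x, normc (cpartial i f x) <= B.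
  by move=> i; exact: rapid_bounded (schwartz_rapid (schwartz_partial i sf)).
pose M := \sum_i `|B i|.
have HM i x : normc (cpartial i f x) <= M.
  rewrite (le_trans (HB i x))// (le_trans (ler_norm _))//.
  by rewrite /M (bigD1 i)//= lerDl sumr_ge0.
exists (2 * M) => [|x y]; first by rewrite mulr_ge0// sumr_ge0.
rewrite (le_trans (normc_le _))// -mulrA mulr_natl mulr2n mulr_sumr.
apply: lerD.
  rewrite cReB.
  under eq_bigr do rewrite mulrC.
  exact: (@lipschitz_coord R n (Re \o f) (fun i => Re \o cpartial i f) M
    (fun i z => (schwartz_cder i z sf).1) (fun i z => le_trans (normc_Re _) (HM i z)) x y).
rewrite cImB.
under eq_bigr do rewrite mulrC.
exact: (@lipschitz_coord R n (Im \o f) (fun i => Im \o cpartial i f) M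
    (fun i z => (schwartz_cder i z sf).2) (fun i z => le_trans (normc_Im _) (HM i z)) x y).
Qed.

Lemma cintegral_dilate n (h f : cfun R n) : schwartz h -> schwartz f ->
  exists K, forall e : R, 0 < e ->
    normc (cintegral (fun y => h y * f (e *: y)) - f 0 * cintegral h) <= e * K.
Proof.
move=> sh sf.
have [L L0 HL] := lipschitz_schwartz sf.
have /choice[B HB] : forall i, exists B, forall x : 'rV[R]_n, normc ((x 0 i)%:C * h x) <= B * maj x.
  move=> i; have [M _ HM] := rapid_maj (schwartz_rapid (schwartz_mulx i sh)).
  by exists M.
exists (2 * \int[lebesgue_tuple R n]_t (L * (\sum_i B i) * maj (rowt t))) => e e0.
have s1 : schwartz (fun y => h y * f (e *: y)).
  apply: schwartz_mul => //; have := schwartz_scale 0 (lt0r_neq0 e0) sf.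
  by under [X in schwartz X -> _]eq_fun do rewrite addr0.
rewrite -mulNr -cintegralZ; last exact: schwartz_integrable.
rewrite -cintegralD; [|exact: schwartz_integrable|exact/schwartz_integrable/schwartzZ].
rewrite mulrCA -RintegralZl//; last exact: integrable_Mmaj.
apply: normc_cint => //.
- exact: (schwartz_integrable (schwartzD s1 (schwartzZ (- f 0) sh))).
- by apply: integrableRZ => //; exact: integrable_Mmaj.
- move=> t _ /=; set y := rowt t.
  rewrite mulNr mulrC -mulrBl Normc.normcM.
  rewrite (@le_trans _ _ (e * (L * \sum_i `|y 0 i|) * normc (h y)))//.
    rewrite ler_wpM2r ?normc_ge0//.
    have := HL 0 (e *: y); rewrite addr0 => /le_trans; apply.
    rewrite mulrCA ler_wpM2l// mulr_sumr ler_sum// => i _.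
    by rewrite mxE normrM gtr0_norm.
  rewrite -!mulrA ler_wpM2l ?(ltW e0)// ler_wpM2l//.
  rewrite mulr_suml mulr_suml ler_sum// => i _.
  by have := HB i y; rewrite Normc.normcM normc_real.
Qed.

(** Plays the part of uniqueness of limits; with e = d / (1 + |K| + |L|) the total error is at most
    d. *)
Lemma eq_of_dilate (u : R -> C) (a b : C) (K L : R) :
  (forall e, 0 < e -> normc (u e - a) <= e * K) ->
  (forall e, 0 < e -> normc (u e - b) <= e * L) -> a = b.
Proof.
move=> Ha Hb; apply/eqP; rewrite -subr_eq0; apply/eqP; apply: Normc.eq0_normc.
apply/eqP; rewrite eq_le normc_ge0 andbT; apply/ler_addgt0Pr => d d0; rewrite add0r.
pose e := d / (1 + `|K| + `|L|).
have k0 : 0 < 1 + `|K| + `|L| by rewrite -addrA ltr_wpDr// addr_ge0.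
have e0 : 0 < e by rewrite divr_gt0.
have -> : a - b = (u e - b) + - (u e - a) by ring.
rewrite (le_trans (le_normcD _ _))// normcN (le_trans (lerD (Hb e e0) (Ha e e0)))//.
rewrite -mulrDr /e mulrAC ler_pdivrMr// ler_wpM2l ?(ltW d0)//.
by have := ler_norm K; have := ler_norm L; lra.
Qed.

Lemma ft_mul_swap n (f h : cfun R n) : schwartz f -> schwartz h ->
  cintegral (fun w => h w * ft f w) = cintegral (fun t => ft h t * f t).
Proof.
move=> sf sh.
have sF := @schwartz_cis_dotp R (n + n) n _ lsubmx rsubmx 0 0 (- (2 * pi)) _ _ (schwartz_tens sh sf).
have {}sF : schwartz (fun x : 'rV_(n + n) => cis (- (2 * pi * dotp (lsubmx x) (rsubmx x))) * (h (lsubmx x) * f (rsubmx x))).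
  have : schwartz (fun x : 'rV_(n + n) => cis (- (2 * pi) * dotp (lsubmx x + 0) (rsubmx x + 0)) * (h (lsubmx x) * f (rsubmx x))).
    by apply: sF => k x y; rewrite linearD linearZ.
  by under [X in schwartz X -> _]eq_fun do rewrite !addr0 mulNr.
transitivity (cintegral (fun w => cintegral (fun t => cis (- (2 * pi * dotp w t)) * (h w * f t)))).
  apply: eq_cintegral => w; rewrite /ft -cintegralZ; last exact/schwartz_integrable/ft_integrable.
  by apply: eq_cintegral => t; rewrite mulrCA.
have := cintegral_swap sF.
under [X in cintegral X = _ -> _]eq_fun do under eq_fun do rewrite row_mxKl row_mxKr.
under [X in _ = cintegral X -> _]eq_fun do under eq_fun do rewrite row_mxKl row_mxKr.
move=> ->; apply: eq_cintegral => t; rewrite [RHS]mulrC /ft -cintegralZ; last exact/schwartz_integrable/ft_integrable.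
by apply: eq_cintegral => w; rewrite /= dotpC; ring.
Qed.

(* Multiplying ft f by a dilated Gaussian moves the dilation onto f; both sides
   are limits as the dilation factor tends to 0. *)
Lemma ft_inv0 n (f : cfun R n) : schwartz f -> cintegral (ft f) = f 0.
Proof.
move=> sf; have sg := @schwartz_gauss n.
have [K1 H1] := cintegral_dilate (schwartz_ft sf) sg.
have [K2 H2] := cintegral_dilate sg sf.
have G0 : gauss (0 : 'rV[R]_n) = 1 by rewrite /gauss dotp0l mulr0 expR0.
rewrite -[LHS]mul1r -G0.
apply: (eq_of_dilate H1) => e e0.
suff -> : cintegral (fun w => ft f w * gauss (e *: w)) =
          cintegral (fun y => gauss y * f (e *: y)).
  by rewrite -[X in _ - X]mulr1 -(cintegral_gauss n); exact: H2.
have en : e != 0 by rewrite gt_eqF.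
have sfe : schwartz (fun y => f (e *: y)).
  have := schwartz_scale 0 en sf.
  by under [X in schwartz X -> _]eq_fun do rewrite addr0.
have E w : ft f w = (`|e| ^+ n)%:C * ft (fun y => f (e *: y)) (e *: w).
  rewrite /ft (cintegral_scale 0 (ft_integrable w sf) en); congr (_ * _).
  by apply: eq_cintegral => t; rewrite addr0 dotpZl dotpZr.
have sP : schwartz (fun w => gauss w * ft (fun y => f (e *: y)) w).
  by apply: schwartz_mul => //; exact: schwartz_ft.
transitivity (cintegral (fun w => gauss w * ft (fun y => f (e *: y)) w)).
  rewrite [RHS](cintegral_scale 0 sP en).
  rewrite -cintegralZ; last exact: (schwartz_integrable (schwartz_scale 0 en sP)).
  by apply: eq_cintegral => w; rewrite addr0 E mulrC mulrCA.
by rewrite ft_mul_swap// ft_gauss.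
Qed.

(** Inversion at 0 for the translate of [f] by [x], whose transform is the modulated transform of
    [f]. *)
Lemma ft_inv n (f : cfun R n) x : schwartz f ->
  cintegral (fun w => cis (2 * pi * dotp w x) * ft f w) = f x.
Proof.
move=> sf; have st : schwartz (fun t => f (t + x)).
  have := schwartz_scale x (oner_neq0 _) sf.
  by under [X in schwartz X -> _]eq_fun do rewrite scale1r.
have := ft_inv0 st; rewrite add0r => <-.
apply: eq_cintegral => w.
rewrite /ft -(cintegral_translate x (ft_integrable w sf)) -cintegralZ; last first.
  have := schwartz_scale x (oner_neq0 _) (ft_integrable w sf).
  by under [X in schwartz X -> _]eq_fun do rewrite scale1r; exact: schwartz_integrable.
apply: eq_cintegral => t; rewrite mulrA -cisD dotpDr; congr (cis _ * _); ring.
Qed.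

End fourier_inversion.

(** * The Weyl symbol of a convolution *)

Section wigner_convolution.
Context {R : realType}.
Local Notation C := R[i].
Local Open Scope complex_scope.

Lemma lin_comb d (a b a' b' : R) : lin (fun z : 'rV[R]_(d + d) =>
  row_mx (a *: lsubmx z + b *: rsubmx z) (a' *: lsubmx z + b' *: rsubmx z)).
Proof.
move=> k x y; rewrite -row_mx_lin !linearD !linearZ /=.
by congr row_mx; rewrite !scalerA !(mulrC k) addrACA.
Qed.

(** Scalar 2-by-2 matrices acting on pairs of vectors; the inverse is given by Cramer's rule. The
    shear (x + t/2, x - t/2) and the arguments of a convolution are of this form. *)
Lemma schwartz_comb d (F : cfun R (d + d)) (a b a' b' : R) : a * b' - a' * b != 0 ->
  schwartz F -> schwartz (fun z : 'rV[R]_(d + d) =>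
    F (row_mx (a *: lsubmx z + b *: rsubmx z) (a' *: lsubmx z + b' *: rsubmx z))).
Proof.
move=> D sF; set D' := a * b' - a' * b in D.
apply: (schwartz_lin _ (@lin_comb d (b' / D') (- b / D') (- a' / D') (a / D'))) => //.
  exact: lin_comb.
move=> z; rewrite row_mxKl row_mxKr -[RHS]hsubmxK.
congr row_mx; rewrite !scalerDr !scalerA addrACA -!scalerDl.
  have -> : b' / D' * a + - b / D' * a' = 1 by rewrite /D'; field.
  have -> : b' / D' * b + - b / D' * b' = 0 by field.
  by rewrite scale1r scale0r addr0.
have -> : - a' / D' * a + a / D' * a' = 0 by field.
have -> : - a' / D' * b + a / D' * b' = 1 by rewrite /D'; field.
by rewrite scale1r scale0r add0r.
Qed.

(** The local correlation at [x], whose Fourier transform in t is the Wigner distribution. *)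
Definition wint d (psi phi : cfun R d) (x : 'rV[R]_d) : cfun R d :=
  fun t => psi (x + 2^-1 *: t) * conjc (phi (x - 2^-1 *: t)).

Lemma wigner_ft d (psi phi : cfun R d) z :
  wigner psi phi z = ft (wint psi phi (lsubmx z)) (rsubmx z).
Proof. by apply: eq_cintegral => t; rewrite mulrC. Qed.

Lemma schwartz_wint2 d (psi phi : cfun R d) : schwartz psi -> schwartz phi ->
  schwartz (fun z : 'rV_(d + d) => wint psi phi (lsubmx z) (rsubmx z)).
Proof.
move=> s1 s2.
have := @schwartz_comb d _ 1 2^-1 1 (- 2^-1) _ (schwartz_tens s1 (schwartz_conj s2)).
under [X in (_ -> schwartz X) -> _]eq_fun do rewrite row_mxKl row_mxKr !scale1r scaleNr.
by apply; rewrite (_ : _ - _ = -1) ?oppr_eq0 ?oner_eq0//; field.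
Qed.

Lemma schwartz_wint d (psi phi : cfun R d) x : schwartz psi -> schwartz phi ->
  schwartz (wint psi phi x).
Proof.
move=> s1 s2; have := schwartz_slice x (schwartz_wint2 s1 s2).
by under [X in schwartz X -> _]eq_fun do rewrite row_mxKl row_mxKr.
Qed.

Lemma schwartz_wigner d (psi phi : cfun R d) : schwartz psi -> schwartz phi ->
  schwartz (wigner psi phi).
Proof.
move=> s1 s2; have := schwartz_pft (schwartz_wint2 s1 s2).
congr schwartz; apply/funext => z; rewrite wigner_ft.
by apply: eq_cintegral => t; rewrite row_mxKl row_mxKr.
Qed.

Lemma schwartz_reflect n (f : cfun R n) c : schwartz f -> schwartz (fun x => f (c - x)).
Proof.
have N1 : (-1 : R) != 0 by rewrite oppr_eq0 oner_eq0.
move=> /(schwartz_scale c N1).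
by under [X in schwartz X -> _]eq_fun do rewrite scaleN1r addrC.
Qed.

Lemma schwartz_reflect_fun n (f : cfun R n) : schwartz f -> schwartz (reflect_fun f).
Proof.
move=> /(schwartz_reflect 0).
by under [X in schwartz X -> _]eq_fun do rewrite sub0r.
Qed.

Lemma schwartz_conv2 n (f g : cfun R n) : schwartz f -> schwartz g ->
  schwartz (fun z : 'rV_(n + n) => f (rsubmx z) * g (lsubmx z - rsubmx z)).
Proof.
move=> sf sg; have := @schwartz_comb n _ 0 1 1 (-1) _ (schwartz_tens sf sg).
under [X in (_ -> schwartz X) -> _]eq_fun do rewrite row_mxKl row_mxKr scale0r add0r !scale1r scaleN1r.
by apply; rewrite mul0r mul1r sub0r oppr_eq0 oner_eq0.
Qed.

Lemma schwartz_conv n (f g : cfun R n) : schwartz f -> schwartz g -> schwartz (Defs.conv f g).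
Proof.
move=> sf sg; have := schwartz_cintegral (schwartz_conv2 sf sg).
by under [X in schwartz X -> _]eq_fun do under eq_fun do rewrite row_mxKl row_mxKr.
Qed.

Lemma consr_row_mx m n s (x : 'rV[R]_m) (y : 'rV[R]_n) :
  consr s (row_mx x y) = row_mx (consr s x) y :> 'rV_(m + n).+1.
Proof. by rewrite /consr row_mxA castmx_id. Qed.

Lemma cintegral_split m n (F : cfun R (m + n)) : schwartz F ->
  cintegral F = cintegral (fun x => cintegral (fun y => F (row_mx x y))).
Proof.
elim: m F => [|m IH] F sF.
  by rewrite cintegral_rV0; apply: eq_cintegral => y; rewrite row_mx_rV0.
rewrite (cintegral_cons1 sF) (cintegral_cons1 (schwartz_cintegral sF)).
apply: eq_cint => // s _; rewrite (IH _ (schwartz_consr s sF)).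
by apply: eq_cintegral => x; apply: eq_cintegral => y; rewrite consr_row_mx.
Qed.

Lemma ft_opp n (f : cfun R n) w : schwartz f -> ft f (- w) = ft (fun t => f (- t)) w.
Proof.
move=> sf; rewrite /ft -(cintegral_opp 0 (ft_integrable (- w) sf)).
by apply: eq_cintegral => t; rewrite sub0r dotpNl dotpNr opprK.
Qed.

Lemma ft_ft n (f : cfun R n) t : schwartz f -> ft (ft f) t = f (- t).
Proof.
move=> sf; rewrite -(ft_inv (- t) sf); apply: eq_cintegral => w.
by rewrite dotpNr [dotp w t]dotpC mulrN.
Qed.

(** The factor ft A (y - w) is the transform of the modulated, reflected A. The multiplication
    formula then moves this transform onto ft B, where applying it twice leaves B reflected. *)
Lemma ft_convolution n (A B : cfun R n) y : schwartz A -> schwartz B ->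
  cintegral (fun w => ft A (y - w) * ft B w) =
  cintegral (fun t => cis (- (2 * pi * dotp y t)) * (A t * B t)).
Proof.
move=> sA sB; pose A' t := cis (- (2 * pi * dotp y t)) * A t.
have sA' : schwartz A' by exact: ft_integrable.
pose A'' t := A' (- t).
have sA'' : schwartz A'' by exact: schwartz_reflect_fun sA'.
have E w : ft A (y - w) = ft A'' w.
  rewrite -(ft_opp w sA'); apply: eq_cintegral => t.
  by rewrite /A' mulrA -cisD dotpDl; congr (cis _ * _); ring.
transitivity (cintegral (fun w => ft B w * ft A'' w)).
  by apply: eq_cintegral => w; rewrite E mulrC.
rewrite ft_mul_swap//; last exact: schwartz_ft.
have sP : schwartz (fun t => cis (- (2 * pi * dotp y t)) * (A t * B t)).
  by apply: ft_integrable; exact: schwartz_mul.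
rewrite -[RHS](cintegral_opp 0 sP); apply: eq_cintegral => t.
by rewrite ft_ft// sub0r /A'' /A'; ring.
Qed.

Section moyal.
Variables (d : nat) (psi zeta eta : cfun R d) (y : 'rV[R]_(d + d)).
Hypotheses (spsi : schwartz psi) (szeta : schwartz zeta) (seta : schwartz eta).
Local Notation y1 := (lsubmx y).
Local Notation y2 := (rsubmx y).

(** With u = x + t/2 and v = x - t/2 in Moyal's integral, [p] gathers the factors depending on u and
    [q] those depending on v. *)
Let p : cfun R d := fun u => cis (- (2 * pi * dotp y2 u)) * (zeta u * conjc (psi (y1 - u))).
Let q : cfun R d := fun v => cis (2 * pi * dotp y2 v) * (eta v * psi (y1 - v)).

Let sp : schwartz p.
Proof.
apply: ft_integrable; apply: schwartz_mul => //.
exact: schwartz_conj (schwartz_reflect y1 spsi).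
Qed.

Let sq : schwartz q.
Proof.
by apply: schwartz_cis; apply: schwartz_mul => //; exact: schwartz_reflect.
Qed.

Let H : cfun R (d + d) := fun z => p (lsubmx z) * q (rsubmx z).

Let sH : schwartz H.
Proof. exact: schwartz_tens. Qed.

Let H_comb a b a' b' : a * b' - a' * b != 0 -> schwartz (fun z : 'rV[R]_(d + d) =>
  p (a *: lsubmx z + b *: rsubmx z) * q (a' *: lsubmx z + b' *: rsubmx z)).
Proof.
move=> D; have := schwartz_comb D sH.
by under [X in schwartz X -> _]eq_fun do rewrite /H row_mxKl row_mxKr.
Qed.

(** The shear has Jacobian 1: at fixed t a translation of x by t/2 leads to p(x) q(x - t), and at
    fixed x the reflection t -> x - t separates the two integrals. *)
Let cintegral_shear :
  cintegral (fun x => cintegral (fun t => p (x + 2^-1 *: t) * q (x - 2^-1 *: t))) =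
  cintegral p * cintegral q.
Proof.
have s1 : schwartz (fun z : 'rV[R]_(d + d) =>
    p (lsubmx z + 2^-1 *: rsubmx z) * q (lsubmx z - 2^-1 *: rsubmx z)).
  have := @H_comb 1 2^-1 1 (- 2^-1).
  under [X in (_ -> schwartz X) -> _]eq_fun do rewrite !scale1r scaleNr.
  by apply; rewrite (_ : _ - _ = -1) ?oppr_eq0 ?oner_eq0//; field.
have s2 : schwartz (fun z : 'rV[R]_(d + d) =>
    p (lsubmx z) * q (lsubmx z - rsubmx z)).
  have := @H_comb 1 0 1 (- 1).
  under [X in (_ -> schwartz X) -> _]eq_fun do rewrite !scale1r scale0r addr0 scaleN1r.
  by apply; rewrite mulr0 subr0 mul1r oppr_eq0 oner_eq0.
have := cintegral_swap s1.
under [X in cintegral X = _ -> _]eq_fun do under eq_fun do rewrite row_mxKl row_mxKr.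
under [X in _ = cintegral X -> _]eq_fun do under eq_fun do rewrite row_mxKl row_mxKr.
move=> ->.
transitivity (cintegral (fun t => cintegral (fun x => p x * q (x - t)))).
  apply: eq_cintegral => t.
  have s3 : schwartz (fun x => p x * q (x - t)).
    have := schwartz_slicel t s2.
    by under [X in schwartz X -> _]eq_fun do rewrite row_mxKl row_mxKr.
  rewrite -[RHS](cintegral_translate (2^-1 *: t) s3).
  apply: eq_cintegral => x; congr (_ * q _); rewrite -addrA; congr (_ + _).
  by rewrite -[X in _ = _ - X]scale1r -scalerBl -scaleNr; congr (_ *: _); lra.
have := cintegral_swap s2.
under [X in cintegral X = _ -> _]eq_fun do under eq_fun do rewrite row_mxKl row_mxKr.
under [X in _ = cintegral X -> _]eq_fun do under eq_fun do rewrite row_mxKl row_mxKr.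
move=> <-; rewrite [RHS]mulrC -cintegralZ; last exact: schwartz_integrable.
apply: eq_cintegral => x; rewrite [RHS]mulrC.
rewrite cintegralZ; last exact: (schwartz_integrable (schwartz_reflect x sq)).
by rewrite cintegral_opp.
Qed.

(** At a fixed position x, the convolution in the frequency variable turns into a product of
    correlations by [ft_convolution]; [cintegral_shear] then separates the integral over (x, t). *)
Lemma moyal :
  cintegral (fun w => wigner psi psi (y - w) * wigner zeta (conjf eta) w) =
  cintegral p * cintegral q.
Proof.
have sW1 := schwartz_wigner spsi spsi.
have sW2 := schwartz_wigner szeta (schwartz_conj seta).
rewrite cintegral_split; last exact: (schwartz_mul (schwartz_reflect y sW1) sW2).
rewrite -cintegral_shear; apply: eq_cintegral => x.
pose A := wint psi psi (y1 - x); pose B := wint zeta (conjf eta) x.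
transitivity (cintegral (fun w => ft A (y2 - w) * ft B w)).
  apply: eq_cintegral => w; rewrite !wigner_ft row_mxKl row_mxKr.
  by rewrite !linearB /= row_mxKl row_mxKr.
have sA : schwartz A by exact: schwartz_wint.
have sB : schwartz B by apply: schwartz_wint => //; exact: schwartz_conj.
rewrite ft_convolution//; apply: eq_cintegral => t.
rewrite /A /B /wint /p /q /conjf conjcK.
have -> : y1 - (x + 2^-1 *: t) = y1 - x - 2^-1 *: t by rewrite opprD addrA.
have -> : y1 - (x - 2^-1 *: t) = y1 - x + 2^-1 *: t by rewrite opprB addrA addrAC.
set a := psi _; set b := conjc _; set c := zeta _; set e := eta _.
(* The phase factors because t is the difference of x + t/2 and x - t/2. *)
have -> : cis (- (2 * pi * dotp y2 t)) =
    cis (- (2 * pi * dotp y2 (x + 2^-1 *: t))) * cis (2 * pi * dotp y2 (x - 2^-1 *: t)).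
  by rewrite -cisD !dotpDr dotpNr dotpZr; congr cis; field.
by ring.
Qed.

(** The substitution x -> y1 - x in both integrals combines the reflection in [check_op] with the
    translation in pi(y). *)
Lemma alpha_rank_one :
  alpha y (check_op (rank_one psi)) zeta eta = cintegral p * cintegral q.
Proof.
have -> : cintegral p = inner (reflect_fun (tfshift_adj y zeta)) psi.
  rewrite -(cintegral_opp y1 sp); apply: eq_cintegral => x.
  by rewrite /p /reflect_fun /tfshift_adj subKr [- x + y1]addrC mulrA.
set c := inner _ _.
have sq' := schwartz_reflect y1 sq.
rewrite -(cintegral_opp y1 sq) -cintegralZ; last exact: schwartz_integrable.
apply: eq_cintegral => x.
rewrite /c /reflect_fun /conjf /tfshift_adj /conjf conjcM conjcK conj_cis opprK.
rewrite /q subKr [- x + y1]addrC; ring.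
Qed.

End moyal.

Lemma star_symbol d (f : cfun R (d + d)) (psi : cfun R d) : schwartz f -> schwartz psi ->
  is_schwartz_symbol (star_fun_op f (check_op (rank_one psi)))
    (Defs.conv f (reflect_fun (wigner psi psi))).
Proof.
move=> sf spsi; have sW := schwartz_wigner spsi spsi.
split; first exact: (schwartz_conv sf (schwartz_reflect_fun sW)).
move=> zeta szeta eta seta.
set W := wigner psi psi in sW *; set V := wigner zeta (conjf eta).
have sV : schwartz V by apply: schwartz_wigner => //; exact: schwartz_conj.
(* A tensor product of three Schwartz functions restricted to the subspace of points (w, z, z -
   w). *)
have sF : schwartz (fun z : 'rV[R]_((d + d) + (d + d)) =>
    V (rsubmx z) * (f (lsubmx z) * W (lsubmx z - rsubmx z))).
  have := @schwartz_lin R ((d + d) + (d + d)) ((d + d) + ((d + d) + (d + d))) _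
    (fun z => row_mx (rsubmx z) (row_mx (lsubmx z) (lsubmx z - rsubmx z)))
    (fun u => row_mx (lsubmx (rsubmx u)) (lsubmx u)) _ _ _
    (schwartz_tens sV (schwartz_tens sf sW)).
  under [X in _ -> _ -> _ -> schwartz X]eq_fun do rewrite row_mxKl row_mxKr row_mxKl row_mxKr.
  apply.
  - move=> k x z; rewrite -!row_mx_lin !linearD !linearZ /=.
    congr (row_mx _ (row_mx _ _)).
    by rewrite addrACA.
  - by move=> k x z; rewrite -!row_mx_lin !linearD !linearZ.
  - by move=> z; rewrite row_mxKr !row_mxKl hsubmxK.
transitivity (cintegral (fun z => cintegral (fun w => V w * (f z * W (z - w))))).
  apply: eq_cintegral => z; rewrite alpha_rank_one// -moyal//.
  rewrite -cintegralZ; last first.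
    exact: (schwartz_integrable (schwartz_mul (schwartz_reflect z sW) sV)).
  by apply: eq_cintegral => w; rewrite /V /W; ring.
have := cintegral_swap sF.
under [X in cintegral X = _ -> _]eq_fun do under eq_fun do rewrite row_mxKl row_mxKr.
under [X in _ = cintegral X -> _]eq_fun do under eq_fun do rewrite row_mxKl row_mxKr.
move=> ->; apply: eq_cintegral => w; rewrite -/V.
rewrite [RHS]mulrC /Defs.conv -cintegralZ; last first.
  exact: (schwartz_integrable (schwartz_mul sf (schwartz_reflect w (schwartz_reflect_fun sW)))).
by apply: eq_cintegral => z; rewrite /reflect_fun opprB.
Qed.

End wigner_convolution.

(** * Averages of tempered distributions *)

Section tempered_functionals.
Context {R : realType}.
Local Notation C := R[i].
Local Notation Re := (@complex.Re R).
Local Notation Im := (@complex.Im R).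
Local Notation normc := (@Normc.normc R).
Local Open Scope complex_scope.
Local Notation leb := (@lebesgue_measure R).

Lemma weighted_ge0 n k s (f : cfun R n) x : 0 <= weighted k s f x.
Proof. by rewrite mulr_ge0 ?normc_ge0 ?exprn_ge0 ?addr_ge0. Qed.

Lemma seminorm_le n k s (f : cfun R n) (B : R) :
  (forall x, weighted k s f x <= B) -> seminorm k s f <= B.
Proof.
move=> H; apply: ge_sup; first by exists (weighted k s f 0); exists 0.
by move=> _ [x _ <-]; exact: H.
Qed.

(** Continuity in usable form: any pointwise bounds [B] may replace the suprema, and the constant is
    nonnegative. *)
Lemma tempered_bound n (T : functional R n) : tempered T ->
  exists c (l : seq (nat * seq 'I_n)), 0 <= c /\
    forall f (B : nat * seq 'I_n -> R), schwartz f ->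
    (forall p x, weighted p.1 p.2 f x <= B p) ->
    normc (T f) <= c * \sum_(p <- l) B p.
Proof.
move=> [_ [c [l H]]]; exists `|c|, l; split=> // f B sf HB.
rewrite (le_trans (H f sf))//.
rewrite (@le_trans _ _ (`|c| * \sum_(p <- l) seminorm p.1 p.2 f))//.
  rewrite ler_wpM2r ?ler_norm// sumr_ge0// => p _.
  rewrite (le_trans (weighted_ge0 p.1 p.2 f 0))//.
  by apply: ub_le_sup; [exact: sf.2|exists 0].
by rewrite ler_wpM2l// ler_sum// => p _; apply: seminorm_le => x; exact: HB.
Qed.

Lemma tempered0 n (T : functional R n) : tempered T -> T (fun=> 0) = 0.
Proof.
move=> [H _]; have := H 1 _ _ (schwartz0 n) (schwartz0 n).
have -> : (fun _ : 'rV[R]_n => 1 * 0 + 0 : C) = fun=> 0 by apply/funext => x; rewrite mulr0 addr0.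
rewrite mul1r.
by move=> /eqP; rewrite -subr_eq0 opprD addNKr oppr_eq0 => /eqP.
Qed.

Lemma temperedZ n (T : functional R n) c f : tempered T -> schwartz f ->
  T (fun x => c * f x) = c * T f.
Proof.
move=> tT sf; have := tT.1 c _ _ sf (schwartz0 n).
rewrite tempered0// addr0 => <-.
by congr T; apply/funext => x; rewrite addr0.
Qed.

Lemma schwartz_partials n (h : cfun R n) t : schwartz h -> schwartz (cpartials t h).
Proof. by move=> sh; elim: t => //= i t; exact: schwartz_partial. Qed.

Lemma cpartialsL n s (c : C) (f g : cfun R n) : schwartz f -> schwartz g ->
  cpartials s (fun x => c * f x + g x) =
  fun x => c * cpartials s f x + cpartials s g x.
Proof.
move=> sf sg; elim: s => //= i s ->; apply/funext => x.
apply: cder_uniq; apply: cderD; last exact/schwartz_cder/schwartz_partials.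
by apply: cderZ; exact/schwartz_cder/schwartz_partials.
Qed.

Lemma consr_e n s (h : R) (i : 'I_n) (y : 'rV[R]_n) :
  consr s (h *: e_ i + y) = h *: e_ (lift ord0 i) + consr s y.
Proof.
apply/rowP => j; rewrite [RHS]mxE [X in _ = X + _]mxE.
case: (unliftP ord0 j) => [j'|] ->; rewrite ?consrS ?consr0 !mxE eqxx /=.
  by rewrite (inj_eq (@lift_inj _ _)).
by rewrite mulr0 add0r.
Qed.

Section consr_rapid.
Variables (n : nat) (F : cfun R n.+1).
Hypothesis sF : schwartz F.

(** Four extra orders of decay in s give two factors 1/(1 + s^2): one for integrability, one for the
    size of the tail in [T_pint_tail]. *)
Lemma consr_rapid k : exists2 M, 0 <= M & forall s x,
  (1 + `|x|) ^+ k * normc (F (consr s x)) <= M * ((oneDsqr s)^-1 * (oneDsqr s)^-1).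
Proof.
have [M HM] := schwartz_rapid sF (k + (2 + 2))%N.
have M0 : 0 <= M by rewrite (le_trans _ (HM 0))// mulr_ge0 ?normc_ge0 ?exprn_ge0 ?addr_ge0.
exists M => // s x; rewrite -invfM ler_pdivlMr ?mulr_gt0 ?oneDsqr_gt0//.
rewrite (le_trans _ (HM (consr s x)))// mulrAC ler_wpM2r ?normc_ge0// exprD [X in _ <= _ * X]exprD.
have H1 : `|x| <= `|consr s x|.
  by apply: norm_le_coord => // i; rewrite -(consrS s x) coord_le.
have H2 : oneDsqr s <= (1 + `|consr s x|) ^+ 2.
  have := coord_le (consr s x) ord0; rewrite consr0 => H.
  have : `|s| ^+ 2 <= `|consr s x| ^+ 2 by rewrite lerXn2r ?nnegrE.
  rewrite real_normK ?num_real// /oneDsqr; have := normr_ge0 (consr s x); nra.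
have O0 : 0 <= oneDsqr s by exact/ltW/oneDsqr_gt0.
rewrite ler_pM ?exprn_ge0 ?addr_ge0 ?mulr_ge0//.
  by rewrite lerXn2r ?nnegrE ?addr_ge0// lerD2l.
by rewrite ler_pM.
Qed.

End consr_rapid.

(** The weight [chi] will be the indicator of an interval, that of its complement, or the constant
    1. *)
Definition pint n (chi : R -> R) (G : cfun R n.+1) : cfun R n := fun x =>
  cint leb setT (fun s => (chi s)%:C * G (consr s x)).

Section schwartz_pint.
Variables (n : nat) (chi : R -> R).
Hypothesis mchi : measurable_fun setT chi.
Hypothesis chi1 : forall s, `|chi s| <= 1.
Implicit Type F : cfun R n.+1.

Lemma cintegrable_pint F x : schwartz F ->
  cintegrable leb setT (fun s => (chi s)%:C * F (consr s x)).
Proof.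
move=> sF; have [i1 i2] := cintegrable_consr sF x.
have [M M0 HM] := consr_rapid sF 0.
apply: (@cintegrable_dom _ _ _ _ _ _ _ (fun s : measurableTypeR R => M * (oneDsqr s)^-1)) => //.
- rewrite (_ : _ \o _ = fun s : measurableTypeR R => chi s * Re (F (consr s x))).
    apply: measurable_funM => //.
    by apply/measurable_EFinP; exact: measurable_int i1.
  by apply/funext => s; rewrite /= cReM /= mul0r subr0.
- rewrite (_ : _ \o _ = fun s : measurableTypeR R => chi s * Im (F (consr s x))).
    apply: measurable_funM => //.
    by apply/measurable_EFinP; exact: measurable_int i2.
  by apply/funext => s; rewrite /= cImM /= mul0r addr0.
- by apply: integrableRZ => //; exact: integrable_inv_oneDsqr.
- move=> s _; rewrite Normc.normcM normc_real.
  rewrite (@le_trans _ _ (normc (F (consr s x))))// ?ler_piMl ?normc_ge0//.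
  have := HM s x; rewrite expr0 mul1r => /le_trans; apply.
  by rewrite ler_wpM2l// ler_piMr ?inv_oneDsqr_le1 ?inv_oneDsqr_ge0.
Qed.

Lemma cder_pint F x i : schwartz F ->
  cder (pint chi F) x (e_ i) (pint chi (cpartial (lift ord0 i) F) x).
Proof.
move=> sF; have sF' := schwartz_partial (lift ord0 i) sF.
have [M M0 HM] := consr_rapid sF' 0.
apply: (@cder_under _ _ _ leb setT measurableT n
  (fun x s => (chi s)%:C * F (consr s x))
  (fun x s => (chi s)%:C * cpartial (lift ord0 i) F (consr s x)) x _
  (fun s => M * (oneDsqr s)^-1)).
- by move=> y; exact: cintegrable_pint.
- move=> y s; apply: cderZ.
  apply: (@cder_affine _ _ _ (consr s) F _ _ (e_ (lift ord0 i))); last exact: schwartz_cder.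
  by move=> h; exact: consr_e.
- by move=> s; rewrite mulr_ge0// inv_oneDsqr_ge0.
- by apply: integrableRZ => //; exact: integrable_inv_oneDsqr.
- move=> h s _ _; rewrite Normc.normcM normc_real.
  set z := consr _ _.
  rewrite (@le_trans _ _ (normc (cpartial (lift ord0 i) F z)))// ?ler_piMl ?normc_ge0//.
  have := HM s (h *: e_ i + x); rewrite expr0 mul1r => /le_trans; apply.
  by rewrite ler_wpM2l// ler_piMr ?inv_oneDsqr_le1 ?inv_oneDsqr_ge0.
Qed.

Lemma normc_pint F (G : R -> R) (B : R) k x : schwartz F ->
  leb.-integrable setT (EFin \o G) -> 2 * \int[leb]_s G s <= B ->
  (forall s, `|chi s| * ((1 + `|x|) ^+ k * normc (F (consr s x))) <= G s) ->
  (1 + `|x|) ^+ k * normc (pint chi F x) <= B.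
Proof.
move=> sF iG HB HG.
have p0 : 0 < (1 + `|x|) ^+ k by rewrite exprn_gt0// ltr_pwDl.
rewrite mulrC -ler_pdivlMr// mulrC.
rewrite (@le_trans _ _ (((1 + `|x|) ^+ k)^-1 * (2 * \int[leb]_s G s)))//; last first.
  by rewrite ler_wpM2l// invr_ge0 ltW.
rewrite mulrCA -RintegralZl//.
apply: normc_cint => //.
- exact: cintegrable_pint.
- by apply: integrableRZ.
- move=> s _; rewrite Normc.normcM normc_real [leRHS]mulrC ler_pdivlMr//.
  by rewrite -mulrA [normc _ * _]mulrC; exact: HG.
Qed.

Lemma schwartz_pint F : schwartz F -> schwartz (pint chi F).
Proof.
move=> sF; pose S : set (cfun R n) := [set pint chi F | F in @schwartz R n.+1].
apply: (@schwartz_coind _ _ S); last by exists F.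
- move=> _ [G sG <-] k; have [M M0 HM] := consr_rapid sG k.
  exists (2 * \int[leb]_s (M * (oneDsqr s)^-1)) => x.
  apply: (normc_pint (G := fun s => M * (oneDsqr s)^-1)) => //.
    by apply: integrableRZ => //; exact: integrable_inv_oneDsqr.
  move=> s; rewrite (@le_trans _ _ ((1 + `|x|) ^+ k * normc (G (consr s x))))//.
    by rewrite ler_piMl// mulr_ge0 ?normc_ge0 ?exprn_ge0 ?addr_ge0.
  rewrite (le_trans (HM s x))//.
  by rewrite ler_wpM2l// ler_piMr ?inv_oneDsqr_le1 ?inv_oneDsqr_ge0.
- move=> _ i [G sG <-]; exists (pint chi (cpartial (lift ord0 i) G)).
    by exists (cpartial (lift ord0 i) G) => //; exact: schwartz_partial.
  by move=> x; exact: cder_pint.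
Qed.

Lemma cpartials_pint F t : schwartz F ->
  cpartials t (pint chi F) = pint chi (cpartials (map (lift ord0) t) F).
Proof.
move=> sF; elim: t => //= i t ->; apply/funext => x.
by apply: cder_uniq; apply: cder_pint; exact: schwartz_partials.
Qed.

Lemma cpartials_consr F t s : schwartz F ->
  cpartials t (fun x => F (consr s x)) = fun x => cpartials (map (lift ord0) t) F (consr s x).
Proof.
move=> sF; elim: t => //= i t ->; apply/funext => x; apply: cder_uniq.
apply: (@cder_affine _ _ _ (consr s) _ _ _ (e_ (lift ord0 i))); last first.
  by apply: schwartz_cder; exact: schwartz_partials.
by move=> h; exact: consr_e.
Qed.

End schwartz_pint.

End tempered_functionals.

Section wigner_totality.
Context {R : realType}.
Local Notation C := R[i].
Local Notation Re := (@complex.Re R).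
Local Notation Im := (@complex.Im R).
Local Notation normc := (@Normc.normc R).
Local Open Scope complex_scope.
Local Notation leb := (@lebesgue_measure R).

Section average.
Variables (n : nat) (F : cfun R n.+1) (T : functional R n).
Hypotheses (sF : schwartz F) (tT : tempered T).

(** Half-open, so that the indicators of adjacent intervals add up exactly. *)
Definition itvI (a b : R) : R -> R := \1_(`[a, b[%classic).

Lemma itvI_E a b s : itvI a b s = ((a <= s) && (s < b))%:R.
Proof.
rewrite /itvI indicE; congr (_%:R); congr nat_of_bool.
by apply/idP/idP; rewrite inE/= in_itv.
Qed.

Lemma measurable_itvI a b : measurable_fun setT (itvI a b).
Proof. exact: measurable_indic. Qed.

Lemma itvI_le1 a b s : `|itvI a b s| <= 1.
Proof. by rewrite itvI_E; case: (_ && _); rewrite ?normr1 ?normr0. Qed.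

Lemma integral_itvI a b :
  (\int[leb]_s (itvI a b s)%:E)%E = leb (`[a, b[%classic : set R).
Proof. by rewrite /itvI integral_indic// setIT. Qed.

Lemma integrable_itvI a b : leb.-integrable setT (EFin \o itvI a b).
Proof.
apply/integrableP; split; first by apply/measurable_EFinP; exact: measurable_itvI.
have -> : (\int[leb]_s `|(EFin \o itvI a b) s| = \int[leb]_s (itvI a b s)%:E)%E.
  by apply: eq_integral => s _; rewrite /= ger0_norm// itvI_E.
rewrite integral_itvI lebesgue_measure_itv/=.
by case: ifP => _; rewrite ltry.
Qed.

Lemma Rintegral_itvI (a h : R) : 0 <= h -> \int[leb]_s itvI a (a + h) s = h.
Proof.
move=> h0; rewrite /Rintegral integral_itvI lebesgue_measure_itv/=.
rewrite lte_fin ltrDl; case: ltP => [_|h0'] /=; first by rewrite addrC addKr.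
by apply/eqP; rewrite eq_le h0 h0'.
Qed.

Lemma pintD (c1 c2 c : R -> R) : measurable_fun setT c1 -> measurable_fun setT c2 ->
  (forall s, `|c1 s| <= 1) -> (forall s, `|c2 s| <= 1) ->
  (forall s, c s = c1 s + c2 s) ->
  pint c F = fun x => 1 * pint c1 F x + pint c2 F x.
Proof.
move=> m1 m2 b1 b2 E; apply/funext => x; rewrite mul1r /pint.
rewrite -(cintD measurableT (cintegrable_pint m1 b1 x sF) (cintegrable_pint m2 b2 x sF)).
by apply: eq_cint => // s _; rewrite E rmorphD mulrDl.
Qed.

Lemma T_pintD (c1 c2 c : R -> R) : measurable_fun setT c1 -> measurable_fun setT c2 ->
  (forall s, `|c1 s| <= 1) -> (forall s, `|c2 s| <= 1) ->
  (forall s, c s = c1 s + c2 s) ->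
  T (pint c F) = T (pint c1 F) + T (pint c2 F).
Proof.
move=> m1 m2 b1 b2 E; rewrite (pintD m1 m2 b1 b2 E).
by rewrite tT.1 ?mul1r//; exact: schwartz_pint.
Qed.

(** The error of one Riemann term, in every seminorm. On an interval of length h the integrand
    differs from its value at the left end by at most 2 M h (real and imaginary parts), so the
    integral by 2 M h^2; the factor 2 of [normc_cint] makes it 4 M h^2. *)
Lemma pint_itv_sub k t : exists2 M, 0 <= M & forall a h x, 0 <= h ->
  weighted k t (fun x => (- h)%:C * F (consr a x) + pint (itvI a (a + h)) F x) x <= M * h ^+ 2.
Proof.
pose G := cpartials (map (lift ord0) t) F.
have sG : schwartz G by exact: schwartz_partials.
have sG0 := schwartz_partial ord0 sG.
have [M M0 HM] := consr_rapid sG0 k.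
exists (4 * M) => [|a h x h0]; first by rewrite mulr_ge0.
have mI := measurable_itvI a (a + h).
have bI := itvI_le1 a (a + h).
rewrite /weighted cpartialsL; [|exact: schwartz_consr|exact: schwartz_pint].
rewrite cpartials_consr// cpartials_pint// -/G.
(* The sampled term is an integral over the same interval, so that the error becomes one integral of
   a difference. *)
have icst : cintegrable leb setT (fun s => (- (itvI a (a + h) s))%:C * G (consr a x)).
  split.
    rewrite (_ : _ \o _ = EFin \o (fun s => - Re (G (consr a x)) * itvI a (a + h) s)).
      by apply: integrableRZ => //; exact: integrable_itvI.
    by apply/funext => s; rewrite /= cReM /= mul0r subr0 mulNr mulrC mulNr.
  rewrite (_ : _ \o _ = EFin \o (fun s => - Im (G (consr a x)) * itvI a (a + h) s)).
    by apply: integrableRZ => //; exact: integrable_itvI.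
  by apply/funext => s; rewrite /= cImM /= mul0r addr0 mulNr mulrC mulNr.
have ip := cintegrable_pint mI bI x sG.
have -> : (- h)%:C * G (consr a x) + pint (itvI a (a + h)) G x =
    cint leb setT (fun s => (- (itvI a (a + h) s))%:C * G (consr a x) +
       (itvI a (a + h) s)%:C * G (consr s x)).
  rewrite cintD//; congr (_ + _); apply: complexP.
    transitivity ((-1 * \int[leb]_s itvI a (a + h) s) * Re (G (consr a x))).
      by rewrite Rintegral_itvI// cReM /= mul0r subr0 mulN1r.
    rewrite -RintegralZl//; last exact: integrable_itvI.
    rewrite -RintegralZr//; last by apply: integrableRZ => //; exact: integrable_itvI.
    by apply: eq_Rintegral => s _; rewrite cReM /= mul0r subr0 mulN1r.
  transitivity ((-1 * \int[leb]_s itvI a (a + h) s) * Im (G (consr a x))).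
    by rewrite Rintegral_itvI// cImM /= mul0r addr0 mulN1r.
  rewrite -RintegralZl//; last exact: integrable_itvI.
  rewrite -RintegralZr//; last by apply: integrableRZ => //; exact: integrable_itvI.
  by apply: eq_Rintegral => s _; rewrite cImM /= mul0r addr0 mulN1r.
have p0 : 0 < (1 + `|x|) ^+ k by rewrite exprn_gt0// ltr_pwDl.
rewrite mulrC -ler_pdivlMr//.
have HB : 2 * \int[leb]_s (2 * M * h / (1 + `|x|) ^+ k * itvI a (a + h) s) =
    4 * M * h ^+ 2 / (1 + `|x|) ^+ k.
  rewrite RintegralZl//; last exact: integrable_itvI.
  by rewrite Rintegral_itvI//; field; exact: lt0r_neq0.
rewrite -HB; apply: normc_cint => //.
- exact: cintegrableD.
- by apply: integrableRZ => //; exact: integrable_itvI.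
move=> s _.
have -> : (- itvI a (a + h) s)%:C * G (consr a x) + (itvI a (a + h) s)%:C * G (consr s x) =
   (itvI a (a + h) s)%:C * (G (consr s x) - G (consr a x)) by rewrite rmorphN; ring.
rewrite Normc.normcM normc_real itvI_E.
case: (boolP (_ && _)) => [/andP[as_ sah]|_] /=; last by rewrite normr0 mul0r mulr0.
rewrite normr1 mul1r mulr1 ler_pdivlMr//.
have E : consr s x = (s - a) *: e_ ord0 + consr a x.
  by rewrite (consrE s) (consrE a) addrA -scalerDl subrK.
have [c1 _ E1] := MVT_line (f := Re \o G) (consr a x) (s - a) (fun z => (schwartz_cder ord0 z sG).1).
have [c2 _ E2] := MVT_line (f := Im \o G) (consr a x) (s - a) (fun z => (schwartz_cder ord0 z sG).2).
have HM' c : normc (cpartial ord0 G (c *: e_ ord0 + consr a x)) * (1 + `|x|) ^+ k <= M.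
  have -> : c *: e_ ord0 + consr a x = consr (c + a) x.
    by rewrite (consrE (c + a)) (consrE a) addrA -scalerDl.
  rewrite mulrC (le_trans (HM _ _))// ler_piMr//.
  by rewrite mulr_ile1// ?inv_oneDsqr_ge0// inv_oneDsqr_le1.
have sa : `|s - a| <= h by rewrite ger0_norm ?subr_ge0// lerBlDr addrC ltW.
rewrite (@le_trans _ _ ((`|s - a| * normc (cpartial ord0 G (c1 *: e_ ord0 + consr a x)) +
  `|s - a| * normc (cpartial ord0 G (c2 *: e_ ord0 + consr a x))) * (1 + `|x|) ^+ k))//.
  rewrite ler_wpM2r ?(ltW p0)// (le_trans (normc_le _))// cReB cImB E lerD//.
    by rewrite [X in `|X|]E1 normrM ler_wpM2l// normc_Re.
  by rewrite [X in `|X|]E2 normrM ler_wpM2l// normc_Im.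
move: (HM' c1) (HM' c2) (normc_ge0 (cpartial ord0 G (c1 *: e_ ord0 + consr a x)))
  (normc_ge0 (cpartial ord0 G (c2 *: e_ ord0 + consr a x))).
move: (normc _) (normc _) => N1 N2 H1 H2 N10 N20.
rewrite (_ : 2 * M * h = h * M + h * M); last by ring.
by rewrite mulrDl -!mulrA lerD// ler_pM// mulr_ge0// ltW.
Qed.

Hypothesis T0 : forall s, T (fun x => F (consr s x)) = 0.

(** [T] kills the sampled slice, so only the quadratic error is left. *)
Lemma T_pint_itv : exists2 K, 0 <= K & forall a h, 0 <= h ->
  normc (T (pint (itvI a (a + h)) F)) <= K * h ^+ 2.
Proof.
have [c [l [c0 H]]] := tempered_bound tT.
have /choice[M HM] : forall p : nat * seq 'I_n, exists M, 0 <= M /\ forall a h x, 0 <= h ->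
    weighted p.1 p.2 (fun x => (- h)%:C * F (consr a x) + pint (itvI a (a + h)) F x) x <= M * h ^+ 2.
  by move=> p; have [M M0 HM] := pint_itv_sub p.1 p.2; exists M.
exists (c * \sum_(p <- l) M p) => [|a h h0].
  by rewrite mulr_ge0// sumr_ge0// => p _; exact: (HM p).1.
have sa := schwartz_consr a sF.
have sp : schwartz (pint (itvI a (a + h)) F).
  by apply: schwartz_pint => //; [exact: measurable_itvI|exact: itvI_le1].
have -> : T (pint (itvI a (a + h)) F) =
    T (fun x => (- h)%:C * F (consr a x) + pint (itvI a (a + h)) F x).
  by rewrite tT.1// T0 mulr0 add0r.
rewrite -mulrA mulr_suml; apply: H; first exact: schwartzL.
by move=> p x; exact: (HM p).2.
Qed.

Lemma T_pint_itvs : exists2 K, 0 <= K & forall m a h, 0 <= h ->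
  normc (T (pint (itvI a (a + m%:R * h)) F)) <= m%:R * K * h ^+ 2.
Proof.
have [K K0 HK] := T_pint_itv; exists K => // m a h h0.
elim: m => [|m IH].
  (* The empty interval is the case h = 0 of the one-interval bound. *)
  by have := HK a 0 (lexx _); rewrite mul0r expr0n /= mulr0 !mul0r.
rewrite (@T_pintD (itvI a (a + m%:R * h)) (itvI (a + m%:R * h) (a + m%:R * h + h))).
- rewrite (le_trans (le_normcD _ _))// -natr1 !mulrDl mul1r lerD//.
  exact: HK.
- exact: measurable_itvI.
- exact: measurable_itvI.
- exact: itvI_le1.
- exact: itvI_le1.
move=> s; rewrite !itvI_E -natr1 mulrDl mul1r addrA.
have mh : 0 <= m%:R * h by rewrite mulr_ge0.
case: (leP a s) => as_; case: (ltP s (a + m%:R * h)) => s1; case: (ltP s (a + m%:R * h + h)) => s2 //=; rewrite ?addr0 ?add0r//; exfalso; lra.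
Qed.

(** Outside [-r, r[ one of the two factors 1/(1 + s^2) is at most 1/(1 + r^2); the other is
    integrated. *)
Lemma T_pint_tail : exists2 K, 0 <= K & forall r, 0 <= r ->
  normc (T (pint (fun s => 1 - itvI (- r) r s) F)) <= K / (1 + r ^+ 2).
Proof.
have [c [l [c0 H]]] := tempered_bound tT.
have /choice[M HM] : forall p : nat * seq 'I_n, exists M, 0 <= M /\ forall s x,
    (1 + `|x|) ^+ p.1 * normc (cpartials (map (lift ord0) p.2) F (consr s x)) <= M * ((oneDsqr s)^-1 * (oneDsqr s)^-1).
  by move=> p; have [M M0 HM] := consr_rapid (schwartz_partials (map (lift ord0) p.2) sF) p.1; exists M.
pose I := \int[leb]_s (oneDsqr s)^-1.
have I0 : 0 <= I by apply: Rintegral_ge0 => s _; exact: inv_oneDsqr_ge0.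
exists (c * \sum_(p <- l) (2 * M p * I)) => [|r r0].
  by rewrite mulr_ge0// sumr_ge0// => p _; rewrite !mulr_ge0//; exact: (HM p).1.
have mchi : measurable_fun setT (fun s => 1 - itvI (- r) r s).
  by apply: measurable_funB => //; exact: measurable_itvI.
have bchi s : `|1 - itvI (- r) r s| <= 1.
  by rewrite itvI_E; case: (_ && _); rewrite ?subrr ?subr0 ?normr1 ?normr0.
rewrite -mulrA mulr_suml; apply: H; first exact: schwartz_pint.
move=> p x; have [M0 HMp] := HM p.
have sG := schwartz_partials (map (lift ord0) p.2) sF.
rewrite /weighted cpartials_pint//.
apply: (normc_pint mchi bchi (G := fun s => M p / (1 + r ^+ 2) * (oneDsqr s)^-1)) => //.
- by apply: integrableRZ => //; exact: integrable_inv_oneDsqr.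
- rewrite RintegralZl//; last exact: integrable_inv_oneDsqr.
  by rewrite -/I le_eqVlt; apply/orP; left; apply/eqP; ring.
- have r1 : 0 < 1 + r ^+ 2 by rewrite ltr_pwDl// sqr_ge0.
  move=> s; rewrite itvI_E; case: (boolP (_ && _)) => [_|] /=.
    by rewrite subrr normr0 mul0r mulr_ge0 ?inv_oneDsqr_ge0// mulr_ge0// invr_ge0 ltW.
  rewrite subr0 normr1 mul1r => ns; rewrite (le_trans (HMp s x))//.
  rewrite -mulrA ler_wpM2l// ler_wpM2r ?inv_oneDsqr_ge0//.
  rewrite lef_pV2 ?posrE ?oneDsqr_gt0// lerD2l.
  move: ns; rewrite negb_and -!leNgt -ltNge => /orP[ns|ns]; nra.
Qed.

(* Riemann sums in the Schwartz topology: T vanishes on the slices of F, so its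
   value on the integral over an interval of length h is O(h^2). Cutting [-N, N[
   into 2 N^3 intervals of length N^-2 leaves O(1/N), as does the tail. *)
Lemma average1 : T (fun x => cint leb setT (fun s => F (consr s x))) = 0.
Proof.
have [K1 K10 H1] := T_pint_itvs; have [K2 K20 H2] := T_pint_tail.
apply: Normc.eq0_normc; apply/eqP; rewrite eq_le normc_ge0 andbT.
have E : (fun x => cint leb setT (fun s => F (consr s x))) = pint (fun=> 1) F.
  by apply/funext => x; apply: eq_cint => // s _; rewrite mul1r.
apply/ler_addgt0Pr => d d0; rewrite add0r E.
pose N := (Num.trunc ((K2 + 2 * K1) / d)).+1.
have N0 : (0 : R) < N%:R by rewrite ltr0n.
have HN : (K2 + 2 * K1) / N%:R <= d.
  by rewrite ler_pdivrMr// [d * _]mulrC -ler_pdivrMr// ltW// /N truncnS_gt.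
apply: le_trans HN.
rewrite (@T_pintD (itvI (- N%:R) N%:R) (fun s => 1 - itvI (- N%:R) N%:R s)).
- rewrite (le_trans (le_normcD _ _))// addrC mulrDl lerD//.
    rewrite (le_trans (H2 _ (ltW N0)))// ler_wpM2l// lef_pV2 ?posrE ?ltr_pwDl ?sqr_ge0//.
    have : (1 : R) <= N%:R by rewrite ler1n.
    by nra.
  have h0 : (0 : R) <= (N%:R ^+ 2)^-1 by rewrite invr_ge0 exprn_ge0// ltW.
  have := H1 (2 * N ^ 3)%N (- N%:R) _ h0.
  have n0 : (N%:R : R) != 0 by rewrite gt_eqF.
  have -> : - N%:R + (2 * N ^ 3)%N%:R * (N%:R ^+ 2)^-1 = N%:R :> R.
    by rewrite natrM natrX; field.
  move=> /le_trans; apply; rewrite natrM natrX le_eqVlt; apply/orP; left; apply/eqP; by field.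
- exact: measurable_itvI.
- by apply: measurable_funB => //; exact: measurable_itvI.
- exact: itvI_le1.
- by move=> s; rewrite itvI_E; case: (_ && _); rewrite ?subrr ?subr0 ?normr1 ?normr0.
- by move=> s; rewrite addrC subrK.
Qed.

End average.

(** Induction on the number of parameters: all but the first are integrated out into [Psi], whose
    slices [T] kills by induction, and [average1] handles the first. *)
Lemma average m n (F : cfun R (m + n)) (T : functional R n) : schwartz F -> tempered T ->
  (forall u, T (fun x => F (row_mx u x)) = 0) ->
  T (fun x => cintegral (fun u => F (row_mx u x))) = 0.
Proof.
move=> sF tT; elim: m F sF => [|m IH] F sF T0.
  rewrite -(T0 0); congr T; apply/funext => x.
  by rewrite cintegral_rV0.
pose Psi : cfun R n.+1 := fun z =>
  cintegral (fun u => F (row_mx (consr (z 0 ord0) u) (rsubmx (z : 'rV_(1 + n))))).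
have sPsi : schwartz Psi.
  (* [L] regroups ((s, x), u) as ((s, u), x); [M] is the same map with m and n exchanged, and undoes
     it. *)
  pose L (w : 'rV[R]_(n.+1 + m)) : 'rV[R]_(m.+1 + n) :=
    row_mx (consr (lsubmx w 0 ord0) (rsubmx w)) (rsubmx (lsubmx w : 'rV_(1 + n))).
  pose M (v : 'rV[R]_(m.+1 + n)) : 'rV[R]_(n.+1 + m) :=
    row_mx (consr (lsubmx v 0 ord0) (rsubmx v)) (rsubmx (lsubmx v : 'rV_(1 + m))).
  have lc a b : lin (fun w : 'rV[R]_(a.+1 + b) =>
      row_mx (consr (lsubmx w 0 ord0) (rsubmx w)) (rsubmx (lsubmx w : 'rV_(1 + a)))).
    move=> k x y; rewrite -row_mx_lin !linearD !linearZ /=; congr row_mx.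
    apply/rowP => i; rewrite [RHS]mxE [X in _ = X + _]mxE.
    by case: (unliftP ord0 i) => [j|] ->; rewrite ?consrS ?consr0 !mxE.
  have cK a b (w : 'rV[R]_(a.+1 + b)) : row_mx
      (consr (lsubmx (row_mx (consr (lsubmx w 0 ord0) (rsubmx w)) (rsubmx (lsubmx w : 'rV_(1 + a)))) 0 ord0)
        (rsubmx (row_mx (consr (lsubmx w 0 ord0) (rsubmx w)) (rsubmx (lsubmx w : 'rV_(1 + a))))))
      (rsubmx (lsubmx (row_mx (consr (lsubmx w 0 ord0) (rsubmx w)) (rsubmx (lsubmx w : 'rV_(1 + a)))) : 'rV_(1 + b))) = w.
    rewrite !row_mxKl !row_mxKr consr0 -[RHS]hsubmxK; congr row_mx.
      apply/rowP => i; case: (unliftP ord0 i) => [j|] ->; rewrite ?consrS ?consr0 //.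
      by rewrite !mxE; congr (w 0 _); exact/val_inj.
  have := schwartz_cintegral (schwartz_lin (lc n m) (lc m n) (@cK n m) sF).
  by under [X in schwartz X -> _]eq_fun do under eq_fun do rewrite row_mxKl row_mxKr.
have E x : cintegral (fun u => F (row_mx u x)) = cint leb setT (fun s => Psi (consr s x)).
  rewrite (cintegral_cons1 (schwartz_slicel x sF)).
  apply: eq_cint => // s _; rewrite /Psi consr0.
  by apply: eq_cintegral => u; rewrite /consr row_mxKr.
under [X in T X]eq_fun do rewrite E.
apply: average1 => // s.
have := IH (fun w => F (consr s w)) (schwartz_consr s sF).
under [X in (_ -> T X = 0) -> _]eq_fun do under eq_fun do rewrite consr_row_mx.
have E' x : Psi (consr s x) = cintegral (fun u => F (row_mx (consr s u) x)).
  by rewrite /Psi consr0; apply: eq_cintegral => u; rewrite /consr row_mxKr.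
under [X in _ -> T X = 0]eq_fun do rewrite E'.
apply=> u; under [X in T X]eq_fun do rewrite consr_row_mx.
exact: T0.
Qed.

(** * Totality of the Wigner distributions *)

Lemma kill_modulations n (T : functional R n) (H K : cfun R n) :
  tempered T -> schwartz H -> schwartz K ->
  (forall w, T (fun x => cis (2 * pi * dotp w x) * K x) = 0) ->
  T (fun x => H x * K x) = 0.
Proof.
move=> tT sH sK T0.
have sF : schwartz (fun z : 'rV_(n + n) =>
    cis (2 * pi * dotp (lsubmx z) (rsubmx z)) * (ft H (lsubmx z) * K (rsubmx z))).
  have := @schwartz_cis_dotp R (n + n) n _ lsubmx rsubmx 0 0 (2 * pi) _ _ (schwartz_tens (schwartz_ft sH) sK).
  under [X in (_ -> _ -> schwartz X) -> _]eq_fun do rewrite !addr0.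
  by apply => k x y; rewrite linearD linearZ.
have := average sF tT.
under [X in (_ -> T X = 0) -> _]eq_fun do under eq_fun do rewrite row_mxKl row_mxKr.
have E x : cintegral (fun w => cis (2 * pi * dotp w x) * (ft H w * K x)) = H x * K x.
  rewrite [RHS]mulrC -(ft_inv x sH) -cintegralZ; last first.
    apply: schwartz_integrable; have := schwartz_cis x (2 * pi) (schwartz_ft sH).
    by under [X in schwartz X -> _]eq_fun do rewrite dotpC.
  by apply: eq_cintegral => w; ring.
under [X in (_ -> T X = 0) -> _]eq_fun do rewrite E.
apply=> w.
have -> : (fun x => cis (2 * pi * dotp (lsubmx (row_mx w x)) (rsubmx (row_mx w x))) *
    (ft H (lsubmx (row_mx w x)) * K (rsubmx (row_mx w x)))) =
    fun x => ft H w * (cis (2 * pi * dotp w x) * K x).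
  by apply/funext => x; rewrite row_mxKl row_mxKr mulrCA.
by rewrite temperedZ// ?T0 ?mulr0//; exact: schwartz_cis.
Qed.

Lemma kill_translates n (T : functional R n) (F th : cfun R n) :
  tempered T -> schwartz F -> schwartz th ->
  (forall u, T (fun x => F x * th (x - u)) = 0) ->
  cintegral th * T F = 0.
Proof.
move=> tT sF sth T0.
have sG : schwartz (fun z : 'rV_(n + n) => F (rsubmx z) * th (rsubmx z - lsubmx z)).
  have := @schwartz_comb R n _ 0 1 (-1) 1 _ (schwartz_tens sF sth).
  under [X in (_ -> schwartz X) -> _]eq_fun do
    rewrite row_mxKl row_mxKr scale0r add0r !scale1r scaleN1r addrC.
  by apply; rewrite mul0r sub0r mulNr opprK mul1r oner_neq0.
rewrite -temperedZ// -[RHS](average sG tT).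
  congr T; apply/funext => x; rewrite mulrC -(cintegral_opp x sth) -cintegralZ; last first.
    exact: (schwartz_integrable (schwartz_reflect x sth)).
  by apply: eq_cintegral => u; rewrite row_mxKl row_mxKr.
move=> u; rewrite -[RHS](T0 u); congr T; apply/funext => x.
by rewrite row_mxKl row_mxKr.
Qed.

(** Modulated Gaussians dilated by e tend to pure characters as e tends to 0, so testing against
    them shows that the Fourier transform of [h] vanishes; inversion concludes. *)
Lemma schwartz_nondegenerate n (h : cfun R n) : schwartz h ->
  (forall f, schwartz f -> cintegral (fun x => h x * f x) = 0) -> forall x, h x = 0.
Proof.
move=> sh H0.
suff F0 w : ft h w = 0.
  move=> x; rewrite -(ft_inv x sh) -(mul0r (cintegral (fun _ : 'rV[R]_n => 0 : C))).
  rewrite -cintegralZ; last exact: schwartz_integrable (schwartz0 n).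
  by apply: eq_cintegral => w; rewrite F0 mulr0 mul0r.
have sg := @schwartz_gauss R n.
have [K HK] := cintegral_dilate (ft_integrable w sh) sg.
have := eq_of_dilate HK (b := 0) (L := 0).
rewrite /gauss dotp0l mulr0 expR0 mul1r; apply=> e e0.
have sge := schwartz_scale 0 (lt0r_neq0 e0) sg.
rewrite (_ : cintegral _ = 0).
  by rewrite subr0 mulr0 (_ : normc 0 = 0)//; exact: Normc.normc0.
rewrite -(H0 (fun t => cis (- (2 * pi * dotp w t)) * gauss (e *: t + 0))); last exact: ft_integrable.
by apply: eq_cintegral => t; rewrite addr0; ring.
Qed.

(** [psi] and [phi] are shifts of [g] centred at [u]: times u1 - w2/2 and u1 + w2/2, frequencies u2
    + w1/2 and u2 - w1/2. The substitution t -> t + w2 cancels the modulation in the frequency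
    variable and leaves the constant phase of u2.w2, which is put into [psi]. *)
Lemma wigner_covariance d (g : cfun R d) (u w : 'rV[R]_(d + d)) : schwartz g ->
  exists psi phi, [/\ schwartz psi, schwartz phi &
    forall z, cis (2 * pi * dotp w z) * wigner g g (z - u) = wigner psi phi z].
Proof.
move=> sg.
set u1 := lsubmx u; set u2 := rsubmx u; set w1 := lsubmx w; set w2 := rsubmx w.
pose psi a := cis (2 * pi * dotp u2 w2) *
  (cis (pi * dotp (2 *: u2 + w1) a) * g (a + (2^-1 *: w2 - u1))).
pose phi b := cis (pi * dotp (2 *: u2 - w1) b) * g (b + (- (2^-1 *: w2) - u1)).
have st c : schwartz (fun a => g (a + c)).
  have := schwartz_scale c (oner_neq0 _) sg.
  by under [X in schwartz X -> _]eq_fun do rewrite scale1r.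
exists psi, phi; split.
- by apply: schwartzZ; exact: (schwartz_cis _ _ (st _)).
- exact: (schwartz_cis _ _ (st _)).
move=> z; rewrite !wigner_ft.
set x := lsubmx z; set xi := rsubmx z.
rewrite !linearB /= -/x -/xi -/u1 -/u2.
have si : schwartz (fun t => cis (- (2 * pi * dotp (xi - u2) t)) * wint g g (x - u1) t).
  exact: (ft_integrable _ (schwartz_wint _ sg sg)).
rewrite /ft -(cintegral_translate w2 si) -cintegralZ; last first.
  have := schwartz_scale w2 (oner_neq0 _) si.
  by under [X in schwartz X -> _]eq_fun do rewrite scale1r; exact: schwartz_integrable.
apply: eq_cintegral => t; rewrite /wint /psi /phi conjcM conj_cis.
have -> : x + 2^-1 *: t + (2^-1 *: w2 - u1) = x - u1 + 2^-1 *: (t + w2).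
  by apply/rowP => i; rewrite !mxE; ring.
have -> : x - 2^-1 *: t + (- (2^-1 *: w2) - u1) = x - u1 - 2^-1 *: (t + w2).
  by apply/rowP => i; rewrite !mxE; ring.
set a := g _; set b := conjc _.
have -> : dotp w z = dotp w1 x + dotp w2 xi.
  by rewrite /dotp big_split_ord /w1 /w2 /x /xi; congr (_ + _); apply: eq_bigr => i _; rewrite !mxE.
suff E : cis (2 * pi * (dotp w1 x + dotp w2 xi)) * cis (- (2 * pi * dotp (xi - u2) (t + w2))) =
  cis (- (2 * pi * dotp xi t)) * (cis (2 * pi * dotp u2 w2) *
    cis (pi * dotp (2 *: u2 + w1) (x + 2^-1 *: t)) *
    cis (- (pi * dotp (2 *: u2 - w1) (x - 2^-1 *: t)))).
  by rewrite mulrA E; ring.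
rewrite -!cisD; congr cis.
rewrite !(dotpDl, dotpDr, dotpNl, dotpNr, dotpZl, dotpZr) [dotp w2 xi]dotpC.
by field.
Qed.

Lemma wigner_total d (T : functional R (d + d)) : tempered T ->
  (forall psi phi, schwartz psi -> schwartz phi -> T (wigner psi phi) = 0) ->
  forall F, schwartz F -> T F = 0.
Proof.
move=> tT T0 F sF; have sg := @schwartz_gauss R d.
pose G := wigner (@gauss R d) (@gauss R d).
have sG : schwartz G by exact: schwartz_wigner.
have G0 : G 0 <> 0.
  move=> E; have : cintegral (@gauss R d) = 0; last first.
    by rewrite cintegral_gauss => /eqP; rewrite oner_eq0.
  (* At the origin the integrand g(t/2) g(-t/2) is exp(- pi |t|^2 / 2), the Gaussian dilated by
     1/sqrt 2; were its integral 0, so would be that of g. *)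
  pose a : R := (Num.sqrt 2)^-1.
  have a0 : a != 0 by rewrite invr_eq0 gt_eqF// sqrtr_gt0.
  rewrite (cintegral_scale 0 sg a0) (_ : cintegral _ = 0) ?mulr0// -[RHS]E.
  apply: eq_cintegral => t; rewrite addr0 !linear0 dotp0l mulr0 oppr0 cis0 mulr1.
  rewrite add0r sub0r /gauss !dotpNr !dotpNl opprK conjc_real -rmorphM -expRD !dotpZl !dotpZr.
  have aa : a * a = 2^-1 by rewrite -expr2 /a exprVn sqr_sqrtr.
  by congr ((expR _)%:C); rewrite [a * (a * _)]mulrA aa; field.
have key th : schwartz th -> cintegral (fun x => G x * th x) * T F = 0.
  move=> sth; apply: kill_translates => //; first exact: schwartz_mul.
  move=> u.
  have sGu : schwartz (fun x => G (x - u)).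
    have := schwartz_scale (- u) (oner_neq0 _) sG.
    by under [X in schwartz X -> _]eq_fun do rewrite scale1r.
  have stu : schwartz (fun x => th (x - u)).
    have := schwartz_scale (- u) (oner_neq0 _) sth.
    by under [X in schwartz X -> _]eq_fun do rewrite scale1r.
  rewrite (_ : (fun x => _) = fun x => (F x * th (x - u)) * G (x - u)); last first.
    by apply/funext => x; ring.
  apply: kill_modulations => //; first exact: schwartz_mul.
  move=> w; have [psi [phi [s1 s2 E]]] := wigner_covariance u w sg.
  by rewrite -(T0 _ _ s1 s2); congr T; apply/funext.
(* If T F were nonzero, [key] would make the integral of G th vanish for all th, hence G(0) = 0. *)
apply: contrapT => TF; apply: G0.
apply: (schwartz_nondegenerate sG) => th /key /eqP.
by rewrite mulf_eq0 => /orP[/eqP//|/eqP].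
Qed.

End wigner_totality.

(** * Weyl symbols *)

Section weyl_symbols.
Context {R : realType}.
Local Notation C := R[i].
Local Notation normc := (@Normc.normc R).
Local Open Scope complex_scope.

Lemma conjfK n (f : cfun R n) : conjf (conjf f) = f.
Proof. by apply/funext => x; rewrite /conjf conjcK. Qed.

Lemma weighted_le_seminorm n k s (f : cfun R n) x : schwartz f ->
  weighted k s f x <= seminorm k s f.
Proof. by move=> sf; apply: ub_le_sup; [exact: sf.2|exists x]. Qed.

Lemma temperedB n (T U : functional R n) : tempered T -> tempered U ->
  tempered (fun f => T f - U f).
Proof.
move=> tT tU; split=> [a f g sf sg|]; first by rewrite tT.1// tU.1//; ring.
have [c [l [c0 H]]] := tempered_bound tT.
have [c' [l' [c0' H']]] := tempered_bound tU.
exists (c + c'), (l ++ l') => f sf.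
have sge0 p : 0 <= seminorm p.1 p.2 f.
  by rewrite (le_trans (weighted_ge0 p.1 p.2 f 0))//; exact: weighted_le_seminorm.
have Hs p x : weighted p.1 p.2 f x <= seminorm p.1 p.2 f by exact: weighted_le_seminorm.
rewrite (le_trans (le_normcD _ _))// normcN mulrDl big_cat mulrDr mulrDr /=.
rewrite lerD//.
  by rewrite (le_trans (H f (fun p => seminorm p.1 p.2 f) sf Hs))// lerDl mulr_ge0// sumr_ge0.
by rewrite (le_trans (H' f (fun p => seminorm p.1 p.2 f) sf Hs))// lerDr mulr_ge0// sumr_ge0.
Qed.

(** Turns a Schwartz symbol into one for [is_symbol], so that [symbol_uniq] applies to both
    kinds. *)
Lemma tempered_dist_of n (c : cfun R n) : schwartz c -> tempered (dist_of c).
Proof.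
move=> sc; split=> [a f g sf sg|].
  have icf := schwartz_integrable (schwartz_mul sc sf).
  have icg := schwartz_integrable (schwartz_mul sc sg).
  have iacf := schwartz_integrable (schwartzZ a (schwartz_mul sc sf)).
  rewrite /dist_of -cintegralZ// -cintegralD//.
  by apply: eq_cintegral => x; ring.
have [M M0 HM] := rapid_maj (schwartz_rapid sc).
pose I := \int[lebesgue_tuple R n]_t maj (rowt t).
exists (2 * (M * I)), [:: (0%N, [::])] => f sf; rewrite big_seq1 /dist_of cintegralE.
have s0 : 0 <= seminorm 0 [::] f.
  by rewrite (le_trans (weighted_ge0 0 [::] f 0))//; exact: weighted_le_seminorm.
have E : 2 * (M * I) * seminorm 0 [::] f =
    2 * \int[lebesgue_tuple R n]_t (M * seminorm 0 [::] f * maj (rowt t)).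
  by rewrite RintegralZl//; [rewrite -/I; ring|exact: integrable_maj].
rewrite E; apply: normc_cint => //.
- exact: schwartz_integrable (schwartz_mul sc sf).
- by apply: integrableRZ => //; exact: integrable_maj.
move=> t _ /=; rewrite Normc.normcM mulrAC ler_pM ?normc_ge0//.
have := weighted_le_seminorm 0 [::] (rowt t) sf.
by rewrite /weighted expr0 mul1r.
Qed.

Lemma symbol_uniq d (A : operator R d) (a b : functional R (d + d)) :
  is_symbol A a -> is_symbol A b -> eq_dist a b.
Proof.
move=> [ta Ea] [tb Eb] f sf; apply/eqP; rewrite -subr_eq0; apply/eqP.
apply: (wigner_total (temperedB ta tb)) sf => psi phi s1 s2.
(* [weyl] conjugates its second argument, so the operators are tested at the conjugate of [phi]. *)
rewrite -[phi]conjfK; have s3 := schwartz_conj s2.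
by have := Ea _ s1 _ s3; rewrite (Eb _ s1 _ s3) /weyl => ->; rewrite subrr.
Qed.

Lemma symbolE d (A : operator R d) (a : functional R (d + d)) :
  is_symbol A a -> eq_dist (symbol A) a.
Proof. by move=> Aa; apply: (symbol_uniq _ Aa); exact: (xgetPex _ (ex_intro _ _ Aa)). Qed.

(** Equality of functions and not only of distributions, as [op_pair] evaluates a functional at the
    chosen symbol; [schwartz_nondegenerate] upgrades one to the other. *)
Lemma schwartz_symbolE d (A : operator R d) (a : cfun R (d + d)) :
  is_schwartz_symbol A a -> schwartz_symbol A = a.
Proof.
move=> Aa; have [sb Eb] : is_schwartz_symbol A (schwartz_symbol A).
  exact: (xgetPex _ (ex_intro _ _ Aa)).
have [sa Ea] := Aa; set b := schwartz_symbol A in sb Eb *.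
have E := symbol_uniq (conj (tempered_dist_of sb) Eb) (conj (tempered_dist_of sa) Ea).
apply/funext => x; apply/eqP; rewrite -subr_eq0; apply/eqP.
apply: (schwartz_nondegenerate (schwartzB sb sa)) x => f sf.
have := E f sf; rewrite /dist_of => Ef.
have ia := schwartz_integrable (schwartzZ (-1) (schwartz_mul sa sf)).
have ib := schwartz_integrable (schwartz_mul sb sf).
rewrite -(subrr (cintegral (fun x => a x * f x))) -{1}Ef -mulN1r.
rewrite -cintegralZ; last exact: schwartz_integrable (schwartz_mul sa sf).
by rewrite -cintegralD//; apply: eq_cintegral => x; ring.
Qed.

(** Both halves of the theorem are instances: [weyl phi] with symbol [phi], and [check_op A] with
    the reflected symbol of [A]. *)
Lemma cohen_star d (A : operator R d) (a : functional R (d + d)) (psi : cfun R d) :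
  is_symbol A a -> schwartz psi ->
  eq_dist (star_op_op (rank_one psi) A) (cohen a psi).
Proof.
move=> Aa spsi f sf; rewrite /star_op_op /op_pair.
rewrite (schwartz_symbolE (star_symbol sf spsi)).
by rewrite (symbolE Aa)//; exact: (star_symbol sf spsi).1.
Qed.

(** Each derivative contributes a sign, so reflection does not increase the seminorms; hence
    reflected tempered distributions are tempered. *)
Lemma cpartials_reflect n s (f : cfun R n) : schwartz f ->
  cpartials s (reflect_fun f) = fun x => (-1) ^+ size s * cpartials s f (- x).
Proof.
move=> sf; elim: s => [|i s IH] /=; first by apply/funext => x; rewrite mul1r.
rewrite IH; have sh := schwartz_partials s sf; apply/funext => x; apply: cder_uniq.
have H : cder (fun x => cpartials s f (- x)) x (e_ i) (- cpartial i (cpartials s f) (- x)).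
  apply: (@cder_affine _ _ _ -%R _ _ _ (- e_ i)).
    by move=> h; rewrite opprD scalerN.
  have := schwartz_dir (- x) (- e_ i) sh.
  congr cder; rewrite (bigD1 i)//= big1 => [|j ji]; rewrite !mxE ?eqxx.
    by rewrite addr0 rmorphN rmorph1 mulN1r.
  by rewrite (negPf ji) oppr0 mul0r.
by have := cderZ ((-1) ^+ size s) H; rewrite exprS; congr cder; ring.
Qed.

Lemma tempered_reflect n (T : functional R n) : tempered T -> tempered (reflect_dist T).
Proof.
move=> tT; split=> [a f g sf sg|].
  exact: tT.1 a _ _ (schwartz_reflect_fun sf) (schwartz_reflect_fun sg).
have [c [l [c0 H]]] := tempered_bound tT.
exists c, l => f sf; apply: H => [|p x]; first exact: schwartz_reflect_fun.
rewrite (le_trans _ (weighted_le_seminorm p.1 p.2 (- x) sf))// /weighted normrN.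
rewrite cpartials_reflect// Normc.normcM ler_wpM2l ?exprn_ge0 ?addr_ge0//.
rewrite (_ : normc _ = 1) ?mul1r//.
by elim: (size _) => [|k IH]; rewrite ?expr0 ?exprS ?Normc.normcM ?normcN ?Normc.normc1 ?mul1r.
Qed.

Lemma wigner_reflect d (psi phi : cfun R d) : schwartz psi -> schwartz phi ->
  wigner (reflect_fun psi) (reflect_fun phi) = reflect_fun (wigner psi phi).
Proof.
move=> s1 s2; apply/funext => z; rewrite /reflect_fun !wigner_ft.
have si := ft_integrable (rsubmx (- z)) (schwartz_wint (lsubmx (- z)) s1 s2).
rewrite [RHS]/ft -(cintegral_opp 0 si); apply: eq_cintegral => t.
rewrite sub0r !linearN /= dotpNl dotpNr opprK; congr (_ * _).
rewrite /wint; congr (psi _ * conjc (phi _)).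
  by rewrite opprD scalerN.
by rewrite opprB scalerN opprK addrC.
Qed.

Lemma symbol_check d (A : operator R d) (a : functional R (d + d)) :
  is_symbol A a -> is_symbol (check_op A) (reflect_dist a).
Proof.
move=> [ta Ea]; split; first exact: tempered_reflect.
move=> psi s1 phi s2; have s1' := schwartz_reflect_fun s1; have s2' := schwartz_reflect_fun s2.
rewrite /check_op {1}/reflect_dist (Ea _ s1' _ s2') /weyl /reflect_dist.
by rewrite -wigner_reflect//; exact: schwartz_conj.
Qed.

End weyl_symbols.

Theorem proposition7p1 (R : realType) (d : nat) :
  (forall phi : functional R (d + d), tempered phi ->
    forall psi : cfun R d, schwartz psi ->
      eq_dist (cohen phi psi) (star_op_op (rank_one psi) (weyl phi)))
  /\
  (forall A : operator R d, frakS' A ->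
    cohen_class (fun psi => star_op_op (rank_one psi) (check_op A))).
Proof.
split=> [phi tphi psi spsi f sf|A [a Aa]].
  (* That [phi] is a symbol of [weyl phi] holds by definition. *)
  by rewrite (@cohen_star _ _ _ phi).
have Ac := symbol_check Aa.
by exists (reflect_dist a) => [|psi spsi]; [exact: Ac.1|exact: cohen_star].
Qed.
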